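(* Let $T$ be the tetrahedron whose four faces are congruent isosceles triangles with two sides of length $\sqrt{3}$ and one side of length $2$ (equivalently, one of three congruent tetrahedra into which a triangular prism is cut), scaled to unit volume. Then $T$ admits an orientation-preserving face-to-face tiling of $\mathbb{R}^3$, and $T$ has least surface area among all unit-volume tetrahedra admitting an orientation-preserving face-to-face tiling of $\mathbb{R}^3$.
   Context: A face-to-face tiling of $\mathbb{R}^3$ by a polyhedron is a covering of $\mathbb{R}^3$ by congruent copies of it with pairwise disjoint interiors, such that any two tiles meet only along entire faces, entire edges, at vertices, or not at all. Such a tiling is orientation-preserving if any two tiles are equivalent under an orientation-preserving isometry of $\mathbb{R}^3$. *)

(* Defs.v *)
From Stdlib Require Import Reals.
Open Scope R_scope.

Record pt : Type := mkpt { px : R; py : R; pz : R }.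

Definition vsub (p q : pt) : pt := mkpt (px p - px q) (py p - py q) (pz p - pz q).
Definition dot (u v : pt) : R := px u * px v + py u * py v + pz u * pz v.
Definition cross (u v : pt) : pt :=
  mkpt (py u * pz v - pz u * py v) (pz u * px v - px u * pz v) (px u * py v - py u * px v).
Definition det3 (u v w : pt) : R := dot u (cross v w).

Definition dist (p q : pt) : R := sqrt (dot (vsub p q) (vsub p q)).

(* six times the signed volume of the oriented tetrahedron (a,b,c,d) *)
Definition sv (a b c d : pt) : R := det3 (vsub b a) (vsub c a) (vsub d a).

Record tet : Type := mktet { v0 : pt; v1 : pt; v2 : pt; v3 : pt }.

Definition tvol (t : tet) : R := Rabs (sv (v0 t) (v1 t) (v2 t) (v3 t)) / 6.

Definition tri_area (a b c : pt) : R :=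
  sqrt (dot (cross (vsub b a) (vsub c a)) (cross (vsub b a) (vsub c a))) / 2.

Definition tarea (t : tet) : R :=
  tri_area (v0 t) (v1 t) (v2 t) + tri_area (v0 t) (v1 t) (v3 t)
  + tri_area (v0 t) (v2 t) (v3 t) + tri_area (v1 t) (v2 t) (v3 t).

Definition hull_sub (t : tet) (b0 b1 b2 b3 : bool) (x : pt) : Prop :=
  exists l0 l1 l2 l3 : R,
    0 <= l0 /\ 0 <= l1 /\ 0 <= l2 /\ 0 <= l3 /\ l0 + l1 + l2 + l3 = 1 /\
    (b0 = false -> l0 = 0) /\ (b1 = false -> l1 = 0) /\
    (b2 = false -> l2 = 0) /\ (b3 = false -> l3 = 0) /\
    px x = l0 * px (v0 t) + l1 * px (v1 t) + l2 * px (v2 t) + l3 * px (v3 t) /\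
    py x = l0 * py (v0 t) + l1 * py (v1 t) + l2 * py (v2 t) + l3 * py (v3 t) /\
    pz x = l0 * pz (v0 t) + l1 * pz (v1 t) + l2 * pz (v2 t) + l3 * pz (v3 t).

Definition hull (t : tet) : pt -> Prop := hull_sub t true true true true.

Definition seteq (A B : pt -> Prop) : Prop := forall x, A x <-> B x.

(* F is a face of t: a vertex, an entire edge or an entire facet, i.e. the
   convex hull of a nonempty proper subset of the vertices. *)
Definition face_of (t : tet) (F : pt -> Prop) : Prop :=
  exists b0 b1 b2 b3 : bool,
    (b0 || b1 || b2 || b3)%bool = true /\ (b0 && b1 && b2 && b3)%bool = false /\
    seteq F (hull_sub t b0 b1 b2 b3).

Definition interior (A : pt -> Prop) (x : pt) : Prop :=
  exists e : R, 0 < e /\ forall y, dist x y < e -> A y.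

Definition image (f : pt -> pt) (A : pt -> Prop) (y : pt) : Prop :=
  exists x, A x /\ f x = y.

Definition isometry (f : pt -> pt) : Prop := forall x y, dist (f x) (f y) = dist x y.

Definition orient_pres (f : pt -> pt) : Prop :=
  forall a b c d, 0 < sv a b c d -> 0 < sv (f a) (f b) (f c) (f d).

Definition ftf_tiling (T : tet) (I : Type) (tile : I -> tet) : Prop :=
  (forall i, exists f, isometry f /\ seteq (hull (tile i)) (image f (hull T))) /\
  (forall x, exists i, hull (tile i) x) /\
  (forall i j, i <> j -> forall x,
      ~ (interior (hull (tile i)) x /\ interior (hull (tile j)) x)) /\
  (forall i j, i <> j ->
      (forall x, ~ (hull (tile i) x /\ hull (tile j) x)) \/
      (exists F, face_of (tile i) F /\ face_of (tile j) F /\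
                 seteq (fun x => hull (tile i) x /\ hull (tile j) x) F)).

Definition op_ftf_tiling (T : tet) (I : Type) (tile : I -> tet) : Prop :=
  ftf_tiling T I tile /\
  (forall i j, exists f, isometry f /\ orient_pres f /\
      seteq (hull (tile j)) (image f (hull (tile i)))).

Definition admits_op_ftf_tiling (T : tet) : Prop :=
  exists (I : Type) (tile : I -> tet), op_ftf_tiling T I tile.

Definition isos_face (s : R) (a b c : pt) : Prop :=
  (dist a b = 2 * s /\ dist b c = sqrt 3 * s /\ dist a c = sqrt 3 * s) \/
  (dist b c = 2 * s /\ dist a b = sqrt 3 * s /\ dist a c = sqrt 3 * s) \/
  (dist a c = 2 * s /\ dist a b = sqrt 3 * s /\ dist b c = sqrt 3 * s).

Definition is_scaled_special (T : tet) : Prop :=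
  exists s : R, 0 < s /\
    isos_face s (v0 T) (v1 T) (v2 T) /\ isos_face s (v0 T) (v1 T) (v3 T) /\
    isos_face s (v0 T) (v2 T) (v3 T) /\ isos_face s (v1 T) (v2 T) (v3 T).

(* Main.v *)
(** The special tetrahedron is an alcove of the affine Weyl group of type A3, so it tiles space: in the
    basis (-1,1,1), (1,-1,1), (1,1,-1) its copies are the Kuhn simplices of the cubic lattice.

    For the lower bound, label all tiles by a fixed tetrahedron. Tiles are locally finite, so each facet
    has a neighbour, and turning around an edge gives a closed cycle of tiles whose dihedral angles sum to
    2 PI. Since all tiles have the same orientation, gluing the facets forces equalities between edge
    lengths: either the tetrahedron is symmetric in a plane, or its edges have two lengths, each occurring
    along a path of three edges. In the second case the cycles contradict the positivity of the spherical
    excess at the vertices unless some dihedral angle is at least 120 degrees. In the first case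
    consecutive facets around an edge mostly alternate between two congruence types, hence the number of
    tiles there is even and the dihedral angle is 90 or at most 60 degrees; the few remaining coincidences
    of lengths are settled by explicit computation.

    Writing S0, .., S3 for the area vectors of the faces, with sum 0, one has
    9 volume^2 = 2 |det (S1, S2, S3)|, and bounding this determinant under the resulting conditions on the
    angles between the Si shows that the area is at least that of the special tetrahedron. *)

From Stdlib Require Import Reals Lra Lia ZArith List Bool Classical ClassicalEpsilon.
Require Import Defs.
Import ListNotations.
Open Scope R_scope.

(** * Area bounds from dihedral angles *)

(** A tiling is given only through hulls and isometries, without labels, adjacency or finiteness.
    The lower bound needs just one finite trace of it: around each edge a closed cycle of vertex
    labellings, in which neighbours agree on the lengths in the glued facet and, all tiles being
    equally oriented, have the same parity. Tiles around one edge may meet it along edges with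
    different labels but equal lengths, so every coincidence of lengths is a case of its own.
    Lengths are therefore replaced by small codes, and the combinatorial claims become finite
    computations over the 24 labellings.

    The area bound is carried in the homogeneous form [8192 * sv^4 <= (sum of doubled face
    areas)^6], so the volume is normalised only at the end. Only the case of a ring of four edges
    with angles of at most 60 degrees is sharp. All other cases leave room, which permits replacing
    square roots by rational linear forms and then applying the inequality of the means. *)

Definition norm (u : pt) : R := sqrt (dot u u).

Lemma dot_ge0 u : 0 <= dot u u.
Proof. unfold dot; nra. Qed.

Lemma norm_ge0 u : 0 <= norm u.
Proof. apply sqrt_pos. Qed.

Lemma norm_sq u : norm u * norm u = dot u u.
Proof. apply sqrt_sqrt, dot_ge0. Qed.

Lemma lagrange u v : dot (cross u v) (cross u v) = dot u u * dot v v - dot u v * dot u v.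
Proof. destruct u, v; unfold dot, cross; simpl; ring. Qed.

Lemma cauchy u v : dot u v <= norm u * norm v.
Proof.
  assert (H := dot_ge0 (cross u v)); rewrite lagrange in H.
  rewrite <- !norm_sq in H.
  pose proof (Rmult_le_pos _ _ (norm_ge0 u) (norm_ge0 v)).
  destruct (Rle_or_lt (dot u v) (norm u * norm v)); auto; nra.
Qed.

Lemma cauchy_two_sided u v : - (norm u * norm v) <= dot u v <= norm u * norm v.
Proof.
  split; [|apply cauchy].
  assert (H := dot_ge0 (cross u v)); rewrite lagrange in H.
  rewrite <- !norm_sq in H.
  pose proof (Rmult_le_pos _ _ (norm_ge0 u) (norm_ge0 v)).
  destruct (Rle_or_lt (- (norm u * norm v)) (dot u v)); auto; nra.
Qed.

Definition vadd (p q : pt) : pt := mkpt (px p + px q) (py p + py q) (pz p + pz q).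
Definition vopp (p : pt) : pt := mkpt (- px p) (- py p) (- pz p).

(* The sum of two vectors as the base of a triangle of perimeter [|x| + |y| + |x+y|]:
   among such triangles the isosceles one is the highest. *)
Lemma isosceles_bound x y :
  dot (vadd x y) (vadd x y) * dot (vadd x y) (vadd x y) + 4 * dot (cross x y) (cross x y)
  <= (norm x + norm y) * (norm x + norm y) * dot (vadd x y) (vadd x y).
Proof.
  rewrite lagrange.
  replace (dot (vadd x y) (vadd x y)) with (dot x x + dot y y + 2 * dot x y)
    by (destruct x, y; unfold dot, vadd; simpl; ring).
  rewrite <- !norm_sq.
  pose proof (cauchy_two_sided x y).
  set (a := norm x) in *; set (b := norm y) in *; set (d := dot x y) in *.
  assert (0 <= (a*b - d) * ((a-b)*(a-b))) by (apply Rmult_le_pos; [lra|apply Rle_0_sqr]).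
  nra.
Qed.

(** The vector product of [s1 x u] and [s2 x u] is, up to sign, [det3 s1 s2 u] times [u], and its
    length is at most the product of the lengths of its factors. *)
Lemma cross_det_bound s1 s2 u :
  det3 s1 s2 u * det3 s1 s2 u * dot u u
  <= dot (cross s1 u) (cross s1 u) * dot (cross s2 u) (cross s2 u).
Proof.
  assert (H := dot_ge0 (cross (cross s1 u) (cross s2 u))).
  pose proof (lagrange (cross s1 u) (cross s2 u)) as HL.
  assert (E : dot (cross (cross s1 u) (cross s2 u)) (cross (cross s1 u) (cross s2 u))
          = det3 s1 s2 u * det3 s1 s2 u * dot u u)
    by (destruct s1, s2, u; unfold det3, dot, cross; simpl; ring).
  nra.
Qed.

(** For area vectors, [dot si sj] is minus the cosine of the dihedral angle times both norms, so the
    hypotheses say that four angles are at most 60 degrees. Let [t] be the squared length of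
    [s2 + s3 = -(s0 + s1)], and [x], [y] the sums of norms of the two pairs. The four hypotheses add
    up to [t >= x y / 2], and the isosceles bounds give [16 D^2 <= t (x^2 - t) (y^2 - t) <= t (x y -
    t)^2]. With [x y <= ((x + y) / 2)^2] the constant becomes [8 * 16 * 64 = 8192]. *)
Lemma four_small_angles_vec s0 s1 s2 s3 :
  vadd s0 s1 = vopp (vadd s2 s3) ->
  dot s0 s2 <= - (norm s0 * norm s2) / 2 -> dot s0 s3 <= - (norm s0 * norm s3) / 2 ->
  dot s1 s2 <= - (norm s1 * norm s2) / 2 -> dot s1 s3 <= - (norm s1 * norm s3) / 2 ->
  8192 * (det3 s1 s2 s3) ^ 2 <= (norm s0 + norm s1 + norm s2 + norm s3) ^ 6.
Proof.
  intros Hs H02 H03 H12 H13.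
  set (u := vadd s2 s3).
  assert (Eu : dot u u = - (dot s0 s2 + dot s0 s3 + dot s1 s2 + dot s1 s3)).
  { replace (dot u u) with (- dot (vadd s0 s1) u).
    - unfold u; destruct s0, s1, s2, s3; unfold dot, vadd; simpl; ring.
    - rewrite Hs; fold u; destruct u; unfold dot, vopp; simpl; ring. }
  pose proof (isosceles_bound s2 s3) as I1; fold u in I1.
  pose proof (isosceles_bound s0 s1) as I2.
  rewrite Hs in I2; fold u in I2.
  replace (dot (vopp u) (vopp u)) with (dot u u) in I2
    by (destruct u; unfold dot, vopp; simpl; ring).
  pose proof (cross_det_bound s1 s2 u) as HD.
  assert (E1 : dot (cross s1 u) (cross s1 u) = dot (cross s0 s1) (cross s0 s1)).
  { replace u with (vopp (vadd s0 s1)).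
    - destruct s0, s1; unfold dot, cross, vadd, vopp; simpl; ring.
    - rewrite Hs; destruct u eqn:E; unfold vopp; subst u; rewrite E; simpl; f_equal; ring. }
  assert (E2 : dot (cross s2 u) (cross s2 u) = dot (cross s2 s3) (cross s2 s3))
    by (unfold u; destruct s2, s3; unfold dot, cross, vadd; simpl; ring).
  assert (E3 : det3 s1 s2 u = det3 s1 s2 s3)
    by (unfold u; destruct s1, s2, s3; unfold det3, dot, cross, vadd; simpl; ring).
  rewrite E1, E2, E3 in HD.
  pose proof (dot_ge0 (cross s0 s1)) as P1. pose proof (dot_ge0 (cross s2 s3)) as P2.
  pose proof (norm_ge0 s0). pose proof (norm_ge0 s1).
  pose proof (norm_ge0 s2). pose proof (norm_ge0 s3).
  pose proof (dot_ge0 u) as Pt.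
  assert (Hz : dot u u = 0 -> det3 s1 s2 s3 = 0).
  { intros Z; rewrite <- E3; clear - Z; destruct u as [a b c]; unfold dot in Z; simpl in Z.
    assert (a = 0) by nra. assert (b = 0) by nra. assert (c = 0) by nra. subst.
    unfold det3, dot, cross; simpl; ring. }
  replace (norm s0 + norm s1 + norm s2 + norm s3)
    with ((norm s2 + norm s3) + (norm s0 + norm s1)) by ring.
  set (D := det3 s1 s2 s3) in *.
  set (t := dot u u) in *.
  set (x := norm s2 + norm s3) in *. set (y := norm s0 + norm s1) in *.
  assert (Ht : x * y / 2 <= t) by (unfold x, y; nra).
  assert (0 <= x) by (unfold x; lra). assert (0 <= y) by (unfold y; lra).
  set (c1 := dot (cross s0 s1) (cross s0 s1)) in *.
  set (c2 := dot (cross s2 s3) (cross s2 s3)) in *.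
  clearbody D t x y c1 c2. clear - Pt P1 P2 I1 I2 HD Ht H3 H4 Hz.
  assert (Hxy : 0 <= x * y) by nra.
  assert (0 <= (x+y)^6) by (apply pow_le; lra).
  destruct (Req_dec t 0) as [Z | NZ].
  - rewrite (Hz Z). replace (8192 * 0 ^ 2) with 0 by ring. assumption.
  - assert (Tp : 0 < t) by lra.
    assert (A1 : 0 <= y * y - t) by (apply Rmult_le_reg_l with t; nra).
    assert (A2 : 0 <= x * x - t) by (apply Rmult_le_reg_l with t; nra).
    assert (Hm : t <= x * y).
    { assert (t * t <= (x*x)*(y*y)) by (apply Rmult_le_compat; lra).
      destruct (Rle_or_lt t (x*y)); auto. assert (x*y*(x*y) < t*t) by nra. nra. }
    assert (B : 16 * D ^ 2 <= t * ((x*x - t) * (y*y - t))).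
    { apply Rmult_le_reg_l with t; [lra|].
      assert (4 * c1 * (4 * c2) <= t * (y*y-t) * (t * (x*x-t)))
        by (apply Rmult_le_compat; nra).
      assert (16 * (D*D*t) <= 16 * (c1 * c2)) by lra. simpl. nra. }
    assert (C : (x*x - t) * (y*y - t) <= (x*y - t) * (x*y-t))
      by (assert (0 <= t * ((x-y)*(x-y))) by (apply Rmult_le_pos; [lra|apply Rle_0_sqr]); nra).
    assert (B' : 16 * D ^ 2 <= t * ((x*y - t) * (x*y-t)))
      by (apply Rle_trans with (1 := B); apply Rmult_le_compat_l; lra).
    set (m := x * y) in *.
    (* On [[m/2, m]] the function [t (m - t)^2] decreases, so its maximum [m^3 / 8] is taken at
       [t = m / 2]. *)
    assert (K : 8 * (t * ((m - t) * (m - t))) <= m * m * m).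
    { assert (0 <= (t - m/2) * m * m) by (apply Rmult_le_pos; [apply Rmult_le_pos|]; lra).
      assert (0 <= (t - m/2) * (t-m/2) * (m - t)) by (apply Rmult_le_pos; [apply Rmult_le_pos|]; lra).
      nra. }
    assert (M : 4 * m <= (x+y) * (x+y)) by (unfold m; pose proof (Rle_0_sqr (x-y)); unfold Rsqr in *; lra).
    assert (4 * m * (4 * m) * (4*m) <= (x+y)*(x+y) * ((x+y)*(x+y)) * ((x+y)*(x+y))).
    { apply Rmult_le_compat; try lra; try nra. }
    replace ((x+y)^6) with ((x+y)*(x+y) * ((x+y)*(x+y)) * ((x+y)*(x+y))) by ring.
    lra.
Qed.

Lemma amgm3 x y z : 0 <= x -> 0 <= y -> 0 <= z -> 27 * (x * y * z) <= (x + y + z) ^ 3.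
Proof.
  intros Hx Hy Hz.
  assert (0 <= x * ((y-z)*(y-z))) by (apply Rmult_le_pos; [lra|apply Rle_0_sqr]).
  assert (0 <= y * ((x-z)*(x-z))) by (apply Rmult_le_pos; [lra|apply Rle_0_sqr]).
  assert (0 <= z * ((x-y)*(x-y))) by (apply Rmult_le_pos; [lra|apply Rle_0_sqr]).
  assert (0 <= (x+y) * ((x-y)*(x-y))) by (apply Rmult_le_pos; [lra|apply Rle_0_sqr]).
  assert (0 <= (x+z) * ((x-z)*(x-z))) by (apply Rmult_le_pos; [lra|apply Rle_0_sqr]).
  assert (0 <= (z+y) * ((z-y)*(z-y))) by (apply Rmult_le_pos; [lra|apply Rle_0_sqr]).
  nra.
Qed.

(** Cauchy-Schwarz against a vector [(p, q)] of the unit disc. It bounds a square root below by a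
    linear form; the rational pairs used later point roughly in the extremal direction. *)
Lemma hyp_ge p q x y z :
  p * p + q * q <= 1 -> 0 <= z -> x * x + y * y <= z * z -> p * x + q * y <= z.
Proof.
  intros H1 Hz H.
  assert ((p*x+q*y)*(p*x+q*y) <= z * z).
  { assert (0 <= (p*y-q*x)*(p*y-q*x)) by apply Rle_0_sqr.
    assert ((p*p+q*q)*(x*x+y*y) <= 1 * (z*z)) by (apply Rmult_le_compat; nra).
    nra. }
  destruct (Rle_or_lt (p*x+q*y) z); auto. nra.
Qed.

(** The square root of 8192 is about 90.51, so a cubic estimate with [k] at least 91 suffices. *)
Lemma pow6_le (k x y : R) : 0 <= x -> 0 <= y -> k * x <= y ^ 3 -> 8192 <= k * k -> 0 <= k ->
  8192 * x ^ 2 <= y ^ 6.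
Proof.
  intros Hx Hy H Hk K0.
  assert (0 <= k * x) by (apply Rmult_le_pos; auto).
  assert ((k*x)*(k*x) <= y^3*y^3) by (apply Rmult_le_compat; auto).
  replace (y^6) with (y^3*y^3) by ring.
  assert (0 <= x * x) by nra.
  nra.
Qed.

Lemma det_le_norm s1 s2 s3 :
  det3 s1 s2 s3 ^ 2 <= dot s1 s1 * dot (cross s2 s3) (cross s2 s3).
Proof.
  unfold det3. pose proof (dot_ge0 (cross s1 (cross s2 s3))) as H.
  rewrite lagrange in H. nra.
Qed.

(* [w] is the height over the base [U] of the triangle spanned by [s2] and [s3]. *)
Lemma height_exists s2 s3 : 0 < dot (vadd s2 s3) (vadd s2 s3) ->
  exists U w, 0 < U /\ 0 <= w /\ U * U = dot (vadd s2 s3) (vadd s2 s3) /\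
    dot (cross s2 s3) (cross s2 s3) = (U * w) * (U * w) /\
    U * U + (2 * w) * (2 * w) <= (norm s2 + norm s3) * (norm s2 + norm s3).
Proof.
  intros H. pose proof (isosceles_bound s2 s3) as I.
  exists (norm (vadd s2 s3)), (norm (cross s2 s3) / norm (vadd s2 s3)).
  assert (P : 0 < norm (vadd s2 s3)) by (apply sqrt_lt_R0; auto).
  pose proof (norm_sq (vadd s2 s3)) as E1. pose proof (norm_sq (cross s2 s3)) as E2.
  pose proof (norm_ge0 (cross s2 s3)) as E3.
  rewrite <- E1, <- E2 in I. rewrite <- E2.
  set (U := norm (vadd s2 s3)) in *. set (C := norm (cross s2 s3)) in *.
  repeat split; auto.
  - apply Rmult_le_pos; auto. left; apply Rinv_0_lt_compat; auto.
  - field. lra.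
  - apply Rmult_le_reg_l with (U * U); [nra|].
    replace (U * U * (U * U + 2 * (C / U) * (2 * (C / U)))) with (U*U*(U*U) + 4 * (C * C)) by (field; lra).
    nra.
Qed.

Lemma dot_zero_vec u : dot u u = 0 -> u = mkpt 0 0 0.
Proof.
  destruct u as [a b c]; unfold dot; simpl; intros Z.
  assert (a = 0) by nra. assert (b = 0) by nra. assert (c = 0) by nra. subst; auto.
Qed.

Lemma det3_add s1 s2 s3 : det3 s1 s2 (vadd s2 s3) = det3 s1 s2 s3.
Proof. destruct s1, s2, s3; unfold det3, dot, cross, vadd; simpl; ring. Qed.

Lemma sum_norm_pow_ge0 s0 s1 s2 s3 : 0 <= (norm s0 + norm s1 + norm s2 + norm s3) ^ 6.
Proof.
  apply pow_le. pose proof (norm_ge0 s0). pose proof (norm_ge0 s1).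
  pose proof (norm_ge0 s2). pose proof (norm_ge0 s3). lra.
Qed.

(** Let [a = norm s1], and let [U], [w] be base and height of the triangle on [s2], [s3]. Since [s1]
    makes no obtuse angle with [s2] and [s3], [norm s0] is at least the hypotenuse over [a] and [U];
    likewise [norm s2 + norm s3] is at least the one over [U] and [2 w], while the determinant is at
    most [a U w]. *)
Lemma two_obtuse_angles_vec s0 s1 s2 s3 :
  vadd s0 s1 = vopp (vadd s2 s3) ->
  0 <= dot s1 s2 -> 0 <= dot s1 s3 ->
  8192 * (det3 s1 s2 s3) ^ 2 <= (norm s0 + norm s1 + norm s2 + norm s3) ^ 6.
Proof.
  intros Hs H12 H13.
  destruct (Req_dec (dot (vadd s2 s3) (vadd s2 s3)) 0) as [Z | NZ].
  { rewrite <- det3_add, (dot_zero_vec _ Z).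
    replace (det3 s1 s2 (mkpt 0 0 0)) with 0 by (unfold det3, dot, cross; simpl; ring).
    replace (8192 * 0 ^ 2) with 0 by ring. apply sum_norm_pow_ge0. }
  destruct (height_exists s2 s3) as (U & w & HU & Hw & EU & EC & HX).
  { pose proof (dot_ge0 (vadd s2 s3)); lra. }
  pose proof (det_le_norm s1 s2 s3) as HD. rewrite EC, <- norm_sq in HD.
  assert (E0 : norm s0 * norm s0 = norm s1 * norm s1 + U * U + 2 * (dot s1 s2 + dot s1 s3)).
  { rewrite !norm_sq, EU.
    replace s0 with (vopp (vadd s1 (vadd s2 s3))).
    - destruct s1, s2, s3; unfold dot, vadd, vopp; simpl; ring.
    - clear - Hs. destruct s0, s1, s2, s3. unfold vadd, vopp in *; simpl in *.
      injection Hs; intros. f_equal; lra. }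
  pose proof (norm_ge0 s0). pose proof (norm_ge0 s1). pose proof (norm_ge0 s2). pose proof (norm_ge0 s3).
  assert (HS0 : 3/5 * norm s1 + 4/5 * U <= norm s0) by (apply hyp_ge; lra).
  assert (HX' : 3/5 * U + 4/5 * (2 * w) <= norm s2 + norm s3) by (apply hyp_ge; lra).
  set (a := norm s1) in *.
  (* The three terms sum to a lower bound for the four norms, and
     [27 * (8/5) * (7/5) * (8/5) = 96.768]. *)
  pose proof (amgm3 (8/5*a) (7/5*U) (8/5*w)) as AG.
  assert (P : 0 <= a * U * w) by (apply Rmult_le_pos; [apply Rmult_le_pos|]; lra).
  apply Rle_trans with (8192 * (a * U * w)^2); [nra|].
  apply pow6_le with 96; try lra.
  apply Rle_trans with ((8/5*a + 7/5*U + 8/5*w)^3); [lra|].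
  apply pow_incr; lra.
Qed.

(** The angle between [s1] and [s2] is at most 60 degrees, so their sum is long compared with
    [x = a + b], while their vector product is at most [sqrt 3 / 2 * a b]. The other two vectors
    span a triangle over the same base, of height [w]. *)
Lemma very_obtuse_angle_vec s0 s1 s2 s3 :
  vadd s0 s3 = vopp (vadd s1 s2) ->
  norm s1 * norm s2 / 2 <= dot s1 s2 ->
  8192 * (det3 s1 s2 s3) ^ 2 <= (norm s0 + norm s1 + norm s2 + norm s3) ^ 6.
Proof.
  intros Hs H12.
  assert (Hu : dot (vadd s0 s3) (vadd s0 s3) = dot (vadd s1 s2) (vadd s1 s2))
    by (rewrite Hs; destruct (vadd s1 s2); unfold dot, vopp; simpl; ring).
  assert (EUT : dot (vadd s1 s2) (vadd s1 s2) = norm s1 * norm s1 + norm s2 * norm s2 + 2 * dot s1 s2)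
    by (rewrite !norm_sq; destruct s1, s2; unfold dot, vadd; simpl; ring).
  pose proof (norm_ge0 s0). pose proof (norm_ge0 s1). pose proof (norm_ge0 s2). pose proof (norm_ge0 s3).
  destruct (Req_dec (dot (vadd s1 s2) (vadd s1 s2)) 0) as [Z | NZ].
  { replace (det3 s1 s2 s3) with (det3 s3 s1 s2)
      by (destruct s1, s2, s3; unfold det3, dot, cross; simpl; ring).
    rewrite <- det3_add, (dot_zero_vec _ Z).
    replace (det3 s3 s1 (mkpt 0 0 0)) with 0 by (unfold det3, dot, cross; simpl; ring).
    replace (8192 * 0 ^ 2) with 0 by ring. apply sum_norm_pow_ge0. }
  destruct (height_exists s0 s3) as (U & w & HU & Hw & EU & EC & HX).
  { rewrite Hu. pose proof (dot_ge0 (vadd s1 s2)); lra. }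
  pose proof (cross_det_bound s1 s3 (vadd s0 s3)) as HD.
  replace (dot (cross s3 (vadd s0 s3)) (cross s3 (vadd s0 s3))) with (dot (cross s0 s3) (cross s0 s3)) in HD
    by (destruct s0, s3; unfold dot, cross, vadd; simpl; ring).
  rewrite EC, <- EU, Hs in HD.
  replace (det3 s1 s3 (vopp (vadd s1 s2))) with (det3 s1 s2 s3) in HD
    by (destruct s1, s2, s3; unfold det3, dot, cross, vadd, vopp; simpl; ring).
  replace (dot (cross s1 (vopp (vadd s1 s2))) (cross s1 (vopp (vadd s1 s2))))
    with (dot (cross s1 s2) (cross s1 s2)) in HD
    by (destruct s1, s2; unfold dot, cross, vadd, vopp; simpl; ring).
  rewrite lagrange, <- !norm_sq in HD. rewrite Hu, EUT in EU.
  replace (norm s0 + norm s1 + norm s2 + norm s3) with ((norm s1 + norm s2) + (norm s0 + norm s3)) by ring.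
  set (a := norm s1) in *. set (b := norm s2) in *. set (y := norm s0 + norm s3) in *.
  set (D := det3 s1 s2 s3) in *. set (d := dot s1 s2) in *.
  set (x := a + b).
  assert (Hx : 0 <= x) by (unfold x; lra).
  assert (HUx : 4/5 * x <= U).
  { destruct (Rle_or_lt (4/5 * x) U); auto.
    assert (U * U < (4/5*x)*(4/5*x)) by nra. unfold x in *. nra. }
  assert (HD' : D ^ 2 <= 3/4 * ((a*b)*(a*b)) * (w * w)).
  { apply Rmult_le_reg_l with (U*U); [nra|].
    assert (0 <= a * b) by nra.
    assert ((a*a)*(b*b) - d * d <= 3/4 * ((a*b)*(a*b))) by nra.
    assert (0 <= (U*w)*(U*w)) by apply Rle_0_sqr.
    assert ((a*a*(b*b) - d*d) * (U*w*(U*w)) <= 3/4 * ((a*b)*(a*b)) * (U*w*(U*w)))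
      by (apply Rmult_le_compat_r; auto).
    nra. }
  assert (Hab : 0 <= a * b <= x * x / 4)
    by (unfold x; pose proof (Rle_0_sqr (a-b)); unfold Rsqr in *; split; nra).
  assert (Hab2 : (a*b)*(a*b) <= (x*x/4)*(x*x/4)) by (apply Rmult_le_compat; lra).
  assert (HX' : 3/5 * U + 4/5 * (2 * w) <= y) by (apply hyp_ge; unfold y in *; lra).
  pose proof (amgm3 (37/50*x) (37/50*x) (8/5*w)) as AG.
  assert (P : 0 <= x * x * w) by (apply Rmult_le_pos; [apply Rmult_le_pos|]; lra).
  (* [22/100] rounds up [sqrt 3 / 8], which comes from [sqrt 3 / 2] and [a b <= x^2 / 4]. *)
  apply Rle_trans with (8192 * (22/100 * (x * x * w))^2).
  { assert (0 <= w * w) by apply Rle_0_sqr.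
    assert ((a*b)*(a*b) * (w*w) <= (x*x/4)*(x*x/4) * (w*w)) by (apply Rmult_le_compat_r; auto).
    assert (0 <= (x*x*w)*(x*x*w)) by apply Rle_0_sqr. nra. }
  apply pow6_le with 91; try lra.
  apply Rle_trans with ((37/50*x + 37/50*x + 8/5*w)^3); [lra|].
  apply pow_incr; lra.
Qed.

(** Heron's formula together with the inequality of the means, applied to the three factors other
    than the perimeter. *)
Lemma triangle_isoperimetric y1 y2 y3 : vadd y1 y2 = vopp y3 ->
  108 * dot (cross y1 y2) (cross y1 y2) <= (norm y1 + norm y2 + norm y3) ^ 4.
Proof.
  intros E. rewrite lagrange.
  assert (Ec : norm y3 * norm y3 = norm y1 * norm y1 + norm y2 * norm y2 + 2 * dot y1 y2).
  { rewrite !norm_sq. replace (dot y3 y3) with (dot (vadd y1 y2) (vadd y1 y2))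
      by (rewrite E; destruct y3; unfold dot, vopp; simpl; ring).
    destruct y1, y2; unfold dot, vadd; simpl; ring. }
  pose proof (cauchy_two_sided y1 y2) as C. rewrite <- !norm_sq.
  pose proof (norm_ge0 y1). pose proof (norm_ge0 y2). pose proof (norm_ge0 y3).
  set (a := norm y1) in *. set (b := norm y2) in *. set (c := norm y3) in *. set (d := dot y1 y2) in *.
  assert (X : 0 <= a + b - c) by (destruct (Rle_or_lt c (a+b)); [lra|nra]).
  assert (Y : 0 <= a - b + c) by (destruct (Rle_or_lt (b - a) c); [lra|nra]).
  assert (Z : 0 <= b - a + c) by (destruct (Rle_or_lt (a - b) c); [lra|nra]).
  pose proof (amgm3 _ _ _ X Y Z) as AG.
  replace (a + b - c + (a - b + c) + (b - a + c)) with (a + b + c) in AG by ring.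
  assert (K : (a+b+c) * (27 * ((a + b - c) * (a - b + c) * (b - a + c))) <= (a+b+c)*(a+b+c)^3)
    by (apply Rmult_le_compat_l; lra).
  assert (Ed : d = (c*c - a*a - b*b)/2) by lra. rewrite Ed.
  simpl in *. nra.
Qed.

(** The vectors [si x s0] are the projections of the [si] along [s0], turned by a right angle and
    scaled by [norm s0]. They close up to a triangle whose area yields the determinant, so the
    isoperimetric inequality bounds it by their total length [W]. *)
Lemma face_small_angles_vec s0 s1 s2 s3 :
  vadd s0 s1 = vopp (vadd s2 s3) ->
  dot s0 s1 <= - (norm s0 * norm s1) / 2 -> dot s0 s2 <= - (norm s0 * norm s2) / 2 ->
  dot s0 s3 <= - (norm s0 * norm s3) / 2 ->
  8192 * (det3 s1 s2 s3) ^ 2 <= (norm s0 + norm s1 + norm s2 + norm s3) ^ 6.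
Proof.
  intros Hs H1 H2 H3.
  assert (E3 : s3 = vopp (vadd s0 (vadd s1 s2))).
  { destruct s0, s1, s2, s3; unfold vadd, vopp in *; simpl in *.
    injection Hs; intros; f_equal; lra. }
  assert (E0 : norm s0 * norm s0 = - (dot s0 s1 + dot s0 s2 + dot s0 s3)).
  { rewrite norm_sq, E3. destruct s0, s1, s2; unfold dot, vadd, vopp; simpl; ring. }
  pose proof (norm_ge0 s0). pose proof (norm_ge0 s1). pose proof (norm_ge0 s2). pose proof (norm_ge0 s3).
  destruct (Req_dec (norm s0) 0) as [Z | NZ].
  { assert (ED : det3 s1 s2 s3 = 0).
    { rewrite E3, (dot_zero_vec s0) by (rewrite <- norm_sq, Z; ring).
      destruct s1, s2; unfold det3, dot, cross, vadd, vopp; simpl; ring. }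
    rewrite ED. replace (8192 * 0 ^ 2) with 0 by ring. apply sum_norm_pow_ge0. }
  assert (P0 : 0 < norm s0) by lra.
  pose proof (triangle_isoperimetric (cross s1 s0) (cross s2 s0) (cross s3 s0)) as TI.
  assert (EY : dot (cross (cross s1 s0) (cross s2 s0)) (cross (cross s1 s0) (cross s2 s0))
     = det3 s1 s2 s3 ^ 2 * (norm s0 * norm s0)).
  { rewrite norm_sq, E3. destruct s0, s1, s2; unfold det3, dot, cross, vadd, vopp; simpl; ring. }
  rewrite EY in TI.
  assert (TI' : 108 * (det3 s1 s2 s3 ^ 2 * (norm s0 * norm s0)) <=
      (norm (cross s1 s0) + norm (cross s2 s0) + norm (cross s3 s0)) ^ 4).
  { apply TI. rewrite E3. destruct s0, s1, s2; unfold cross, vadd, vopp; simpl; f_equal; ring. }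
  clear TI EY.
  (* [sqrt 3 / 2] rounded down, so that [(1/2, q)] stays in the unit disc: the direction of an angle
     of exactly 60 degrees. *)
  set (q := 433/500).
  assert (G : forall s, 1/2 * (- dot s0 s) + q * norm (cross s s0) <= norm s * norm s0).
  { intros s. apply hyp_ge; [unfold q; lra|apply Rmult_le_pos; apply norm_ge0|].
    rewrite norm_sq, lagrange.
    replace (dot s s0) with (dot s0 s) by (destruct s, s0; unfold dot; simpl; ring).
    rewrite <- !norm_sq. nra. }
  pose proof (G s1) as G1. pose proof (G s2) as G2. pose proof (G s3) as G3. clear G.
  set (W := norm (cross s1 s0) + norm (cross s2 s0) + norm (cross s3 s0)) in *.
  assert (HW : 0 <= W) by (unfold W; pose proof (norm_ge0 (cross s1 s0));
    pose proof (norm_ge0 (cross s2 s0)); pose proof (norm_ge0 (cross s3 s0)); lra).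
  set (a := norm s0) in *.
  set (Ln := norm s1 + norm s2 + norm s3).
  replace (a + norm s1 + norm s2 + norm s3) with (a + Ln) by (unfold Ln; ring).
  assert (HL : 1/2 * (a * a) + q * W <= a * Ln) by (unfold Ln, W; lra).
  assert (HL2 : Ln <= 2 * a) by (apply Rmult_le_reg_l with a; unfold Ln; nra).
  set (D := det3 s1 s2 s3) in *. clearbody D Ln W a. clear - HW P0 TI' HL HL2.
  (* [k = W / (sqrt 3 a^2)], with [sqrt 3] rounded down to [2q = 1.732] *)
  set (k := W / (2 * q * (a*a))).
  assert (EW : W = 2 * q * (a*a) * k) by (unfold k, q; field; lra).
  assert (Hk : 0 <= k) by (unfold k, q; apply Rmult_le_pos; [auto|left; apply Rinv_0_lt_compat; nra]).
  assert (Hk1 : k <= 3/4 / (q * q)).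
  { assert (q * W <= 3/2 * (a * a)) by nra. rewrite EW in H.
    apply Rmult_le_reg_l with (2 * (q*q) * (a*a)); [unfold q; nra|].
    replace (2 * (q*q) * (a*a) * (3/4/(q*q))) with (3/2 * (a*a)) by (unfold q; field). nra. }
  assert (HA : a * (1/2 + 2 * (q * q) * k) <= Ln).
  { apply Rmult_le_reg_l with a; [lra|]. rewrite EW in HL. nra. }
  assert (HD : 108 * D ^ 2 <= (2*q) ^ 4 * a ^ 6 * k ^ 4).
  { apply Rmult_le_reg_l with (a*a); [nra|]. rewrite EW in TI'.
    apply Rle_trans with ((2 * q * (a * a) * k) ^ 4); [lra|right; ring]. }
  unfold q in *.
  assert (Hk2 : k <= 10004/10000) by lra.
  (* Tightest near [k = 1], where the right side is [2.999^3 = 26.97]. The factor 1.499 rounds down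
     [2 q^2], and below 0.2888 rounds up [(2 q)^2 / sqrt 108]. *)
  assert (C : 26.95 * k ^ 2 <= (3/2 + 1.499 * k)^3).
  { assert (0 <= (10004/10000 - k) * k) by nra.
    assert (0 <= (10004/10000 - k) * k * k) by nra. nra. }
  assert (HA2 : (a * (3/2 + 1.499 * k)) ^ 3 <= (a + Ln)^3) by (apply pow_incr; nra).
  rewrite Rpow_mult_distr in HA2.
  assert (a ^ 3 * (26.95 * k ^ 2) <= a ^ 3 * (3/2 + 1.499 * k)^3)
    by (apply Rmult_le_compat_l; [apply pow_le; lra| auto]).
  assert (Hx : 0 <= a ^ 3 * k ^ 2) by (apply Rmult_le_pos; apply pow_le; lra).
  assert (D ^ 2 <= (0.2888 * (a^3 * k^2))^2).
  { replace ((0.2888 * (a^3 * k^2))^2) with (0.2888^2 * (a^6 * k^4)) by ring.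
    assert (0 <= a ^ 6 * k ^ 4) by (apply Rmult_le_pos; apply pow_le; lra). lra. }
  apply Rle_trans with (8192 * (0.2888 * (a^3*k^2))^2); [lra|].
  assert (0 <= a * k) by nra.
  apply pow6_le with 93; try lra; nra.
Qed.

(** * Squared edge lengths, dihedral angles and the area bound for tetrahedra *)

Definition d2 (p q : pt) : R := dot (vsub p q) (vsub p q).

(* [L x y] plays the role of the squared distance between [x] and [y]. *)
Section SquaredLengths.
Context {X : Type} (L : X -> X -> R).

Definition gram (a b c : X) : R := (L a b + L a c - L b c) / 2.
(* four times the squared area of the triangle abc *)
Definition nn (a b c : X) : R := L a b * L a c - gram a b c * gram a b c.
Definition dn (a b c d : X) : R := L a b * gram a c d - gram a b c * gram a b d.
(* cosine of the dihedral angle at the edge ab of the tetrahedron abcd *)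
Definition cosd (a b c d : X) : R := dn a b c d / (sqrt (nn a b c) * sqrt (nn a b d)).
(* thirty-six times the squared volume *)
Definition svsq (a b c d : X) : R :=
  L a b * L a c * L a d + 2 * gram a b c * gram a b d * gram a c d
  - L a b * (gram a c d)^2 - L a c * (gram a b d)^2 - L a d * (gram a b c)^2.
Definition asum (a b c d : X) : R :=
  sqrt (nn a b c) + sqrt (nn a b d) + sqrt (nn a c d) + sqrt (nn b c d).
(* The bound area^3 >= 288 sqrt 2 volume^2, squared and multiplied out; the scaled special
   tetrahedra attain equality. *)
Definition large_area (a b c d : X) : Prop :=
  8192 * svsq a b c d ^ 2 <= asum a b c d ^ 6.
End SquaredLengths.

Ltac uL := unfold asum, svsq, cosd, dn, nn, gram in *.
Ltac uv := unfold d2, sv, det3, dot, cross, vsub, vadd, vopp in *; simpl in *.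

Lemma pow2_pos x : x <> 0 -> 0 < x ^ 2.
Proof. intros H; apply Rsqr_pos_lt in H; unfold Rsqr in H; simpl; lra. Qed.

Lemma d2_sym p q : d2 p q = d2 q p.
Proof. uv; ring. Qed.

Lemma d2_ge0 p q : 0 <= d2 p q.
Proof. apply dot_ge0. Qed.

Lemma svsq_d2 a b c d : svsq d2 a b c d = sv a b c d ^ 2.
Proof. destruct a, b, c, d; uL; uv; field. Qed.

Lemma nn_d2 a b c : nn d2 a b c = dot (cross (vsub b a) (vsub c a)) (cross (vsub b a) (vsub c a)).
Proof. destruct a, b, c; uL; uv; field. Qed.

Lemma nn_norm a b c : sqrt (nn d2 a b c) = norm (cross (vsub b a) (vsub c a)).
Proof. rewrite nn_d2; reflexivity. Qed.

Lemma tri_area_nn a b c : tri_area a b c = sqrt (nn d2 a b c) / 2.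
Proof. rewrite nn_d2; reflexivity. Qed.

Lemma nn_perm12 a b c : nn d2 a c b = nn d2 a b c.
Proof. destruct a, b, c; uL; uv; field. Qed.

Lemma nn_perm01 a b c : nn d2 b a c = nn d2 a b c.
Proof. destruct a, b, c; uL; uv; field. Qed.

Lemma nn_ge0 a b c : 0 <= nn d2 a b c.
Proof. rewrite nn_d2; apply dot_ge0. Qed.

(** This is the squared sine of the dihedral angle at [ab], just as [dn] gives its cosine. *)
Lemma nn_dn a b c d : nn d2 a b c * nn d2 a b d - dn d2 a b c d ^ 2 = d2 a b * sv a b c d ^ 2.
Proof. destruct a, b, c, d; uL; uv; field. Qed.

Lemma nn_pos a b c d : sv a b c d <> 0 -> 0 < nn d2 a b c.
Proof.
  intros H. pose proof (nn_ge0 a b c). destruct (Req_dec (nn d2 a b c) 0) as [E|]; [|lra].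
  exfalso; apply H. rewrite nn_d2 in E. apply dot_zero_vec in E.
  replace (sv a b c d) with (dot (cross (vsub b a) (vsub c a)) (vsub d a))
    by (destruct a, b, c, d; uv; ring).
  rewrite E. unfold dot; simpl; ring.
Qed.

Lemma d2_pos a b c d : sv a b c d <> 0 -> 0 < d2 a b.
Proof.
  intros H. pose proof (d2_ge0 a b). destruct (Req_dec (d2 a b) 0) as [E|]; [|lra].
  pose proof (nn_pos a b c d H) as P. unfold nn in P. rewrite E in P.
  pose proof (Rle_0_sqr (gram d2 a b c)). unfold Rsqr in *. lra.
Qed.

Lemma sv_swap01 a b c d : sv b a c d = - sv a b c d.
Proof. destruct a, b, c, d; uv; ring. Qed.
Lemma sv_swap23 a b c d : sv a b d c = - sv a b c d.
Proof. destruct a, b, c, d; uv; ring. Qed.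

Lemma cosd_swap_ends a b c d : cosd d2 b a c d = cosd d2 a b c d.
Proof.
  unfold cosd. rewrite !(nn_perm01 a b). f_equal. destruct a, b, c, d; uL; uv; field.
Qed.
Lemma cosd_swap_sides a b c d : cosd d2 a b d c = cosd d2 a b c d.
Proof.
  unfold cosd. rewrite (Rmult_comm (sqrt (nn d2 a b d))). f_equal. destruct a, b, c, d; uL; uv; field.
Qed.

(* Doubled area vectors of the four faces; [face0] belongs to the face opposite the first vertex. *)
Definition face1 (a b c d : pt) : pt := cross (vsub c a) (vsub d a).
Definition face2 (a b c d : pt) : pt := cross (vsub d a) (vsub b a).
Definition face3 (a b c d : pt) : pt := cross (vsub b a) (vsub c a).
Definition face0 (a b c d : pt) : pt := vopp (vadd (face1 a b c d) (vadd (face2 a b c d) (face3 a b c d))).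
Ltac uf := unfold face0, face1, face2, face3 in *.

Lemma face0_norm a b c d : norm (face0 a b c d) = sqrt (nn d2 b c d).
Proof. rewrite nn_d2. unfold norm. f_equal. destruct a, b, c, d; uf; uv; ring. Qed.
Lemma face1_norm a b c d : norm (face1 a b c d) = sqrt (nn d2 a c d).
Proof. rewrite nn_d2. reflexivity. Qed.
Lemma face2_norm a b c d : norm (face2 a b c d) = sqrt (nn d2 a b d).
Proof. rewrite <- nn_perm12, nn_d2. reflexivity. Qed.
Lemma face3_norm a b c d : norm (face3 a b c d) = sqrt (nn d2 a b c).
Proof. rewrite nn_d2. reflexivity. Qed.

Lemma face_det a b c d : det3 (face1 a b c d) (face2 a b c d) (face3 a b c d) = sv a b c d ^ 2.
Proof. destruct a, b, c, d; uf; uv; ring. Qed.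

Lemma dot_face01 a b c d : dot (face0 a b c d) (face1 a b c d) = - dn d2 c d a b.
Proof. destruct a, b, c, d; uf; uL; uv; field. Qed.
Lemma dot_face02 a b c d : dot (face0 a b c d) (face2 a b c d) = - dn d2 b d a c.
Proof. destruct a, b, c, d; uf; uL; uv; field. Qed.
Lemma dot_face03 a b c d : dot (face0 a b c d) (face3 a b c d) = - dn d2 b c a d.
Proof. destruct a, b, c, d; uf; uL; uv; field. Qed.
Lemma dot_face12 a b c d : dot (face1 a b c d) (face2 a b c d) = - dn d2 a d b c.
Proof. destruct a, b, c, d; uf; uL; uv; field. Qed.
Lemma dot_face13 a b c d : dot (face1 a b c d) (face3 a b c d) = - dn d2 a c b d.
Proof. destruct a, b, c, d; uf; uL; uv; field. Qed.
Lemma dot_face23 a b c d : dot (face2 a b c d) (face3 a b c d) = - dn d2 a b c d.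
Proof. destruct a, b, c, d; uf; uL; uv; field. Qed.

Lemma dn_cosd a b c d : sv a b c d <> 0 ->
  dn d2 a b c d = cosd d2 a b c d * (sqrt (nn d2 a b c) * sqrt (nn d2 a b d)).
Proof.
  intros H. pose proof (sqrt_lt_R0 _ (nn_pos a b c d H)).
  assert (sv a b d c <> 0) by (rewrite sv_swap23; lra).
  pose proof (sqrt_lt_R0 _ (nn_pos a b d c H1)).
  unfold cosd. field. lra.
Qed.

Lemma sqrt_mul_ge0 x y : 0 <= sqrt x * sqrt y.
Proof. apply Rmult_le_pos; apply sqrt_pos. Qed.

Lemma face_sum a b c d :
  vadd (face0 a b c d) (face1 a b c d) = vopp (vadd (face2 a b c d) (face3 a b c d)).
Proof. destruct a, b, c, d; uf; uv; f_equal; ring. Qed.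

Lemma asum_norms a b c d : asum d2 a b c d =
  norm (face0 a b c d) + norm (face1 a b c d) + norm (face2 a b c d) + norm (face3 a b c d).
Proof. rewrite face0_norm, face1_norm, face2_norm, face3_norm; unfold asum; ring. Qed.

Lemma dn_le a b c d k : sv a b c d <> 0 -> k <= cosd d2 a b c d ->
  - dn d2 a b c d <= - (k * (sqrt (nn d2 a b c) * sqrt (nn d2 a b d))).
Proof.
  intros H Hk. rewrite dn_cosd by auto.
  pose proof (sqrt_mul_ge0 (nn d2 a b c) (nn d2 a b d)). nra.
Qed.

Lemma dn_ge a b c d k : sv a b c d <> 0 -> cosd d2 a b c d <= k ->
  - (k * (sqrt (nn d2 a b c) * sqrt (nn d2 a b d))) <= - dn d2 a b c d.
Proof.
  intros H Hk. rewrite dn_cosd by auto.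
  pose proof (sqrt_mul_ge0 (nn d2 a b c) (nn d2 a b d)). nra.
Qed.

Lemma sv_ne_perm a b c d : sv a b c d <> 0 ->
  sv a c b d <> 0 /\ sv a d b c <> 0 /\ sv b c a d <> 0 /\ sv b d a c <> 0 /\ sv c d a b <> 0.
Proof.
  intros H. repeat split; intro E; apply H; destruct a, b, c, d; uv; lra.
Qed.

Ltac nn_sort3 a b c :=
  rewrite ?(nn_perm12 c a b), ?(nn_perm01 a c b), ?(nn_perm12 b a c), ?(nn_perm01 a b c), ?(nn_perm12 a b c) in *.
Ltac nn_sort a b c d := nn_sort3 a b c; nn_sort3 a b d; nn_sort3 a c d; nn_sort3 b c d.
Ltac faces := rewrite ?dot_face01, ?dot_face02, ?dot_face03, ?dot_face12, ?dot_face13, ?dot_face23,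
  ?face0_norm, ?face1_norm, ?face2_norm, ?face3_norm.

Lemma large_four_small_angles a b c d : sv a b c d <> 0 ->
  1/2 <= cosd d2 a c b d -> 1/2 <= cosd d2 a d b c ->
  1/2 <= cosd d2 b c a d -> 1/2 <= cosd d2 b d a c -> large_area d2 a b c d.
Proof.
  intros H H1 H2 H3 H4. destruct (sv_ne_perm _ _ _ _ H) as (S1 & S2 & S3 & S4 & S5).
  unfold large_area. rewrite asum_norms, svsq_d2, <- face_det.
  apply dn_le in H1, H2, H3, H4; auto. nn_sort a b c d.
  apply four_small_angles_vec; [apply face_sum|..]; faces; lra.
Qed.

Lemma large_two_obtuse_angles a b c d : sv a b c d <> 0 ->
  cosd d2 a c b d <= 0 -> cosd d2 a d b c <= 0 -> large_area d2 a b c d.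
Proof.
  intros H H1 H2. destruct (sv_ne_perm _ _ _ _ H) as (S1 & S2 & S3 & S4 & S5).
  unfold large_area. rewrite asum_norms, svsq_d2, <- face_det.
  apply dn_ge in H1, H2; auto. nn_sort a b c d.
  apply two_obtuse_angles_vec; [apply face_sum|..]; faces; lra.
Qed.

Lemma large_face_small_angles a b c d : sv a b c d <> 0 ->
  1/2 <= cosd d2 b c a d -> 1/2 <= cosd d2 b d a c -> 1/2 <= cosd d2 c d a b -> large_area d2 a b c d.
Proof.
  intros H H1 H2 H3. destruct (sv_ne_perm _ _ _ _ H) as (S1 & S2 & S3 & S4 & S5).
  unfold large_area. rewrite asum_norms, svsq_d2, <- face_det.
  apply dn_le in H1, H2, H3; auto. nn_sort a b c d.
  apply face_small_angles_vec; [apply face_sum|..]; faces; lra.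
Qed.

Lemma large_very_obtuse_angle a b c d : sv a b c d <> 0 -> cosd d2 a d b c <= - (1/2) -> large_area d2 a b c d.
Proof.
  intros H H1. destruct (sv_ne_perm _ _ _ _ H) as (S1 & S2 & S3 & S4 & S5).
  unfold large_area. rewrite asum_norms, svsq_d2, <- face_det.
  apply dn_ge in H1; auto. nn_sort a b c d.
  apply very_obtuse_angle_vec; [|faces; lra].
  destruct a, b, c, d; uf; uv; f_equal; ring.
Qed.

(** The right angle at [cd] makes the triangle [bcd] right-angled at [b], and puts [a] above the
    midpoint of [cd]. The shape is thus described by half the length [m] of [cd] and the height
    [h]. *)
Lemma large_right_dihedral a b c d : sv a b c d <> 0 ->
  d2 a c = d2 a b -> d2 a d = d2 a b -> d2 b d = d2 b c -> cosd d2 c d a b = 0 -> large_area d2 a b c d.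
Proof.
  intros H E1 E2 E3 H1. destruct (sv_ne_perm _ _ _ _ H) as (S1 & S2 & S3 & S4 & S5).
  assert (Z : dn d2 c d a b = 0) by (rewrite dn_cosd, H1 by auto; ring).
  pose proof (d2_pos _ _ _ _ S5) as Pq.
  assert (S6 : sv a c d b <> 0) by (clear - H; intro; apply H; destruct a, b, c, d; uv; lra).
  pose proof (nn_pos _ _ _ _ S6) as Ph.
  unfold large_area, asum.
  assert (Es : d2 b c = d2 c d / 2).
  { unfold dn, gram in Z. rewrite (d2_sym c a), (d2_sym c b), (d2_sym d a), (d2_sym d b), E3, E2, E1 in Z.
    apply Rmult_eq_reg_l with (d2 c d); [|lra]. lra. }
  set (m := sqrt (d2 c d) / 2). set (h := sqrt (d2 a b - d2 c d / 4)).
  assert (Hm : 0 < m) by (unfold m; apply sqrt_lt_R0 in Pq; lra).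
  assert (Em : d2 c d = 4 * (m * m)) by (unfold m; pose proof (sqrt_sqrt (d2 c d)); lra).
  assert (Eh : d2 a b = h * h + m * m).
  { unfold h. rewrite sqrt_sqrt; [lra|].
    unfold nn, gram in Ph. rewrite E1, E2 in Ph.
    apply Rmult_le_reg_l with (d2 c d); nra. }
  assert (Hh : 0 <= h) by apply sqrt_pos.
  assert (N1 : sqrt (nn d2 a c d) = 2 * m * h).
  { apply sqrt_lem_1; [rewrite nn_d2; apply dot_ge0|nra|].
    unfold nn, gram. rewrite E1, E2, Em, Eh. field. }
  assert (N2 : sqrt (nn d2 b c d) = 2 * m * m).
  { apply sqrt_lem_1; [rewrite nn_d2; apply dot_ge0|nra|].
    unfold nn, gram. rewrite E3, Es, Em. field. }
  set (k := sqrt (2 * (h * h) + m * m)).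
  assert (Hk : 0 <= k) by apply sqrt_pos.
  assert (Ek : k * k = 2 * (h * h) + m * m) by (apply sqrt_sqrt; nra).
  assert (N3 : sqrt (nn d2 a b c) = m * k).
  { apply sqrt_lem_1; [rewrite nn_d2; apply dot_ge0|nra|].
    replace (m * k * (m * k)) with (m * m * (k * k)) by ring.
    unfold nn, gram. rewrite E1, Es, Em, Eh, Ek. field. }
  assert (N4 : sqrt (nn d2 a b d) = m * k).
  { apply sqrt_lem_1; [rewrite nn_d2; apply dot_ge0|nra|].
    replace (m * k * (m * k)) with (m * m * (k * k)) by ring.
    unfold nn, gram. rewrite E2, E3, Es, Em, Eh, Ek. field. }
  rewrite N1, N2, N3, N4.
  replace (svsq d2 a b c d) with (4 * (m^4 * h^2))
    by (unfold svsq, gram; rewrite E1, E2, E3, Es, Em, Eh; field).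
  (* [7/5] rounds down [sqrt 2]. With this, [27 * (3/2) * (11/10)^2 = 49.005] in the inequality of
     the means. *)
  assert (Hkl : 1/2 * m + 6/7 * (7/5 * h) <= k).
  { apply hyp_ge; try lra. nra. }
  pose proof (amgm3 (3/2*m) (11/10*h) (11/10*h)) as AG.
  replace (m * k + m * k + 2 * m * h + 2 * m * m) with (2 * m * (m + h + k)) by ring.
  assert (0 <= m * h ^ 2) by (apply Rmult_le_pos; [lra|nra]).
  assert (0 <= m ^ 3) by (apply pow_le; lra).
  assert (AG2 : 49 * (m * h^2) <= (m + h + k)^3).
  { apply Rle_trans with ((3/2*m + 11/10*h + 11/10*h)^3); [lra|]. apply pow_incr; lra. }
  apply pow6_le with 98.
  - apply Rmult_le_pos; [lra|]. apply Rmult_le_pos; [apply pow_le; lra|nra].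
  - apply Rmult_le_pos; nra.
  - replace ((2 * m * (m + h + k)) ^ 3) with (8 * (m^3 * (m+h+k)^3)) by ring.
    assert (m^3 * (49 * (m * h^2)) <= m^3 * (m+h+k)^3) by (apply Rmult_le_compat_l; auto).
    apply Rle_trans with (8 * (m ^ 3 * (49 * (m * h ^ 2)))); [right; ring|lra].
  - lra.
  - lra.
Qed.

(** Supplementary angles at edges of equal length in the common face [acd] have equal sines, so the
    faces [bcd] and [abc] have equal areas and their [dn] are opposite. This forces the foot of the
    altitude from [b] to be the mirror image of [a] in [cd]; [r] is the side of the equilateral face
    and [h] that altitude. *)
Lemma large_supplementary_dihedrals a b c d : sv a b c d <> 0 ->
  d2 a d = d2 a c -> d2 c d = d2 a c -> d2 b d = d2 b c ->
  cosd d2 c d a b = - cosd d2 a c b d -> large_area d2 a b c d.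
Proof.
  intros H E1 E2 E3 H1. destruct (sv_ne_perm _ _ _ _ H) as (S1 & S2 & S3 & S4 & S5).
  assert (Pq : 0 < d2 a c) by (rewrite <- E2; apply (d2_pos _ _ _ _ S5)).
  pose proof (nn_dn c d a b) as I1. pose proof (nn_dn a c b d) as I2.
  pose proof (dn_cosd c d a b S5) as J1. pose proof (dn_cosd a c b d S1) as J2.
  assert (sv b c d a <> 0) by (clear - H; intro; apply H; destruct a, b, c, d; uv; lra).
  assert (P1 : 0 < nn d2 b c d) by (eapply nn_pos; eauto).
  assert (P2 : 0 < nn d2 a b c) by (eapply nn_pos; eauto).
  assert (Esv : sv c d a b ^ 2 = sv a c b d ^ 2) by (destruct a, b, c, d; uv; ring).
  nn_sort a b c d. rewrite Esv, E2 in I1. clear Esv.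
  assert (P3 : 0 < d2 a c * sv a c b d ^ 2).
  { apply Rmult_lt_0_compat; auto. apply pow2_pos; auto. }
  rewrite H1 in J1.
  set (x1 := dn d2 c d a b) in *. set (x2 := dn d2 a c b d) in *.
  set (g := cosd d2 a c b d) in *.
  pose proof (sqrt_sqrt _ (Rlt_le _ _ P1)) as Q1. pose proof (sqrt_sqrt _ (Rlt_le _ _ P2)) as Q2.
  pose proof (sqrt_sqrt _ (nn_ge0 a c d)) as Q3.
  set (n1 := sqrt (nn d2 b c d)) in *. set (n2 := sqrt (nn d2 a b c)) in *.
  set (n3 := sqrt (nn d2 a c d)) in *.
  assert (N : nn d2 b c d = nn d2 a b c).
  { rewrite <- Q1, <- Q2. rewrite <- Q1, <- Q3, J1 in I1. rewrite <- Q2, <- Q3, J2 in I2.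
    assert (n3*n3 * (1 - g * g) * (n1 * n1 - n2 * n2) = 0) by lra.
    assert (n3*n3*(1-g*g) <> 0) by (intro Z; assert (n2*n2*(n3*n3*(1-g*g)) = 0) by (rewrite Z; ring); lra).
    apply Rmult_integral in H2. destruct H2; [contradiction|lra]. }
  assert (Nn : n1 = n2) by (unfold n1, n2; rewrite N; auto).
  assert (X : x1 = - x2) by (rewrite J1, J2, Nn; ring).
  assert (Ep : d2 a b = d2 b c + 2 * d2 a c).
  { clear - X Pq E1 E2 E3. unfold x1, x2, dn, gram in X.
    rewrite (d2_sym c a), (d2_sym c b), (d2_sym d a), (d2_sym d b), E3, E2, E1 in X.
    apply Rmult_eq_reg_l with (d2 a c); [|lra].
    rewrite ?(d2_sym c b), ?(d2_sym d b), ?E3 in X. lra. }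
  set (r := sqrt (d2 a c)). set (h := sqrt (d2 b c - d2 a c)).
  assert (Hr : 0 < r) by (apply sqrt_lt_R0; auto).
  assert (Er : d2 a c = r * r) by (symmetry; apply sqrt_sqrt; lra).
  assert (V : svsq d2 a b c d = 3/4 * (d2 a c)^2 * (d2 b c - d2 a c)).
  { unfold svsq, gram. rewrite E1, E2, E3, Ep. field. }
  assert (Eh : d2 b c = h * h + r * r).
  { unfold h. rewrite sqrt_sqrt; [lra|].
    assert (0 < svsq d2 a b c d) by (rewrite svsq_d2; apply pow2_pos; auto).
    rewrite V in H2. assert (0 < d2 a c ^ 2) by (apply pow_lt; auto).
    apply Rmult_le_reg_l with (3/4 * d2 a c ^ 2); lra. }
  assert (Hh : 0 <= h) by apply sqrt_pos.
  set (k := sqrt (h * h + 3/4 * (r * r))).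
  assert (Hk : 0 <= k) by apply sqrt_pos.
  assert (Ek : k * k = h * h + 3/4 * (r * r)) by (apply sqrt_sqrt; nra).
  assert (K1 : n1 = r * k).
  { apply sqrt_lem_1; [lra|nra|]. unfold nn, gram. rewrite E3, E2, Eh, Er.
    replace (r * k * (r * k)) with (r * r * (k * k)) by ring. rewrite Ek. field. }
  assert (K4 : sqrt (nn d2 a b d) = r * k).
  { apply sqrt_lem_1; [apply nn_ge0|nra|]. unfold nn, gram. rewrite E3, E1, Ep, Eh, Er.
    replace (r * k * (r * k)) with (r * r * (k * k)) by ring. rewrite Ek. field. }
  assert (K3 : 866/1000 * (r * r) <= n3).
  { assert (n3 * n3 = 3/4 * ((r*r)*(r*r))) by (rewrite Q3; unfold nn, gram; rewrite E1, E2, Er; field).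
    assert (0 <= n3) by apply sqrt_pos.
    destruct (Rle_or_lt (866/1000 * (r * r)) n3); auto. nra. }
  unfold large_area. rewrite V.
  unfold asum. fold n1 n2 n3. rewrite K4, <- Nn, K1, Er, Eh.
  clearbody n3 k h r. clear - Hr Hh Hk Ek K3.
  assert (L1 : 4/5 * h + 3/5 * (866/1000 * r) <= k) by (apply hyp_ge; nra).
  pose proof (amgm3 (242/100 * (r*r)) (12/10 * (r * h)) (12/10 * (r*h))) as AG.
  assert (P1 : 0 <= r * h) by nra.
  assert (P2 : 0 <= r * r) by nra.
  assert (P3 : 0 <= (r*r) * ((r*h)*(r*h))) by (apply Rmult_le_pos; nra).
  assert (P4 : r * (4/5 * h + 3/5 * (866/1000 * r)) <= r * k) by (apply Rmult_le_compat_l; lra).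
  assert (P5 : 0 <= r * k) by nra.
  apply pow6_le with 91; try lra.
  - apply Rle_trans with ((242/100 * (r*r) + 12/10 * (r * h) + 12/10 * (r*h))^3).
    + specialize (AG ltac:(lra) ltac:(lra) ltac:(lra)). lra.
    + apply pow_incr. lra.
Qed.

(** * Barycentric coordinates and isometries *)

Lemma pt_eq p q : px p = px q -> py p = py q -> pz p = pz q -> p = q.
Proof. destruct p, q; simpl; intros; subst; auto. Qed.

Lemma dist_d2 p q : dist p q = sqrt (d2 p q).
Proof. reflexivity. Qed.

Lemma dist_sq p q : dist p q * dist p q = d2 p q.
Proof. apply sqrt_sqrt, dot_ge0. Qed.

Definition lin4 (s t u v : R) (A B C D : pt) : pt :=
  mkpt (s * px A + t * px B + u * px C + v * px D)
       (s * py A + t * py B + u * py C + v * py D)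
       (s * pz A + t * pz B + u * pz C + v * pz D).

Definition inhull (A B C D x : pt) : Prop :=
  exists s t u v, 0 <= s /\ 0 <= t /\ 0 <= u /\ 0 <= v /\ s + t + u + v = 1 /\ x = lin4 s t u v A B C D.

Lemma hull_inhull t x : hull t x <-> inhull (v0 t) (v1 t) (v2 t) (v3 t) x.
Proof.
  split.
  - intros (s & t' & u & v & H1 & H2 & H3 & H4 & H5 & _ & _ & _ & _ & E1 & E2 & E3).
    exists s, t', u, v; repeat split; auto. apply pt_eq; simpl; auto.
  - intros (s & t' & u & v & H1 & H2 & H3 & H4 & H5 & E). subst x.
    exists s, t', u, v; repeat split; auto; discriminate.
Qed.

Lemma lin4_sv s t u v A B C D : s + t + u + v = 1 ->
  sv A B C (lin4 s t u v A B C D) = v * sv A B C D /\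
  sv A B (lin4 s t u v A B C D) D = u * sv A B C D /\
  sv A (lin4 s t u v A B C D) C D = t * sv A B C D /\
  sv (lin4 s t u v A B C D) B C D = s * sv A B C D.
Proof.
  intros H. assert (E : s = 1 - t - u - v) by lra. subst s.
  destruct A, B, C, D; unfold lin4; uv; repeat split; ring.
Qed.

(** Cramer's rule: barycentric coordinates are quotients of signed volumes. *)
Lemma lin4_all A B C D x : sv A B C D <> 0 ->
  let V := sv A B C D in
  sv x B C D / V + sv A x C D / V + sv A B x D / V + sv A B C x / V = 1 /\
  x = lin4 (sv x B C D / V) (sv A x C D / V) (sv A B x D / V) (sv A B C x / V) A B C D.
Proof.
  intros H V. subst V. split.
  - apply Rmult_eq_reg_r with (sv A B C D); auto.
    replace ((sv x B C D / sv A B C D + sv A x C D / sv A B C D + sv A B x D / sv A B C D + sv A B C x / sv A B C D) * sv A B C D) with (sv x B C D + sv A x C D + sv A B x D + sv A B C x) by (field; auto).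
    clear H; destruct A, B, C, D, x; uv; ring.
  - apply pt_eq; unfold lin4; cbn [px py pz]; apply Rmult_eq_reg_r with (sv A B C D); auto.
    + replace ((_ * px A + _ * px B + _ * px C + _ * px D) * sv A B C D)
      with (sv x B C D * px A + sv A x C D * px B + sv A B x D * px C + sv A B C x * px D) by (field; auto).
      clear H; destruct A, B, C, D, x; uv; ring.
    + replace ((_ * py A + _ * py B + _ * py C + _ * py D) * sv A B C D)
      with (sv x B C D * py A + sv A x C D * py B + sv A B x D * py C + sv A B C x * py D) by (field; auto).
      clear H; destruct A, B, C, D, x; uv; ring.
    + replace ((_ * pz A + _ * pz B + _ * pz C + _ * pz D) * sv A B C D)
      with (sv x B C D * pz A + sv A x C D * pz B + sv A B x D * pz C + sv A B C x * pz D) by (field; auto).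
      clear H; destruct A, B, C, D, x; uv; ring.
Qed.

Lemma lin4_inj s t u v s' t' u' v' A B C D : sv A B C D <> 0 ->
  s + t + u + v = 1 -> s' + t' + u' + v' = 1 ->
  lin4 s t u v A B C D = lin4 s' t' u' v' A B C D -> s = s' /\ t = t' /\ u = u' /\ v = v'.
Proof.
  intros H H1 H2 E.
  destruct (lin4_sv _ _ _ _ A B C D H1) as (E1 & E2 & E3 & E4).
  destruct (lin4_sv _ _ _ _ A B C D H2) as (F1 & F2 & F3 & F4).
  rewrite E in *. repeat split; apply Rmult_eq_reg_r with (sv A B C D); auto; congruence.
Qed.

Lemma inhull_sv A B C D x : sv A B C D <> 0 ->
  0 <= sv x B C D / sv A B C D -> 0 <= sv A x C D / sv A B C D ->
  0 <= sv A B x D / sv A B C D -> 0 <= sv A B C x / sv A B C D -> inhull A B C D x.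
Proof.
  intros H H1 H2 H3 H4. destruct (lin4_all A B C D x H) as [S E].
  do 4 eexists. repeat split; [| | | | |exact E]; auto.
Qed.

Lemma sv_lipschitz A B C x y :
  Rabs (sv A B C x - sv A B C y) <= sqrt (nn d2 A B C) * dist x y.
Proof.
  rewrite nn_norm.
  replace (sv A B C x - sv A B C y) with (dot (cross (vsub B A) (vsub C A)) (vsub x y))
    by (destruct A, B, C, x, y; uv; ring).
  pose proof (cauchy_two_sided (cross (vsub B A) (vsub C A)) (vsub x y)) as [H1 H2].
  change (norm (vsub x y)) with (dist x y) in *.
  apply Rabs_le; lra.
Qed.

Lemma Rabs_le_both x y : Rabs x <= y -> - y <= x <= y.
Proof. unfold Rabs; destruct (Rcase_abs x); lra. Qed.

Lemma ratio_ge0 V a b m k e : V <> 0 -> a = m * V -> Rabs (a - b) <= k * e -> k * e <= m * Rabs V -> 0 <= b / V.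
Proof.
  intros HV Ha H1 H2. assert (H3 : Rabs (a - b) <= m * Rabs V) by lra.
  assert (K : 0 <= b * V).
  { subst a. apply Rabs_le_both in H3. destruct H3.
    unfold Rabs in *. destruct (Rcase_abs V); nra. }
  replace (b / V) with (b * V * (/ (V * V))) by (field; auto).
  apply Rmult_le_pos; auto. left; apply Rinv_0_lt_compat. nra.
Qed.

Lemma dist_ge0 x y : 0 <= dist x y.
Proof. apply sqrt_pos. Qed.

(* The radius depends only on the weights and the edge lengths, so it is uniform over all tiles. *)
Lemma ball_in_hull A B C D s t u v m y : sv A B C D <> 0 -> s + t + u + v = 1 ->
  m <= s -> m <= t -> m <= u -> m <= v -> 0 <= m ->
  dist (lin4 s t u v A B C D) y * asum d2 A B C D <= m * Rabs (sv A B C D) -> inhull A B C D y.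
Proof.
  intros H H1 Hs Ht Hu Hv Hm Hd.
  set (x := lin4 s t u v A B C D) in *.
  destruct (lin4_sv _ _ _ _ A B C D H1) as (E1 & E2 & E3 & E4). fold x in E1, E2, E3, E4.
  unfold asum in Hd. pose proof (dist_ge0 x y) as D0.
  pose proof (sqrt_pos (nn d2 A B C)). pose proof (sqrt_pos (nn d2 A B D)).
  pose proof (sqrt_pos (nn d2 A C D)). pose proof (sqrt_pos (nn d2 B C D)).
  pose proof (Rabs_pos (sv A B C D)) as PV.
  apply inhull_sv; auto.
  - apply ratio_ge0 with (1 := H) (2 := E4) (k := sqrt (nn d2 B C D)) (e := dist x y).
    + replace (sv x B C D - sv y B C D) with (- (sv B C D x - sv B C D y)) by (destruct x, y, B, C, D; uv; ring).
      rewrite Rabs_Ropp. apply sv_lipschitz.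
    + nra.
  - apply ratio_ge0 with (1 := H) (2 := E3) (k := sqrt (nn d2 A C D)) (e := dist x y).
    + replace (sv A x C D - sv A y C D) with (sv A C D x - sv A C D y) by (destruct A, x, y, C, D; uv; ring).
      apply sv_lipschitz.
    + nra.
  - apply ratio_ge0 with (1 := H) (2 := E2) (k := sqrt (nn d2 A B D)) (e := dist x y).
    + replace (sv A B x D - sv A B y D) with (- (sv A B D x - sv A B D y)) by (destruct A, x, y, B, D; uv; ring).
      rewrite Rabs_Ropp. apply sv_lipschitz.
    + nra.
  - apply ratio_ge0 with (1 := H) (2 := E1) (k := sqrt (nn d2 A B C)) (e := dist x y).
    + apply sv_lipschitz.
    + nra.
Qed.

Lemma asum_pos A B C D : sv A B C D <> 0 -> 0 < asum d2 A B C D.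
Proof.
  intros H. unfold asum. pose proof (sqrt_lt_R0 _ (nn_pos _ _ _ _ H)).
  pose proof (sqrt_pos (nn d2 A B D)).
  pose proof (sqrt_pos (nn d2 A C D)). pose proof (sqrt_pos (nn d2 B C D)). lra.
Qed.

Lemma interior_lin4 A B C D s t u v : sv A B C D <> 0 -> s + t + u + v = 1 ->
  0 < s -> 0 < t -> 0 < u -> 0 < v -> interior (inhull A B C D) (lin4 s t u v A B C D).
Proof.
  intros H H1 Hs Ht Hu Hv. pose proof (asum_pos _ _ _ _ H) as PA.
  set (m := Rmin (Rmin s t) (Rmin u v)).
  assert (Hm : 0 < m) by (unfold m; repeat apply Rmin_glb_lt; auto).
  assert (P := Rabs_pos_lt _ H).
  exists (m * Rabs (sv A B C D) / asum d2 A B C D). split.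
  - apply Rdiv_lt_0_compat; auto. apply Rmult_lt_0_compat; auto.
  - intros y Hy. apply ball_in_hull with s t u v m; auto; try lra; unfold m;
      try solve [eapply Rle_trans; [|apply Rmin_l]; eapply Rle_trans; [apply Rmin_l|]; lra].
    + eapply Rle_trans; [apply Rmin_l|apply Rmin_l].
    + eapply Rle_trans; [apply Rmin_l|apply Rmin_r].
    + eapply Rle_trans; [apply Rmin_r|apply Rmin_l].
    + eapply Rle_trans; [apply Rmin_r|apply Rmin_r].
    + fold m. left. apply Rmult_lt_reg_r with (/ asum d2 A B C D); [apply Rinv_0_lt_compat; auto|].
      rewrite Rmult_assoc, Rinv_r, Rmult_1_r by lra. exact Hy.
Qed.

Lemma interior_ext A B x : seteq A B -> interior A x -> interior B x.
Proof. intros E (e & He & H). exists e; split; auto. intros y Hy; apply E, H, Hy. Qed.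

Lemma d2_lin4 s t u v A B C D : s + t + u + v = 1 ->
  d2 (lin4 s t u v A B C D) A =
  t^2 * d2 A B + u^2 * d2 A C + v^2 * d2 A D
  + 2*t*u * gram d2 A B C + 2*t*v * gram d2 A B D + 2*u*v * gram d2 A C D.
Proof.
  intros H. assert (E : s = 1 - t - u - v) by lra. subst s.
  destruct A, B, C, D; unfold lin4; uL; uv; field.
Qed.

Lemma lin4_rot s t u v A B C D : lin4 s t u v A B C D = lin4 t u v s B C D A.
Proof. apply pt_eq; simpl; ring. Qed.

Lemma isometry_d2 f : isometry f -> forall x y, d2 (f x) (f y) = d2 x y.
Proof. intros H x y. rewrite <- !dist_sq, H; auto. Qed.

Lemma isometry_d2_lin4 f s t u v A B C D : isometry f -> s + t + u + v = 1 ->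
  d2 (lin4 s t u v (f A) (f B) (f C) (f D)) (f A) = d2 (f (lin4 s t u v A B C D)) (f A).
Proof.
  intros H H1. rewrite isometry_d2, !d2_lin4 by auto. unfold gram. rewrite !(isometry_d2 _ H). reflexivity.
Qed.

Lemma orthogonal_zero e1 e2 e3 w : det3 e1 e2 e3 <> 0 -> dot w e1 = 0 -> dot w e2 = 0 -> dot w e3 = 0 ->
  w = mkpt 0 0 0.
Proof.
  intros H H1 H2 H3.
  assert (K : forall k, det3 e1 e2 e3 * k = 0 -> k = 0).
  { intros k Hk. apply Rmult_integral in Hk. tauto. }
  apply pt_eq; cbn [px py pz]; apply K.
  - replace (det3 e1 e2 e3 * px w) with
     (dot w e1 * px (cross e2 e3) + dot w e2 * px (cross e3 e1) + dot w e3 * px (cross e1 e2))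
     by (destruct e1, e2, e3, w; uv; ring). rewrite H1, H2, H3; ring.
  - replace (det3 e1 e2 e3 * py w) with
     (dot w e1 * py (cross e2 e3) + dot w e2 * py (cross e3 e1) + dot w e3 * py (cross e1 e2))
     by (destruct e1, e2, e3, w; uv; ring). rewrite H1, H2, H3; ring.
  - replace (det3 e1 e2 e3 * pz w) with
     (dot w e1 * pz (cross e2 e3) + dot w e2 * pz (cross e3 e1) + dot w e3 * pz (cross e1 e2))
     by (destruct e1, e2, e3, w; uv; ring). rewrite H1, H2, H3; ring.
Qed.

(** Subtracting the equations pairwise cancels the quadratic terms, so [x - y] is orthogonal to
    three independent edges. *)
Lemma equidistant_eq A B C D x y : sv A B C D <> 0 ->
  d2 x A = d2 y A -> d2 x B = d2 y B -> d2 x C = d2 y C -> d2 x D = d2 y D -> x = y.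
Proof.
  intros H HA HB HC HD.
  assert (E : vsub x y = mkpt 0 0 0).
  { apply orthogonal_zero with (vsub B A) (vsub C A) (vsub D A); auto.
    - clear - HA HB. destruct A, B, x, y; uv; lra.
    - clear - HA HC. destruct A, C, x, y; uv; lra.
    - clear - HA HD. destruct A, D, x, y; uv; lra. }
  unfold vsub in E. injection E; intros. apply pt_eq; lra.
Qed.

Lemma isometry_svsq f A B C D : isometry f -> sv (f A) (f B) (f C) (f D) ^ 2 = sv A B C D ^ 2.
Proof.
  intros H. rewrite <- !svsq_d2. unfold svsq, gram. rewrite !(isometry_d2 _ H). reflexivity.
Qed.

Lemma isometry_sv_ne f A B C D : isometry f -> sv A B C D <> 0 -> sv (f A) (f B) (f C) (f D) <> 0.
Proof.
  intros H H1 E. pose proof (isometry_svsq f A B C D H) as S. rewrite E in S.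
  apply H1. simpl in S. nra.
Qed.

(** An isometry is only assumed to preserve distances. It is affine because both sides have the same
    distances to four affinely independent points. *)
Lemma isometry_lin4 f s t u v A B C D : isometry f -> sv A B C D <> 0 -> s + t + u + v = 1 ->
  f (lin4 s t u v A B C D) = lin4 s t u v (f A) (f B) (f C) (f D).
Proof.
  intros Hf H H1. symmetry. apply equidistant_eq with (f A) (f B) (f C) (f D).
  - apply isometry_sv_ne; auto.
  - apply isometry_d2_lin4; auto.
  - rewrite !(lin4_rot s). apply isometry_d2_lin4; auto; lra.
  - rewrite !(lin4_rot s), !(lin4_rot t). apply isometry_d2_lin4; auto; lra.
  - rewrite !(lin4_rot s), !(lin4_rot t), !(lin4_rot u). apply isometry_d2_lin4; auto; lra.
Qed.

Lemma image_inhull f A B C D : isometry f -> sv A B C D <> 0 ->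
  seteq (image f (inhull A B C D)) (inhull (f A) (f B) (f C) (f D)).
Proof.
  intros Hf H x; split.
  - intros (y & (s & t & u & v & H1 & H2 & H3 & H4 & H5 & E) & Ex). subst.
    exists s, t, u, v; repeat split; auto. apply isometry_lin4; auto.
  - intros (s & t & u & v & H1 & H2 & H3 & H4 & H5 & E). subst.
    exists (lin4 s t u v A B C D). split.
    + exists s, t, u, v; repeat split; auto.
    + apply isometry_lin4; auto.
Qed.

Lemma inhull_vertex A B C D : inhull A B C D A.
Proof. exists 1, 0, 0, 0; repeat split; try lra. apply pt_eq; simpl; ring. Qed.

Lemma weight_le1 A B C D x : sv A B C D <> 0 -> inhull A B C D x ->
  sv x B C D / sv A B C D <= 1 /\ (sv x B C D / sv A B C D = 1 -> x = A).
Proof.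
  intros H (s & t & u & v & H1 & H2 & H3 & H4 & H5 & E).
  destruct (lin4_sv _ _ _ _ A B C D H5) as (_ & _ & _ & E4). rewrite <- E in E4.
  rewrite E4. replace (s * sv A B C D / sv A B C D) with s by (field; auto).
  split; [lra|]. intros Hs. assert (t = 0) by lra. assert (u = 0) by lra. assert (v = 0) by lra.
  subst. apply pt_eq; simpl; ring.
Qed.

(** The barycentric weight at [A] is affine, at most 1 on the simplex, and equal to 1 at [A] only; a
    convex combination reaching 1 must use [A] itself. Membership is asked only of points with
    nonzero weight, since a face supplies no more. *)
Lemma extreme_vertex A B C D s t u v P0 P1 P2 P3 : sv A B C D <> 0 ->
  0 <= s -> 0 <= t -> 0 <= u -> 0 <= v -> s + t + u + v = 1 ->
  A = lin4 s t u v P0 P1 P2 P3 ->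
  (s <> 0 -> inhull A B C D P0) -> (t <> 0 -> inhull A B C D P1) ->
  (u <> 0 -> inhull A B C D P2) -> (v <> 0 -> inhull A B C D P3) ->
  (s <> 0 /\ P0 = A) \/ (t <> 0 /\ P1 = A) \/ (u <> 0 /\ P2 = A) \/ (v <> 0 /\ P3 = A).
Proof.
  intros H Hs Ht Hu Hv S EA H0 H1 H2 H3.
  set (w := fun x => sv x B C D / sv A B C D).
  assert (W : s * w P0 + t * w P1 + u * w P2 + v * w P3 = 1).
  { unfold w. apply Rmult_eq_reg_r with (sv A B C D); auto.
    rewrite Rmult_1_l.
    transitivity (sv (lin4 s t u v P0 P1 P2 P3) B C D); [|rewrite <- EA; reflexivity].
    replace ((s * (sv P0 B C D / sv A B C D) + t * (sv P1 B C D / sv A B C D) + u * (sv P2 B C D / sv A B C D) + v * (sv P3 B C D / sv A B C D)) * sv A B C D)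
     with (s * sv P0 B C D + t * sv P1 B C D + u * sv P2 B C D + v * sv P3 B C D) by (field; auto).
    clear - S. assert (E : s = 1 - t - u - v) by lra. subst s.
    destruct B, C, D, P0, P1, P2, P3; unfold lin4; uv; ring. }
  assert (K : forall r P, 0 <= r -> (r <> 0 -> inhull A B C D P) -> r * w P <= r /\ (r * w P = r -> r <> 0 -> P = A)).
  { intros r P Hr HP. destruct (Req_dec r 0) as [->|N]; [split; [lra|intros; lra]|].
    destruct (weight_le1 A B C D P H (HP N)) as [L1 L2]. fold (w P) in *.
    split; [nra|]. intros E _. apply L2. apply Rmult_eq_reg_l with r; lra. }
  destruct (K _ _ Hs H0), (K _ _ Ht H1), (K _ _ Hu H2), (K _ _ Hv H3).
  destruct (Req_dec s 0); [|left; split; auto; apply H5; auto; lra].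
  destruct (Req_dec t 0); [|right; left; split; auto; apply H7; auto; lra].
  destruct (Req_dec u 0); [|right; right; left; split; auto; apply H9; auto; lra].
  destruct (Req_dec v 0); [lra|right; right; right; split; auto; apply H11; auto; lra].
Qed.

(** * Labelled tilings *)

Inductive idx : Set := i0 | i1 | i2 | i3.

Definition vt (t : tet) (k : idx) : pt :=
  match k with i0 => v0 t | i1 => v1 t | i2 => v2 t | i3 => v3 t end.

Definition dst (a b c d : idx) : Prop :=
  a <> b /\ a <> c /\ a <> d /\ b <> c /\ b <> d /\ c <> d.

Definition even (a b c d : idx) : bool :=
  match a, b, c, d with
  | i0, i1, i2, i3 | i0, i2, i3, i1 | i0, i3, i1, i2
  | i1, i0, i3, i2 | i1, i2, i0, i3 | i1, i3, i2, i0
  | i2, i0, i1, i3 | i2, i1, i3, i0 | i2, i3, i0, i1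
  | i3, i0, i2, i1 | i3, i1, i0, i2 | i3, i2, i1, i0 => true
  | _, _, _, _ => false
  end.

Notation linQ s t u v P := (lin4 s t u v (P i0) (P i1) (P i2) (P i3)) (only parsing).
Definition inhullQ (P : idx -> pt) : pt -> Prop := inhull (P i0) (P i1) (P i2) (P i3).
Definition svQ (P : idx -> pt) : R := sv (P i0) (P i1) (P i2) (P i3).

Ltac perms a b c d H :=
  destruct a, b, c, d; try (exfalso; unfold dst in H; intuition congruence).

Lemma dst_ex a b c : a <> b -> a <> c -> b <> c -> exists d, dst a b c d.
Proof.
  intros. destruct a, b, c; try congruence;
  first [ exists i0; repeat split; congruence | exists i1; repeat split; congruence
        | exists i2; repeat split; congruence | exists i3; repeat split; congruence ].
Qed.

Lemma dst_cover a b c d : dst a b c d -> forall k, k = a \/ k = b \/ k = c \/ k = d.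
Proof. intros H k; perms a b c d H; destruct k; tauto. Qed.

Lemma dst_any k : exists b c d, dst k b c d.
Proof.
  destruct k; [exists i1, i2, i3|exists i0, i2, i3|exists i0, i1, i3|exists i0, i1, i2];
  repeat split; congruence.
Qed.

Lemma svQ_perm P a b c d : dst a b c d ->
  sv (P a) (P b) (P c) (P d) = if even a b c d then svQ P else - svQ P.
Proof.
  intros H; unfold svQ; perms a b c d H; cbn [even];
  destruct (P i0), (P i1), (P i2), (P i3); uv; ring.
Qed.

Lemma svQ_perm_ne P a b c d : dst a b c d -> svQ P <> 0 -> sv (P a) (P b) (P c) (P d) <> 0.
Proof. intros H1 H2. rewrite svQ_perm by auto. destruct (even a b c d); lra. Qed.

Lemma inhull_perm P a b c d x : dst a b c d ->
  (inhull (P a) (P b) (P c) (P d) x <-> inhullQ P x).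
Proof.
  intros H. set (w := fun s t u v : R => fun k : idx =>
    match k with i0 => s | i1 => t | i2 => u | i3 => v end).
  split.
  - intros (s & t & u & v & H1 & H2 & H3 & H4 & H5 & E).
    set (g := fun k => if (match k, a with i0, i0 | i1, i1 | i2, i2 | i3, i3 => true | _, _ => false end) then s
       else if (match k, b with i0, i0 | i1, i1 | i2, i2 | i3, i3 => true | _, _ => false end) then t
       else if (match k, c with i0, i0 | i1, i1 | i2, i2 | i3, i3 => true | _, _ => false end) then u else v).
    exists (g i0), (g i1), (g i2), (g i3). subst x. unfold g.
    perms a b c d H; repeat split; auto; try lra; apply pt_eq; simpl; ring.
  - intros (s & t & u & v & H1 & H2 & H3 & H4 & H5 & E).
    exists (w s t u v a), (w s t u v b), (w s t u v c), (w s t u v d). subst x.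
    perms a b c d H; repeat split; unfold w; auto; try lra; apply pt_eq; simpl; ring.
Qed.

Lemma vertex_in P k : inhullQ P (P k).
Proof. destruct (dst_any k) as (b & c & d & H). apply (inhull_perm P k b c d); auto. apply inhull_vertex. Qed.

Lemma svQ_inj P a b : svQ P <> 0 -> P a = P b -> a = b.
Proof.
  intros H E. destruct a, b; auto; exfalso; apply H; unfold svQ; rewrite ?E, <- ?E;
  destruct (P i0), (P i1), (P i2), (P i3); uv; ring.
Qed.

(** All tiles carry labels with the same lengths and the same orientation. The face-to-face
    condition survives only as [lt_facet]: a tile that contains the centre of a facet of another
    tile has the three vertices of that facet. *)
Record labelled_tiling (L : idx -> idx -> R) (I : Type) (Q : I -> idx -> pt) : Prop := {
  lt_len : forall i a b, d2 (Q i a) (Q i b) = L a b;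
  lt_or : forall i j, 0 < svQ (Q i) * svQ (Q j);
  lt_cover : forall x, exists i, inhullQ (Q i) x;
  lt_disj : forall i j x, interior (inhullQ (Q i)) x -> interior (inhullQ (Q j)) x -> i = j;
  lt_facet : forall i j a b c d, i <> j -> dst a b c d ->
    inhullQ (Q j) (lin4 (1/3) (1/3) (1/3) 0 (Q i a) (Q i b) (Q i c) (Q i d)) ->
    exists a' b' c' d', dst a' b' c' d' /\ Q j a' = Q i a /\ Q j b' = Q i b /\ Q j c' = Q i c
}.

(** A tile is related to the prototile only as a point set, so its vertices are recovered as the
    extreme points of that set. *)
Lemma hull_vertices t P : svQ P <> 0 -> seteq (hull t) (inhullQ P) ->
  (forall k, exists m, vt t m = P k) /\ (forall m, exists k, vt t m = P k).
Proof.
  intros H E.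
  assert (V : forall k, exists m, vt t m = P k).
  { intros k. destruct (dst_any k) as (b & c & d & Hd).
    assert (Hk : hull t (P k)) by (apply E, vertex_in).
    apply hull_inhull in Hk. destruct Hk as (s & t' & u & v & H1 & H2 & H3 & H4 & H5 & EA).
    assert (I : forall m, inhull (P k) (P b) (P c) (P d) (vt t m)).
    { intros m. apply inhull_perm; auto. apply E, hull_inhull. change (inhullQ (vt t) (vt t m)). apply vertex_in. }
    destruct (extreme_vertex (P k) (P b) (P c) (P d) s t' u v (vt t i0) (vt t i1) (vt t i2) (vt t i3))
      as [[_ K]|[[_ K]|[[_ K]|[_ K]]]]; auto; eauto.
    apply svQ_perm_ne; auto. }
  split; auto.
  destruct (V i0) as [m0 E0], (V i1) as [m1 E1], (V i2) as [m2 E2], (V i3) as [m3 E3].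
  assert (D : dst m0 m1 m2 m3).
  { assert (K : forall a b, P a = P b -> a = b) by (intros; apply svQ_inj with P; auto).
    repeat split; intro; subst;
    match goal with A1 : vt t ?m = P ?a, A2 : vt t ?m = P ?b |- _ =>
      assert (Z : a = b) by (apply K; congruence); discriminate Z end. }
  intros m. destruct (dst_cover _ _ _ _ D m) as [->|[->|[->| ->]]]; eauto.
Qed.

Definition bsel (b0 b1 b2 b3 : bool) (k : idx) : bool :=
  match k with i0 => b0 | i1 => b1 | i2 => b2 | i3 => b3 end.

Lemma hull_sub_vertex t b0 b1 b2 b3 m : bsel b0 b1 b2 b3 m = true -> hull_sub t b0 b1 b2 b3 (vt t m).
Proof.
  intros H. destruct m; simpl in H; subst;
  [exists 1, 0, 0, 0|exists 0, 1, 0, 0|exists 0, 0, 1, 0|exists 0, 0, 0, 1];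
  repeat split; try lra; try discriminate; simpl; ring.
Qed.

Lemma hull_sub_lin4 t b0 b1 b2 b3 x : hull_sub t b0 b1 b2 b3 x ->
  exists s t' u v, 0 <= s /\ 0 <= t' /\ 0 <= u /\ 0 <= v /\ s + t' + u + v = 1 /\
    (s <> 0 -> b0 = true) /\ (t' <> 0 -> b1 = true) /\ (u <> 0 -> b2 = true) /\ (v <> 0 -> b3 = true) /\
    x = lin4 s t' u v (vt t i0) (vt t i1) (vt t i2) (vt t i3).
Proof.
  intros (s & t' & u & v & H1 & H2 & H3 & H4 & H5 & K0 & K1 & K2 & K3 & E1 & E2 & E3).
  exists s, t', u, v. repeat split; auto.
  - destruct b0; auto; intros N; exfalso; auto.
  - destruct b1; auto; intros N; exfalso; auto.
  - destruct b2; auto; intros N; exfalso; auto.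
  - destruct b3; auto; intros N; exfalso; auto.
  - apply pt_eq; auto.
Qed.

Lemma lin4_sv_gen s t u v P0 P1 P2 P3 B C D : s + t + u + v = 1 ->
  sv (lin4 s t u v P0 P1 P2 P3) B C D = s * sv P0 B C D + t * sv P1 B C D + u * sv P2 B C D + v * sv P3 B C D.
Proof.
  intros S. assert (E : s = 1 - t - u - v) by lra. subst s.
  destruct B, C, D, P0, P1, P2, P3; unfold lin4; uv; ring.
Qed.

(** The weight at [P a] vanishes at all other vertices, so a face without [P a] would contain no
    point of positive weight there. *)
Lemma face_contains_vertex t P a b c d b0 b1 b2 b3 s t' u v : svQ P <> 0 -> seteq (hull t) (inhullQ P) ->
  dst a b c d -> s + t' + u + v = 1 -> 0 < s ->
  hull_sub t b0 b1 b2 b3 (lin4 s t' u v (P a) (P b) (P c) (P d)) ->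
  exists m, bsel b0 b1 b2 b3 m = true /\ vt t m = P a.
Proof.
  intros H E Hd S Hs HF. destruct (hull_vertices t P H E) as [_ V].
  assert (N := svQ_perm_ne P a b c d Hd H).
  apply hull_sub_lin4 in HF.
  destruct HF as (s' & t1 & u' & v' & H1 & H2 & H3 & H4 & H5 & K0 & K1 & K2 & K3 & Ex).
  destruct (lin4_sv _ _ _ _ (P a) (P b) (P c) (P d) S) as (_ & _ & _ & W).
  rewrite Ex, lin4_sv_gen in W by auto.
  assert (Z : forall m, vt t m <> P a -> sv (vt t m) (P b) (P c) (P d) = 0).
  { intros m Hm. destruct (V m) as [k Ek]. rewrite Ek in *.
    destruct (dst_cover _ _ _ _ Hd k) as [->|[->|[->| ->]]]; [congruence|..];
    destruct (P b), (P c), (P d); uv; ring. }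
  assert (C : forall m r, r * sv (vt t m) (P b) (P c) (P d) <> 0 -> r <> 0 /\ vt t m = P a).
  { intros m r Hr. split; [intro; subst; apply Hr; ring|].
    apply NNPP; intro Hm; apply Hr; rewrite Z by auto; ring. }
  assert (NZ : s * sv (P a) (P b) (P c) (P d) <> 0) by (apply Rmult_integral_contrapositive; split; lra).
  destruct (Req_dec (s' * sv (vt t i0) (P b) (P c) (P d)) 0) as [Z0|Z0];
    [|destruct (C _ _ Z0); exists i0; split; auto].
  destruct (Req_dec (t1 * sv (vt t i1) (P b) (P c) (P d)) 0) as [Z1|Z1];
    [|destruct (C _ _ Z1); exists i1; split; auto].
  destruct (Req_dec (u' * sv (vt t i2) (P b) (P c) (P d)) 0) as [Z2|Z2];
    [|destruct (C _ _ Z2); exists i2; split; auto].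
  destruct (Req_dec (v' * sv (vt t i3) (P b) (P c) (P d)) 0) as [Z3|Z3];
    [|destruct (C _ _ Z3); exists i3; split; auto].
  lra.
Qed.

(** The common face [F] contains [Pi a]. It is also spanned by vertices of the second tile, all of
    which lie in the first one, where [Pi a] is extreme; hence it is one of them. *)
Lemma shared_vertex ti tj Pi Pj F a b c d s t' u v :
  svQ Pi <> 0 -> svQ Pj <> 0 -> seteq (hull ti) (inhullQ Pi) -> seteq (hull tj) (inhullQ Pj) ->
  face_of ti F -> face_of tj F -> seteq (fun x => hull ti x /\ hull tj x) F ->
  dst a b c d -> s + t' + u + v = 1 -> 0 < s ->
  F (lin4 s t' u v (Pi a) (Pi b) (Pi c) (Pi d)) ->
  exists a', Pj a' = Pi a.
Proof.
  intros Hi Hj Ei Ej (b0 & b1 & b2 & b3 & _ & _ & F1) (c0 & c1 & c2 & c3 & _ & _ & F2) FF Hd S Hs Hp.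
  apply F1 in Hp. destruct (face_contains_vertex ti Pi a b c d b0 b1 b2 b3 s t' u v Hi Ei Hd S Hs Hp) as (m & Hm & Em).
  assert (FA : F (Pi a)) by (apply F1; rewrite <- Em; apply hull_sub_vertex; auto).
  apply F2 in FA. apply hull_sub_lin4 in FA.
  destruct FA as (s1 & t1 & u1 & w1 & H1 & H2 & H3 & H4 & H5 & K0 & K1 & K2 & K3 & Ex).
  assert (I : forall k, bsel c0 c1 c2 c3 k = true -> inhull (Pi a) (Pi b) (Pi c) (Pi d) (vt tj k)).
  { intros k Hk. apply inhull_perm; auto. apply Ei. apply FF, F2, hull_sub_vertex; auto. }
  destruct (hull_vertices tj Pj Hj Ej) as [_ V].
  destruct (extreme_vertex (Pi a) (Pi b) (Pi c) (Pi d) s1 t1 u1 w1 (vt tj i0) (vt tj i1) (vt tj i2) (vt tj i3))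
   as [[_ K]|[[_ K]|[[_ K]|[_ K]]]]; auto.
  - apply svQ_perm_ne; auto.
  - destruct (V i0) as [k Ek]; exists k; congruence.
  - destruct (V i1) as [k Ek]; exists k; congruence.
  - destruct (V i2) as [k Ek]; exists k; congruence.
  - destruct (V i3) as [k Ek]; exists k; congruence.
Qed.

(** The labels of one tile [o] are carried to all others by orientation-preserving isometries. The
    isometry from [T] to [o] may reverse orientation, so only the signs of different tiles are
    compared. *)
Lemma tiling_labelled T : svQ (vt T) <> 0 -> admits_op_ftf_tiling T ->
  exists I Q, labelled_tiling (fun a b => d2 (vt T a) (vt T b)) I Q.
Proof.
  intros HT (I & tile & (Hc & Hcov & Hdis & Hftf) & Hop).
  destruct (Hcov (mkpt 0 0 0)) as [o _].
  destruct (Hc o) as (f & Hf & Ef).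
  set (P := fun k => f (vt T k)).
  assert (HP : svQ P <> 0) by (apply isometry_sv_ne; auto).
  assert (EP : seteq (hull (tile o)) (inhullQ P)).
  { intros x. rewrite (Ef x). unfold inhullQ, P. rewrite <- (image_inhull f _ _ _ _ Hf HT x).
    split; intros (y & Hy & E); exists y; split; auto; apply hull_inhull; auto. }
  assert (G : forall j, exists g, isometry g /\ orient_pres g /\ seteq (hull (tile j)) (image g (hull (tile o))))
    by (intros j; apply Hop).
  set (g := fun j => proj1_sig (constructive_indefinite_description _ (G j))).
  assert (Hg : forall j, isometry (g j) /\ orient_pres (g j) /\ seteq (hull (tile j)) (image (g j) (hull (tile o))))
    by (intros j; unfold g; destruct (constructive_indefinite_description _ (G j)); auto).
  clearbody g. clear G.
  set (Q := fun j k => g j (P k)).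
  assert (SQ : forall j, 0 < svQ (Q j) * svQ P).
  { intros j. destruct (Hg j) as (G1 & G2 & _).
    destruct (Rlt_or_le 0 (svQ P)) as [Pp|Pn].
    - apply Rmult_lt_0_compat; auto. apply G2; auto.
    (* [orient_pres] speaks of positive quadruples only, so two vertices are exchanged first. *)
    - assert (0 < sv (P i1) (P i0) (P i2) (P i3)) by (rewrite sv_swap01; unfold svQ in *; lra).
      apply G2 in H. fold (Q j i1) (Q j i0) (Q j i2) (Q j i3) in H.
      rewrite sv_swap01 in H. unfold svQ in *. nra. }
  assert (NQ : forall j, svQ (Q j) <> 0) by (intros j Z; specialize (SQ j); rewrite Z in SQ; lra).
  assert (EQ : forall j, seteq (hull (tile j)) (inhullQ (Q j))).
  { intros j x. destruct (Hg j) as (G1 & G2 & G3). rewrite (G3 x).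
    unfold inhullQ at 1, Q. rewrite <- (image_inhull (g j) _ _ _ _ G1 HP x).
    split; intros (y & Hy & E); exists y; split; auto; apply EP; auto. }
  exists I, Q. split.
  - intros j a b. unfold Q, P. destruct (Hg j) as (G1 & _). rewrite !isometry_d2; auto.
  - intros i j. pose proof (SQ i). pose proof (SQ j).
    assert (0 < svQ P * svQ P) by nra.
    assert (0 < (svQ (Q i) * svQ P) * (svQ (Q j) * svQ P)) by nra.
    apply Rmult_lt_reg_r with (svQ P * svQ P); auto. nra.
  - intros x. destruct (Hcov x) as [i Hi]. exists i. apply EQ; auto.
  - intros i j x H1 H2. apply NNPP; intro N. apply (Hdis i j N x).
    split; [apply interior_ext with (2 := H1)|apply interior_ext with (2 := H2)]; intros y; symmetry; apply EQ.
  - intros i j a b c d Hij Hd Hp.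
    set (p := lin4 _ _ _ _ _ _ _ _) in Hp.
    assert (Hpi : inhullQ (Q i) p).
    { apply (inhull_perm (Q i) a b c d); auto. exists (1/3), (1/3), (1/3), 0. repeat split; try lra. }
    destruct (Hftf i j Hij) as [Ne | (F & F1 & F2 & FF)].
    { exfalso. apply (Ne p). split; apply EQ; auto. }
    assert (Fp : F p) by (apply FF; split; apply EQ; auto).
    destruct (shared_vertex (tile i) (tile j) (Q i) (Q j) F a b c d (1/3) (1/3) (1/3) 0) as [a' Ea]; auto; try lra.
    destruct (shared_vertex (tile i) (tile j) (Q i) (Q j) F b a c d (1/3) (1/3) (1/3) 0) as [b' Eb]; auto; try lra.
    { unfold dst in *; intuition. }
    { replace (lin4 _ _ _ _ _ _ _ _) with p; auto. apply pt_eq; simpl; ring. }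
    destruct (shared_vertex (tile i) (tile j) (Q i) (Q j) F c a b d (1/3) (1/3) (1/3) 0) as [c' Ec]; auto; try lra.
    { unfold dst in *; intuition. }
    { replace (lin4 _ _ _ _ _ _ _ _) with p; auto. apply pt_eq; simpl; ring. }
    assert (K : forall x y, Q i x = Q i y -> x = y) by (intros; apply svQ_inj with (Q i); auto).
    destruct Hd as (D1 & D2 & D3 & D4 & D5 & D6).
    destruct (dst_ex a' b' c') as [d' Hd'].
    + intro; subst. apply D1, K; congruence.
    + intro; subst. apply D2, K; congruence.
    + intro; subst. apply D4, K; congruence.
    + exists a', b', c', d'; auto.
Qed.

(** * Tilings: neighbours across a facet *)

Definition infinitely_often (A : nat -> Prop) : Prop := forall m, exists k, (m <= k)%nat /\ A k.

Lemma infinitely_often_or A B : infinitely_often (fun k => A k \/ B k) ->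
  infinitely_often A \/ infinitely_often B.
Proof.
  intros H. destruct (classic (infinitely_often A)) as [|N]; auto. right.
  apply not_all_ex_not in N. destruct N as [m0 Hm0].
  intros m. destruct (H (max m m0)) as (k & Hk & [HA|HB]).
  - exfalso. apply Hm0. exists k. split; auto. lia.
  - exists k; split; auto; lia.
Qed.

Lemma infinitely_often_imp (A B : nat -> Prop) : (forall k, A k -> B k) -> infinitely_often A -> infinitely_often B.
Proof. intros H HA m. destruct (HA m) as (k & Hk & K). exists k; auto. Qed.

Lemma pigeonhole_interval (u : nat -> R) delta n : 0 < delta -> forall lo A, infinitely_often A ->
  (forall k, A k -> lo <= u k <= lo + INR n * delta) ->
  exists c, infinitely_often (fun k => A k /\ c <= u k <= c + delta).
Proof.
  intros Hd. induction n as [|n IH]; intros lo A HA Hu.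
  - exists lo. apply infinitely_often_imp with (2 := HA). intros k Hk. split; auto.
    specialize (Hu k Hk). simpl in Hu. lra.
  - assert (HS : infinitely_often (fun k => (A k /\ lo <= u k <= lo + delta) \/ (A k /\ lo + delta <= u k))).
    { apply infinitely_often_imp with (2 := HA). intros k Hk. specialize (Hu k Hk).
      destruct (Rle_or_lt (u k) (lo + delta)); [left|right]; split; auto; lra. }
    apply infinitely_often_or in HS. destruct HS as [H1|H2]; [exists lo; auto|].
    destruct (IH (lo + delta) _ H2) as [c Hc].
    + intros k [Hk Hk2]. specialize (Hu k Hk). rewrite S_INR in Hu. lra.
    + exists c. apply infinitely_often_imp with (2 := Hc). intros k [[K1 K2] K3]; auto.
Qed.

Lemma pigeonhole_bounded (u : nat -> R) delta lo hi A : 0 < delta -> infinitely_often A ->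
  (forall k, A k -> lo <= u k <= hi) ->
  exists c, infinitely_often (fun k => A k /\ c <= u k <= c + delta).
Proof.
  intros Hd HA Hu. destruct (INR_unbounded ((hi - lo) / delta)) as [n Hn].
  apply pigeonhole_interval with (n := n) (lo := lo); auto.
  intros k Hk. specialize (Hu k Hk). split; [lra|].
  assert (hi - lo < INR n * delta); [|lra].
  apply Rmult_lt_reg_r with (/ delta); [apply Rinv_0_lt_compat; auto|].
  rewrite Rmult_assoc, Rinv_r, Rmult_1_r by lra. exact Hn.
Qed.

Lemma dist_triangle x y z : dist x z <= dist x y + dist y z.
Proof.
  pose proof (cauchy (vsub x y) (vsub y z)) as C.
  change (norm (vsub x y)) with (dist x y) in C. change (norm (vsub y z)) with (dist y z) in C.
  pose proof (dist_sq x z) as E1. pose proof (dist_sq x y) as E2. pose proof (dist_sq y z) as E3.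
  assert (E : d2 x z = d2 x y + d2 y z + 2 * dot (vsub x y) (vsub y z))
    by (destruct x, y, z; uv; ring).
  pose proof (dist_ge0 x y). pose proof (dist_ge0 y z). pose proof (dist_ge0 x z).
  destruct (Rle_or_lt (dist x z) (dist x y + dist y z)); auto. nra.
Qed.

Lemma Rabs_le_sq x y : 0 <= y -> x * x <= y * y -> Rabs x <= y.
Proof. intros H1 H2; unfold Rabs; destruct (Rcase_abs x); nra. Qed.

Lemma coord_le_dist x y : Rabs (px x - px y) <= dist x y /\ Rabs (py x - py y) <= dist x y /\ Rabs (pz x - pz y) <= dist x y.
Proof.
  pose proof (dist_sq x y) as E. pose proof (dist_ge0 x y).
  destruct x as [a b c], y as [a' b' c']. unfold d2, dot, vsub in E; simpl in *.
  set (e := dist _ _) in *.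
  pose proof (Rle_0_sqr (a - a')). pose proof (Rle_0_sqr (b - b')). pose proof (Rle_0_sqr (c - c')).
  unfold Rsqr in *. repeat split; apply Rabs_le_sq; lra.
Qed.

Lemma dist_le_coord x y delta : Rabs (px x - px y) <= delta -> Rabs (py x - py y) <= delta ->
  Rabs (pz x - pz y) <= delta -> dist x y <= 2 * delta.
Proof.
  intros H1 H2 H3. apply Rabs_le_both in H1, H2, H3.
  pose proof (dist_sq x y) as E. pose proof (dist_ge0 x y).
  destruct x as [a b c], y as [a' b' c']. unfold d2, dot, vsub in E; simpl in *.
  set (e := dist _ _) in *.
  assert ((a - a') * (a - a') <= delta * delta) by nra.
  assert ((b - b') * (b - b') <= delta * delta) by nra.
  assert ((c - c') * (c - c') <= delta * delta) by nra.
  destruct (Rle_or_lt e (2 * delta)); auto. nra.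
Qed.

Section Neighbours.
Context {L : idx -> idx -> R} {I : Type} {Q : I -> idx -> pt} (HT : labelled_tiling L I Q).

Lemma svQ_ne i : svQ (Q i) <> 0.
Proof. intro Z. pose proof (lt_or _ _ _ HT i i) as H. rewrite Z in H. lra. Qed.

Lemma svQ_svsq i : svQ (Q i) ^ 2 = svsq L i0 i1 i2 i3.
Proof. unfold svQ. rewrite <- svsq_d2. unfold svsq, gram. rewrite !(lt_len _ _ _ HT). reflexivity. Qed.

Lemma nn_Q i a b c : nn d2 (Q i a) (Q i b) (Q i c) = nn L a b c.
Proof. unfold nn, gram. rewrite !(lt_len _ _ _ HT). reflexivity. Qed.

Lemma asum_Q i : asum d2 (Q i i0) (Q i i1) (Q i i2) (Q i i3) = asum L i0 i1 i2 i3.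
Proof. unfold asum. rewrite !nn_Q. reflexivity. Qed.

Definition centroid (P : idx -> pt) : pt := lin4 (1/4) (1/4) (1/4) (1/4) (P i0) (P i1) (P i2) (P i3).

Lemma inradius : exists rho, 0 < rho /\ forall i y, dist (centroid (Q i)) y < rho -> inhullQ (Q i) y.
Proof.
  destruct (lt_cover _ _ _ HT (mkpt 0 0 0)) as [o _].
  pose proof (asum_pos _ _ _ _ (svQ_ne o)) as PA. rewrite asum_Q in PA.
  pose proof (Rabs_pos_lt _ (svQ_ne o)) as PS.
  exists (1/4 * Rabs (svQ (Q o)) / asum L i0 i1 i2 i3). split.
  - apply Rdiv_lt_0_compat; lra.
  - intros i y Hy. apply ball_in_hull with (1/4) (1/4) (1/4) (1/4) (1/4); try lra.
    + apply svQ_ne.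
    + fold (svQ (Q i)). rewrite asum_Q.
      assert (Es : Rabs (svQ (Q i)) = Rabs (svQ (Q o))).
      { rewrite <- !sqrt_Rsqr_abs. f_equal. unfold Rsqr.
        pose proof (svQ_svsq i). pose proof (svQ_svsq o). simpl in *. lra. }
      rewrite Es. left.
      apply Rmult_lt_reg_r with (/ asum L i0 i1 i2 i3); [apply Rinv_0_lt_compat; auto|].
      rewrite Rmult_assoc, Rinv_r, Rmult_1_r by lra. exact Hy.
Qed.

(** This is the local finiteness of the tiling: a centroid inside the inscribed ball of another tile
    would be interior to both tiles. *)
Lemma close_centroids : exists rho, 0 < rho /\
  forall i j, dist (centroid (Q i)) (centroid (Q j)) < rho -> i = j.
Proof.
  destruct inradius as (rho & H1 & H2). exists rho. split; auto.
  intros i j H. apply (lt_disj _ _ _ HT) with (centroid (Q j)).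
  - exists (rho - dist (centroid (Q i)) (centroid (Q j))). split; [lra|].
    intros y Hy. apply H2. pose proof (dist_triangle (centroid (Q i)) (centroid (Q j)) y). lra.
  - exists rho. split; auto.
Qed.

Lemma coord_combination s t u v a b c d M : 0 <= s -> 0 <= t -> 0 <= u -> 0 <= v -> s + t + u + v = 1 ->
  Rabs (b - a) <= M -> Rabs (c - a) <= M -> Rabs (d - a) <= M ->
  a - M <= s * a + t * b + u * c + v * d <= a + M.
Proof.
  intros. apply Rabs_le_both in H4, H5, H6. assert (E : s = 1 - t - u - v) by lra. subst s.
  assert (0 <= M) by lra.
  split; nra.
Qed.

Lemma diameter : exists M, 0 <= M /\ forall i x, inhullQ (Q i) x ->
  Rabs (px x - px (centroid (Q i))) <= M /\ Rabs (py x - py (centroid (Q i))) <= M /\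
  Rabs (pz x - pz (centroid (Q i))) <= M.
Proof.
  set (M := sqrt (L i1 i0) + sqrt (L i2 i0) + sqrt (L i3 i0)).
  pose proof (sqrt_pos (L i1 i0)). pose proof (sqrt_pos (L i2 i0)). pose proof (sqrt_pos (L i3 i0)).
  exists (2 * M). split; [unfold M; lra|].
  intros i x (s & t & u & v & H2 & H3 & H4 & H5 & H6 & E).
  assert (K : forall k, dist (Q i k) (Q i i0) = sqrt (L k i0))
    by (intros k; rewrite dist_d2, (lt_len _ _ _ HT); auto).
  destruct (coord_le_dist (Q i i1) (Q i i0)) as (A1 & A2 & A3).
  destruct (coord_le_dist (Q i i2) (Q i i0)) as (B1 & B2 & B3).
  destruct (coord_le_dist (Q i i3) (Q i i0)) as (C1 & C2 & C3).
  rewrite K in *.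
  assert (G : forall a b c d, Rabs (b - a) <= sqrt (L i1 i0) -> Rabs (c - a) <= sqrt (L i2 i0) ->
     Rabs (d - a) <= sqrt (L i3 i0) ->
     Rabs (s * a + t * b + u * c + v * d - (1/4 * a + 1/4 * b + 1/4 * c + 1/4 * d)) <= 2 * M).
  { intros a b c d Ha Hb Hc.
    pose proof (coord_combination s t u v a b c d M) as K1.
    pose proof (coord_combination (1/4) (1/4) (1/4) (1/4) a b c d M) as K2.
    unfold M in *. apply Rabs_le. lra. }
  subst x. repeat split; apply G; auto.
Qed.

Lemma outer_point s t u v A B C D : sv A B C D <> 0 -> s + t + u + v = 1 -> v < 0 ->
  ~ inhull A B C D (lin4 s t u v A B C D).
Proof.
  intros H S Hv (s' & t' & u' & v' & H1 & H2 & H3 & H4 & H5 & E).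
  apply lin4_inj in E; auto. lra.
Qed.

Lemma limit_ge0 r0 r1 : infinitely_often (fun k => 0 <= r0 + / INR (S k) * r1) -> 0 <= r0.
Proof.
  intros H. destruct (Rle_or_lt 0 r0) as [|N]; auto. exfalso.
  destruct (INR_unbounded (r1 / (- r0))) as [n Hn].
  destruct (H n) as (k & Hk & Hr).
  assert (P : 0 < INR (S k)) by (apply lt_0_INR; lia).
  assert (INR n < INR (S k)) by (apply lt_INR; lia).
  assert (K : r1 < INR (S k) * (- r0)).
  { apply Rmult_lt_reg_r with (/ (- r0)); [apply Rinv_0_lt_compat; lra|].
    rewrite Rmult_assoc, Rinv_r, Rmult_1_r by lra. unfold Rdiv in Hn. lra. }
  assert (0 <= INR (S k) * (r0 + / INR (S k) * r1)) by (apply Rmult_le_pos; lra).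
  replace (INR (S k) * (r0 + / INR (S k) * r1)) with (INR (S k) * r0 + r1) in H1 by (field; lra).
  lra.
Qed.

Lemma inhull_weights A B C D x : sv A B C D <> 0 -> inhull A B C D x ->
  0 <= sv x B C D / sv A B C D /\ 0 <= sv A x C D / sv A B C D /\
  0 <= sv A B x D / sv A B C D /\ 0 <= sv A B C x / sv A B C D.
Proof.
  intros H (s & t & u & v & H1 & H2 & H3 & H4 & H5 & E).
  destruct (lin4_sv _ _ _ _ A B C D H5) as (E1 & E2 & E3 & E4). rewrite <- E in *.
  rewrite E1, E2, E3, E4. unfold Rdiv. rewrite !Rmult_assoc, Rinv_r, !Rmult_1_r by auto. auto.
Qed.

(** The centre of the facet [ABC], moved away from [D] by [e] times its displacement from [D]. *)
Definition beyond (e : R) (A B C D : pt) : pt :=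
  lin4 (1/3 + e/3) (1/3 + e/3) (1/3 + e/3) (- e) A B C D.

(** Simplices are closed: each weight is affine along the segment and nonnegative at points tending
    to the centre of the facet. *)
Lemma closed_hull A B C D X Y Z W : sv X Y Z W <> 0 ->
  infinitely_often (fun k => inhull X Y Z W (beyond (/ INR (S k)) A B C D)) ->
  inhull X Y Z W (lin4 (1/3) (1/3) (1/3) 0 A B C D).
Proof.
  intros H HI.
  assert (K : forall g : pt -> R, (forall s t u v, s + t + u + v = 1 ->
       g (lin4 s t u v A B C D) = s * g A + t * g B + u * g C + v * g D) ->
       (forall x, inhull X Y Z W x -> 0 <= g x) -> 0 <= g (lin4 (1/3) (1/3) (1/3) 0 A B C D)).
  { intros g Hl Hg. rewrite Hl by lra.
    apply limit_ge0 with ((g A + g B + g C)/3 - g D).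
    apply infinitely_often_imp with (2 := HI). intros k Hk. apply Hg in Hk.
    unfold beyond in Hk. rewrite Hl in Hk by lra. eapply Rle_trans; [exact Hk|right]. field.
    apply not_0_INR; lia. }
  assert (lin : forall s t u v, s + t + u + v = 1 -> s = 1 - t - u - v) by (intros; lra).
  apply inhull_sv; auto.
  - apply (K (fun x => sv x Y Z W / sv X Y Z W)).
    + intros s t u v S. rewrite lin4_sv_gen by auto. unfold Rdiv; ring.
    + intros x Hx. apply inhull_weights in Hx; tauto.
  - apply (K (fun x => sv X x Z W / sv X Y Z W)).
    + intros s t u v S. cbv beta. replace (sv X (lin4 s t u v A B C D) Z W) with
        (s * sv X A Z W + t * sv X B Z W + u * sv X C Z W + v * sv X D Z W); [unfold Rdiv; ring|].
      rewrite (lin _ _ _ _ S). clear. destruct X, Z, W, A, B, C, D; unfold lin4; uv; ring.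
    + intros x Hx. apply inhull_weights in Hx; tauto.
  - apply (K (fun x => sv X Y x W / sv X Y Z W)).
    + intros s t u v S. cbv beta. replace (sv X Y (lin4 s t u v A B C D) W) with
        (s * sv X Y A W + t * sv X Y B W + u * sv X Y C W + v * sv X Y D W); [unfold Rdiv; ring|].
      rewrite (lin _ _ _ _ S). clear. destruct X, Y, W, A, B, C, D; unfold lin4; uv; ring.
    + intros x Hx. apply inhull_weights in Hx; tauto.
  - apply (K (fun x => sv X Y Z x / sv X Y Z W)).
    + intros s t u v S. cbv beta. replace (sv X Y Z (lin4 s t u v A B C D)) with
        (s * sv X Y Z A + t * sv X Y Z B + u * sv X Y Z C + v * sv X Y Z D); [unfold Rdiv; ring|].
      rewrite (lin _ _ _ _ S). clear. destruct X, Y, Z, A, B, C, D; unfold lin4; uv; ring.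
    + intros x Hx. apply inhull_weights in Hx; tauto.
Qed.

(* Tiles with close centroids coincide, so by pigeonhole on the centroids one tile serves
   infinitely many of these points. *)
Lemma tile_beyond A B C D : exists j,
  infinitely_often (fun k => inhullQ (Q j) (beyond (/ INR (S k)) A B C D)).
Proof.
  set (x := fun k => beyond (/ INR (S k)) A B C D).
  assert (G : forall k, exists j, inhullQ (Q j) (x k)) by (intros k; apply (lt_cover _ _ _ HT)).
  set (J := fun k => proj1_sig (constructive_indefinite_description _ (G k))).
  assert (HJ : forall k, inhullQ (Q (J k)) (x k))
    by (intros k; unfold J; destruct (constructive_indefinite_description _ (G k)); auto).
  clearbody J.
  destruct diameter as (M & HM & Hdiam).
  destruct close_centroids as (rho & Hrho & Hclose).
  assert (E1 : forall k, 0 <= / INR (S k) <= 1).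
  { intros k. assert (1 <= INR (S k)) by (rewrite S_INR; pose proof (pos_INR k); lra).
    split; [left; apply Rinv_0_lt_compat; lra|]. replace 1 with (/ 1) by field. apply Rinv_le_contravar; lra. }
  assert (Bd : forall a b c d, exists lo hi, forall k,
     lo <= (1/3 + / INR (S k)/3) * a + (1/3 + / INR (S k)/3) * b + (1/3 + / INR (S k)/3) * c + - / INR (S k) * d <= hi).
  { intros a b c d. set (p := (a + b + c) / 3). set (q := p - d).
    exists (p - Rabs q), (p + Rabs q). intros k. specialize (E1 k).
    set (e := / INR (S k)) in *.
    replace ((1/3 + e/3) * a + (1/3 + e/3) * b + (1/3 + e/3) * c + - e * d) with (p + e * q)
      by (unfold q, p; field).
    assert (Rabs (e * q) <= Rabs q).
    { rewrite Rabs_mult, (Rabs_pos_eq e) by lra. pose proof (Rabs_pos q). nra. }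
    apply Rabs_le_both in H. lra. }
  assert (delta_pos : 0 < rho / 4) by lra.
  destruct (Bd (px A) (px B) (px C) (px D)) as (l1 & h1 & B1).
  destruct (Bd (py A) (py B) (py C) (py D)) as (l2 & h2 & B2).
  destruct (Bd (pz A) (pz B) (pz C) (pz D)) as (l3 & h3 & B3).
  set (g := fun k => centroid (Q (J k))).
  destruct (pigeonhole_bounded (fun k => px (g k)) (rho/4) (l1 - M) (h1 + M) (fun _ => True)) as [c1 P1]; auto.
  { intros m; exists m; auto. }
  { intros k _. specialize (B1 k). destruct (Hdiam _ _ (HJ k)) as (K1 & _ & _).
    apply Rabs_le_both in K1. unfold g, x, beyond, lin4 in *; cbn [px py pz] in *. lra. }
  destruct (pigeonhole_bounded (fun k => py (g k)) (rho/4) (l2 - M) (h2 + M) _ delta_pos P1) as [c2 P2].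
  { intros k _. specialize (B2 k). destruct (Hdiam _ _ (HJ k)) as (_ & K1 & _).
    apply Rabs_le_both in K1. unfold g, x, beyond, lin4 in *; cbn [px py pz] in *. lra. }
  destruct (pigeonhole_bounded (fun k => pz (g k)) (rho/4) (l3 - M) (h3 + M) _ delta_pos P2) as [c3 P3].
  { intros k _. specialize (B3 k). destruct (Hdiam _ _ (HJ k)) as (_ & _ & K1).
    apply Rabs_le_both in K1. unfold g, x, beyond, lin4 in *; cbn [px py pz] in *. lra. }
  destruct (P3 0%nat) as (k0 & _ & [[[_ Z1] Z2] Z3]).
  exists (J k0). apply infinitely_often_imp with (2 := P3).
  intros k [[[_ Y1] Y2] Y3].
  replace (J k0) with (J k); [apply HJ|].
  apply Hclose. change (dist (g k) (g k0) < rho).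
  apply Rle_lt_trans with (2 * (rho/4)); [|lra].
  apply dist_le_coord; apply Rabs_le; lra.
Qed.

(** One tile [j] contains points beyond the facet arbitrarily close to its centre, hence the centre
    itself, so it shares the facet. It lies on the far side because a point beyond the facet has a
    nonnegative weight in [j] and a negative one in [i]. *)
Lemma facet_neighbour i a b c d : dst a b c d ->
  exists j a' b' c' d', dst a' b' c' d' /\ Q j a' = Q i a /\ Q j b' = Q i b /\ Q j c' = Q i c /\
    sv (Q i a) (Q i b) (Q i c) (Q j d') * sv (Q i a) (Q i b) (Q i c) (Q i d) < 0.
Proof.
  intros Hd. destruct (tile_beyond (Q i a) (Q i b) (Q i c) (Q i d)) as [j Hj].
  assert (Ni := svQ_perm_ne (Q i) a b c d Hd (svQ_ne i)).
  assert (Pe : forall k, 0 < / INR (S k)) by (intros k; apply Rinv_0_lt_compat, lt_0_INR; lia).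
  assert (Hij : i <> j).
  { intro; subst j. destruct (Hj 0%nat) as (k & _ & Hk).
    apply (inhull_perm (Q i) a b c d) in Hk; auto. revert Hk.
    apply outer_point; auto; [lra|]. specialize (Pe k); lra. }
  assert (Hp : inhullQ (Q j) (lin4 (1/3) (1/3) (1/3) 0 (Q i a) (Q i b) (Q i c) (Q i d)))
    by (apply closed_hull; auto; apply svQ_ne).
  destruct (lt_facet _ _ _ HT i j a b c d Hij Hd Hp) as (a' & b' & c' & d' & Hd' & Ea & Eb & Ec).
  exists j, a', b', c', d'. repeat (split; auto).
  destruct (Hj 0%nat) as (k & _ & Hk). specialize (Pe k).
  apply (inhull_perm (Q j) a' b' c' d') in Hk; auto.
  destruct Hk as (s & t & u & v & H1 & H2 & H3 & H4 & H5 & E).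
  destruct (lin4_sv _ _ _ _ (Q j a') (Q j b') (Q j c') (Q j d') H5) as (E1 & _).
  rewrite <- E in E1. rewrite Ea, Eb, Ec in E1. unfold beyond in E1.
  set (e := / INR (S k)) in *.
  assert (S1 : (1/3 + e/3) + (1/3 + e/3) + (1/3 + e/3) + - e = 1) by lra.
  destruct (lin4_sv _ _ _ _ (Q i a) (Q i b) (Q i c) (Q i d) S1) as (F1 & _).
  rewrite F1 in E1.
  set (V := sv (Q i a) (Q i b) (Q i c) (Q i d)) in *.
  set (V' := sv (Q i a) (Q i b) (Q i c) (Q j d')) in *.
  assert (PV : 0 < V * V) by nra.
  assert (K : v * (V' * V) < 0).
  { replace (v * (V' * V)) with ((v * V') * V) by ring. rewrite <- E1.
    replace (- e * V * V) with (- (e * (V * V))) by ring. nra. }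
  destruct (Rlt_or_le (V' * V) 0); auto. nra.
Qed.
End Neighbours.

(** * The cycle of tiles around an edge *)

(* (pa,pb) is an edge of the labelled tetrahedron, pc and pd are the other two
   vertices, in the order in which one turns around the edge. *)
Record perm : Set := mkperm { pa : idx; pb : idx; pc : idx; pd : idx }.

Definition dstp (r : perm) : Prop := dst (pa r) (pb r) (pc r) (pd r).
Definition evenp (r : perm) : bool := even (pa r) (pb r) (pc r) (pd r).
Definition theta (L : idx -> idx -> R) (r : perm) : R := acos (cosd L (pa r) (pb r) (pc r) (pd r)).

(* The facet reached after turning by r is the one entered by r'. *)
Definition compat (L : idx -> idx -> R) (r r' : perm) : Prop :=
  L (pa r) (pb r) = L (pa r') (pb r') /\ L (pa r) (pd r) = L (pa r') (pc r') /\
  L (pb r) (pd r) = L (pb r') (pc r').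

Fixpoint angle_sum (L : idx -> idx -> R) (rho : nat -> perm) (n : nat) : R :=
  match n with O => 0 | S n => angle_sum L rho n + theta L (rho n) end.

Definition edge_cycle (L : idx -> idx -> R) (r0 : perm) (n : nat) (rho : nat -> perm) : Prop :=
  rho 0%nat = r0 /\ rho n = r0 /\ angle_sum L rho n = 2 * PI /\
  forall k, dstp (rho k) /\ evenp (rho k) = evenp r0 /\ compat L (rho k) (rho (S k)).

(** In complex notation, the conjugate of [U + iW] times [U' + iW'] is [r r' exp(i th)]; divide by
    the first factor. *)
Lemma rotation_step r r' U W U' W' phi th : 0 < r ->
  U = r * cos phi -> W = r * sin phi ->
  U * U' + W * W' = r * r' * cos th -> U * W' - W * U' = r * r' * sin th ->
  U' = r' * cos (phi + th) /\ W' = r' * sin (phi + th).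
Proof.
  intros Hr EU EW E1 E2.
  assert (S : U * U + W * W = r * r).
  { rewrite EU, EW. pose proof (sin2_cos2 phi) as T. unfold Rsqr in T. nra. }
  rewrite cos_plus, sin_plus. split; apply Rmult_eq_reg_l with (r * r); try nra.
  - rewrite <- S at 1. replace ((U*U+W*W) * U') with (U * (U * U' + W * W') - W * (U * W' - W * U')) by ring.
    rewrite E1, E2, EU, EW. ring.
  - rewrite <- S at 1. replace ((U*U+W*W) * W') with (W * (U * U' + W * W') + U * (U * W' - W * U')) by ring.
    rewrite E1, E2, EU, EW. ring.
Qed.

Lemma acos_inside x : -1 < x < 1 -> 0 < acos x < PI.
Proof.
  intros H. pose proof (acos_bound x) as B.
  assert (C : cos (acos x) = x) by (apply cos_acos; lra).
  split.
  - destruct (Req_dec (acos x) 0) as [E|]; [|lra]. rewrite E, cos_0 in C. lra.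
  - destruct (Req_dec (acos x) PI) as [E|]; [|lra]. rewrite E, cos_PI in C. lra.
Qed.

(** A product of two determinants is the determinant of the matrix of mutual scalar products. *)
Lemma dot_product_of_dets x y e z :
  det3 x e z * det3 y e z =
  dot x y * (dot e e * dot z z - dot e z * dot e z) - dot x e * (dot e y * dot z z - dot e z * dot z y)
  + dot x z * (dot e y * dot z e - dot e e * dot z y).
Proof. destruct x, y, e, z; uv; ring. Qed.

Section Edge.
(** The sign [sg] fixes the sense of rotation about [AB], so that turning from tile to tile always
    increases the polar angle. *)
Context (A B Z : pt) (sg : R) (Hsg : sg = 1 \/ sg = -1).
Let e := vsub B A.
Let z := vsub Z A.
Let el := norm e.
Let n0 := sqrt (nn d2 A B Z).
Context (He : 0 < el) (Hn : 0 < n0).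

(* Coordinates, in the plane orthogonal to AB, in which Z lies on the first axis. *)
Definition coordU (X : pt) : R :=
  (dot e e * dot (vsub X A) z - dot z e * dot (vsub X A) e) / (el * n0).
Definition coordW (X : pt) : R := sg * (det3 (vsub X A) e z / n0).
Definition radius (X : pt) : R := sqrt (nn d2 A B X) / el.

Lemma el_sq : el * el = d2 A B.
Proof. unfold el. rewrite norm_sq. unfold e. rewrite (d2_sym A B). reflexivity. Qed.
Lemma n0_sq : n0 * n0 = nn d2 A B Z.
Proof. apply sqrt_sqrt, nn_ge0. Qed.

Lemma coord_dot X Y : coordU X * coordU Y + coordW X * coordW Y = dn d2 A B X Y / (el * el).
Proof.
  unfold coordU, coordW.
  set (x := vsub X A). set (y := vsub Y A).
  assert (Es : sg * sg = 1) by (destruct Hsg; subst sg; ring).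
  assert (N : n0 * n0 = dot e e * dot z z - dot e z * dot e z).
  { rewrite n0_sq, nn_d2. unfold e, z. apply lagrange. }
  assert (El : el * el = dot e e) by (unfold el; apply norm_sq).
  assert (Dn : dn d2 A B X Y = dot e e * dot x y - dot e x * dot e y)
    by (unfold x, y, e; clear; destruct A, B, X, Y; uL; uv; field).
  rewrite Dn.
  replace ((dot e e * dot x z - dot z e * dot x e) / (el * n0) * ((dot e e * dot y z - dot z e * dot y e) / (el * n0)) + sg * (det3 x e z / n0) * (sg * (det3 y e z / n0)))
  with ((((dot e e * dot x z - dot z e * dot x e) * (dot e e * dot y z - dot z e * dot y e)) + (sg*sg) * (el * el) * (det3 x e z * det3 y e z)) / ((el * el) * (n0 * n0))) by (field; lra).
  rewrite dot_product_of_dets, Es.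
  assert (Sy : forall u v, dot u v = dot v u) by (intros u v; destruct u, v; unfold dot; simpl; ring).
  assert (P : 0 < el * el) by nra. assert (P' : 0 < n0 * n0) by nra.
  apply Rmult_eq_reg_r with ((el * el) * (n0 * n0)); [|nra].
  replace ((dot e e * dot x y - dot e x * dot e y) / (el * el) * (el * el * (n0 * n0)))
    with ((dot e e * dot x y - dot e x * dot e y) * (n0 * n0)) by (field; lra).
  unfold Rdiv. rewrite Rmult_assoc, Rinv_l by nra.
  rewrite N, El, (Sy z e), (Sy x e), (Sy y e), (Sy z y). ring.
Qed.

Lemma coord_cross X Y : coordU X * coordW Y - coordW X * coordU Y = sg * sv A B X Y / el.
Proof.
  unfold coordU, coordW.
  assert (N : n0 * n0 = dot e e * dot z z - dot e z * dot e z).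
  { rewrite n0_sq, nn_d2. unfold e, z. apply lagrange. }
  set (x := vsub X A). set (y := vsub Y A).
  replace (sv A B X Y) with (det3 e x y) by reflexivity.
  replace ((dot e e * dot x z - dot z e * dot x e) / (el * n0) * (sg * (det3 y e z / n0)) - sg * (det3 x e z / n0) * ((dot e e * dot y z - dot z e * dot y e) / (el * n0)))
  with (sg * ((dot e e * dot x z - dot z e * dot x e) * det3 y e z - det3 x e z * (dot e e * dot y z - dot z e * dot y e)) / (el * (n0 * n0))) by (field; lra).
  replace ((dot e e * dot x z - dot z e * dot x e) * det3 y e z - det3 x e z * (dot e e * dot y z - dot z e * dot y e))
   with (det3 e x y * (n0 * n0)).
  - field; lra.
  - rewrite N. clear. clearbody e z x y. destruct e, z, x, y; uv; ring.
Qed.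

Lemma radius_pos X Y : sv A B X Y <> 0 -> 0 < radius X.
Proof. intros H. apply Rdiv_lt_0_compat; auto. apply sqrt_lt_R0. eapply nn_pos; eauto. Qed.

Lemma cosd_inside X Y : sv A B X Y <> 0 -> -1 < cosd d2 A B X Y < 1.
Proof.
  intros H. pose proof (dn_cosd A B X Y H) as E. pose proof (nn_dn A B X Y) as N.
  pose proof (nn_pos _ _ _ _ H) as P1.
  assert (H' : sv A B Y X <> 0) by (rewrite sv_swap23; lra).
  pose proof (nn_pos _ _ _ _ H') as P2.
  pose proof (d2_pos _ _ _ _ H) as P3.
  assert (P4 : 0 < d2 A B * sv A B X Y ^ 2) by (apply Rmult_lt_0_compat; auto; apply pow2_pos; auto).
  rewrite E in N.
  pose proof (sqrt_sqrt _ (Rlt_le _ _ P1)) as Q1. pose proof (sqrt_sqrt _ (Rlt_le _ _ P2)) as Q2.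
  rewrite <- Q1, <- Q2 in N at 1.
  set (c := cosd d2 A B X Y) in *. set (a := sqrt (nn d2 A B X)) in *. set (b := sqrt (nn d2 A B Y)) in *.
  assert (K : 0 < (a * b) * (a * b) * (1 - c * c)).
  { apply Rlt_le_trans with (1 := P4). right. rewrite <- N. ring. }
  assert (0 < 1 - c * c).
  { destruct (Rlt_or_le 0 (1 - c * c)); auto. pose proof (Rle_0_sqr (a * b)). unfold Rsqr in *. nra. }
  split; nra.
Qed.

Lemma polar_dot X Y : sv A B X Y <> 0 ->
  dn d2 A B X Y / (el * el) = radius X * radius Y * cosd d2 A B X Y.
Proof. intros H. rewrite dn_cosd by auto. unfold radius. field. lra. Qed.

(** By [nn_dn] both sides have the same square, and both are nonnegative. *)
Lemma polar_cross X Y : 0 < sg * sv A B X Y ->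
  sg * sv A B X Y / el = radius X * radius Y * sin (acos (cosd d2 A B X Y)).
Proof.
  intros Hp. assert (H : sv A B X Y <> 0) by (intro K; rewrite K in Hp; lra).
  pose proof (cosd_inside X Y H) as C.
  assert (S0 : 0 <= sin (acos (cosd d2 A B X Y))) by (apply sin_ge_0; apply acos_bound).
  assert (S1 : sin (acos (cosd d2 A B X Y)) * sin (acos (cosd d2 A B X Y)) = 1 - cosd d2 A B X Y * cosd d2 A B X Y).
  { pose proof (sin2_cos2 (acos (cosd d2 A B X Y))) as T. rewrite cos_acos in T by lra. unfold Rsqr in T. lra. }
  pose proof (nn_dn A B X Y) as N. rewrite dn_cosd in N by auto.
  pose proof (sqrt_sqrt _ (nn_ge0 A B X)) as Q1. pose proof (sqrt_sqrt _ (nn_ge0 A B Y)) as Q2.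
  pose proof (sqrt_pos (nn d2 A B X)). pose proof (sqrt_pos (nn d2 A B Y)).
  unfold radius. rewrite <- Q1, <- Q2 in N at 1. rewrite <- el_sq in N.
  set (c := cosd d2 A B X Y) in *. set (a := sqrt (nn d2 A B X)) in *. set (b := sqrt (nn d2 A B Y)) in *.
  set (s := sin (acos c)) in *. set (V := sv A B X Y) in *.
  assert (K : (a * b * s) * (a * b * s) = (el * (sg * V)) * (el * (sg * V))).
  { assert (Es : sg * sg = 1) by (destruct Hsg; subst sg; ring).
    replace ((a * b * s) * (a * b * s)) with ((a*a)*(b*b)*(s*s)) by ring. rewrite S1.
    replace ((el * (sg * V)) * (el * (sg * V))) with ((sg * sg) * (el * el * V ^ 2)) by ring.
    rewrite <- N, Es. ring. }
  assert (K2 : a * b * s = el * (sg * V)).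
  { apply Rsqr_inj; auto; [repeat apply Rmult_le_pos; auto|apply Rmult_le_pos; lra]. }
  replace (a / el * (b / el) * s) with ((a * b * s) / (el * el)) by (field; lra).
  rewrite K2. field. lra.
Qed.

Lemma coord_lin4 s t u v X Y : s + t + u + v = 1 ->
  coordU (lin4 s t u v A B X Y) = u * coordU X + v * coordU Y /\
  coordW (lin4 s t u v A B X Y) = u * coordW X + v * coordW Y.
Proof.
  intros S.
  assert (E : vsub (lin4 s t u v A B X Y) A =
     mkpt (t * px e + u * px (vsub X A) + v * px (vsub Y A)) (t * py e + u * py (vsub X A) + v * py (vsub Y A))
          (t * pz e + u * pz (vsub X A) + v * pz (vsub Y A))).
  { assert (Es : s = 1 - t - u - v) by lra. subst s. apply pt_eq; unfold lin4, e, vsub; simpl; ring. }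
  unfold coordU, coordW. rewrite E.
  set (x := vsub X A). set (y := vsub Y A). clearbody x y e z.
  split.
  - replace (dot e e * dot _ z - dot z e * dot _ e) with
     (u * (dot e e * dot x z - dot z e * dot x e) + v * (dot e e * dot y z - dot z e * dot y e))
     by (destruct e, z, x, y; unfold dot; simpl; ring). unfold Rdiv; ring.
  - replace (det3 _ e z) with (u * det3 x e z + v * det3 y e z)
     by (destruct e, z, x, y; unfold det3, dot, cross; simpl; ring). unfold Rdiv; ring.
Qed.

Lemma coord_inj x y : coordU x = coordU y -> coordW x = coordW y -> dot (vsub x A) e = dot (vsub y A) e -> x = y.
Proof.
  intros H1 H2 H3.
  assert (N : n0 * n0 = dot e e * dot z z - dot e z * dot e z).
  { rewrite n0_sq, nn_d2. unfold e, z. apply lagrange. }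
  assert (El : el * el = dot e e) by (unfold el; apply norm_sq).
  assert (E : vsub x y = mkpt 0 0 0).
  { apply orthogonal_zero with e z (cross e z).
    - replace (det3 e z (cross e z)) with (n0 * n0); [nra|]. rewrite N. clear.
      clearbody e z. destruct e, z; uv; ring.
    - replace (dot (vsub x y) e) with (dot (vsub x A) e - dot (vsub y A) e)
        by (clear; clearbody e; destruct x, y, e, A; uv; ring). lra.
    - assert (K : dot e e * dot (vsub x A) z = dot e e * dot (vsub y A) z).
      { unfold coordU in H1. apply Rmult_eq_reg_r in H1; [|apply Rinv_neq_0_compat; nra].
        rewrite H3 in H1. lra. }
      apply Rmult_eq_reg_l in K; [|nra].
      replace (dot (vsub x y) z) with (dot (vsub x A) z - dot (vsub y A) z)
        by (clear; clearbody z; destruct x, y, z, A; uv; ring). lra.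
    - unfold coordW in H2. apply Rmult_eq_reg_l in H2; [|destruct Hsg; subst sg; lra].
      apply Rmult_eq_reg_r in H2; [|apply Rinv_neq_0_compat; nra].
      replace (dot (vsub x y) (cross e z)) with (det3 (vsub x A) e z - det3 (vsub y A) e z)
        by (clear; clearbody e z; destruct x, y, e, z, A; uv; ring). lra. }
  unfold vsub in E. injection E; intros. apply pt_eq; lra.
Qed.

(* The point at distance [eps] from the middle of AB in direction [psi]. *)
Definition near_edge (eps psi : R) : pt -> Prop := fun y =>
  coordU y = eps * cos psi /\ coordW y = eps * sin psi /\ dot (vsub y A) e = dot e e / 2.

(** The midpoint of [AB] has weights [1/2, 1/2, 0, 0]. By the sine rule the direction [psi] has
    positive components [al], [be] along [X] and [Y], so a step of size [eps] gives these two points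
    positive weights and changes the weights of [A] and [B] by less than [1/2] when
    [eps < 1 / (2 K)]. *)
Lemma wedge_interior X Y rX rY phi th psi : sv A B X Y <> 0 -> 0 < rX -> 0 < rY ->
  coordU X = rX * cos phi -> coordW X = rX * sin phi ->
  coordU Y = rY * cos (phi + th) -> coordW Y = rY * sin (phi + th) ->
  0 < th < PI -> phi < psi < phi + th ->
  exists e0, 0 < e0 /\ forall eps, 0 < eps < e0 ->
    exists y, near_edge eps psi y /\ interior (inhull A B X Y) y.
Proof.
  intros H HX HY EX1 EX2 EY1 EY2 Hth Hpsi.
  assert (S0 : 0 < sin th) by (apply sin_gt_0; lra).
  assert (S1 : 0 < sin (psi - phi)) by (apply sin_gt_0; lra).
  assert (S2 : 0 < sin (phi + th - psi)) by (apply sin_gt_0; lra).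
  set (al := sin (phi + th - psi) / (rX * sin th)).
  set (be := sin (psi - phi) / (rY * sin th)).
  assert (Ha : 0 < al) by (apply Rdiv_lt_0_compat; auto; apply Rmult_lt_0_compat; auto).
  assert (Hb : 0 < be) by (apply Rdiv_lt_0_compat; auto; apply Rmult_lt_0_compat; auto).
  assert (El : el * el = dot e e) by (unfold el; apply norm_sq).
  assert (Pe : 0 < dot e e) by nra.
  set (ga := (al * dot (vsub X A) e + be * dot (vsub Y A) e) / dot e e).
  set (K := Rabs ga + Rabs (al + be - ga) + 1).
  assert (PK : 0 < K) by (unfold K; pose proof (Rabs_pos ga); pose proof (Rabs_pos (al + be - ga)); lra).
  exists (/ (2 * K)). split; [apply Rinv_0_lt_compat; lra|].
  intros eps [He0 He1].
  assert (He2 : eps * K < 1/2).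
  { apply Rmult_lt_compat_r with (r := K) in He1; auto.
    replace (/ (2 * K) * K) with (1/2) in He1 by (field; lra). auto. }
  set (u := eps * al). set (v := eps * be). set (t := 1/2 - eps * ga). set (s := 1/2 - eps * (al + be - ga)).
  assert (S : s + t + u + v = 1) by (unfold s, t, u, v; field).
  exists (lin4 s t u v A B X Y). split.
  - destruct (coord_lin4 s t u v X Y S) as [C1 C2]. repeat split.
    + rewrite C1, EX1, EY1. unfold u, v, al, be.
      replace (cos psi) with ((sin (phi + th - psi) * cos phi + sin (psi - phi) * cos (phi + th)) / sin th).
      * field; lra.
      * replace (sin (phi + th - psi)) with (sin th * cos (psi - phi) - cos th * sin (psi - phi))
          by (rewrite <- sin_minus; f_equal; ring).
        rewrite cos_plus. replace (cos psi) with (cos (phi + (psi - phi))) by (f_equal; ring).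
        rewrite cos_plus. field. lra.
    + rewrite C2, EX2, EY2. unfold u, v, al, be.
      replace (sin psi) with ((sin (phi + th - psi) * sin phi + sin (psi - phi) * sin (phi + th)) / sin th).
      * field; lra.
      * replace (sin (phi + th - psi)) with (sin th * cos (psi - phi) - cos th * sin (psi - phi))
          by (rewrite <- sin_minus; f_equal; ring).
        rewrite sin_plus. replace (sin psi) with (sin (phi + (psi - phi))) by (f_equal; ring).
        rewrite sin_plus. field. lra.
    + replace (dot (vsub (lin4 s t u v A B X Y) A) e) with
        (t * dot e e + u * dot (vsub X A) e + v * dot (vsub Y A) e).
      * unfold t, u, v, ga. field. lra.
      * assert (Es : s = 1 - t - u - v) by lra. rewrite Es. clearbody t u v. clear.
        unfold e; destruct A, B, X, Y; unfold lin4; uv; ring.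
  - assert (G : forall g, Rabs g <= K - 1 -> 0 < 1/2 - eps * g).
    { intros g Hg. apply Rabs_le_both in Hg. nra. }
    apply interior_lin4; auto.
    + apply G. unfold K. pose proof (Rabs_pos ga). lra.
    + apply G. unfold K. pose proof (Rabs_pos (al + be - ga)). lra.
    + apply Rmult_lt_0_compat; auto.
    + apply Rmult_lt_0_compat; auto.
Qed.
End Edge.

Definition min_idx (f : idx -> R) : R := Rmin (Rmin (f i0) (f i1)) (Rmin (f i2) (f i3)).

Lemma min_idx_le f k : min_idx f <= f k.
Proof.
  unfold min_idx. destruct k.
  - eapply Rle_trans; [apply Rmin_l|apply Rmin_l].
  - eapply Rle_trans; [apply Rmin_l|apply Rmin_r].
  - eapply Rle_trans; [apply Rmin_r|apply Rmin_l].
  - eapply Rle_trans; [apply Rmin_r|apply Rmin_r].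
Qed.

Lemma min_idx_pos f : (forall k, 0 < f k) -> 0 < min_idx f.
Proof. intros H. unfold min_idx. repeat apply Rmin_glb_lt; auto. Qed.

Lemma cos_eq_1 x : cos x = 1 -> 0 <= x < 2 * PI -> x = 0.
Proof.
  intros H [H1 H2]. destruct (Req_dec x 0); auto. exfalso.
  assert (S : 0 < sin (x/2)) by (apply sin_gt_0; lra).
  replace x with (2 * (x/2)) in H by field. rewrite cos_2a_sin in H. nra.
Qed.

Lemma first_crossing (f : nat -> R) b m : 0 < m -> f 0%nat < b ->
  (forall k, f k + m <= f (S k)) -> exists n, f n < b <= f (S n).
Proof.
  intros Hm H0 Hs.
  assert (G : forall k, f 0%nat + INR k * m <= f k).
  { induction k; [simpl; lra|]. rewrite S_INR. specialize (Hs k). lra. }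
  destruct (INR_unbounded ((b - f 0%nat) / m)) as [N HN].
  assert (HN' : b <= f N).
  { specialize (G N). assert (b - f 0%nat < INR N * m); [|lra].
    apply Rmult_lt_reg_r with (/ m); [apply Rinv_0_lt_compat; auto|].
    rewrite Rmult_assoc, Rinv_r, Rmult_1_r by lra. exact HN. }
  clear HN G. induction N as [|N IH]; [lra|].
  destruct (Rlt_or_le (f N) b); [exists N; auto|auto].
Qed.

Section Cycles.
Context {L : idx -> idx -> R} {I : Type} {Q : I -> idx -> pt} (HT : labelled_tiling L I Q).

Lemma cosd_Q i a b c d : cosd d2 (Q i a) (Q i b) (Q i c) (Q i d) = cosd L a b c d.
Proof. unfold cosd, dn. rewrite !(nn_Q HT). unfold gram. rewrite !(lt_len _ _ _ HT). reflexivity. Qed.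

Lemma theta_bounds r : dstp r -> 0 < theta L r < PI.
Proof.
  intros Hd. destruct (lt_cover _ _ _ HT (mkpt 0 0 0)) as [i _].
  unfold theta. rewrite <- (cosd_Q i). apply acos_inside.
  apply cosd_inside, svQ_perm_ne; auto. apply (svQ_ne HT).
Qed.

Lemma theta_min : exists m, 0 < m /\ forall r, dstp r -> m <= theta L r.
Proof.
  set (f := fun a b c d => if excluded_middle_informative (dst a b c d) then theta L (mkperm a b c d) else 1).
  assert (Pf : forall a b c d, 0 < f a b c d).
  { intros a b c d. unfold f. destruct (excluded_middle_informative _); [|lra].
    apply theta_bounds; auto. }
  exists (min_idx (fun a => min_idx (fun b => min_idx (fun c => min_idx (fun d => f a b c d))))).
  split; [repeat (apply min_idx_pos; intros); auto|].
  intros [a b c d] Hd.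
  eapply Rle_trans; [apply min_idx_le with (k := a)|].
  eapply Rle_trans; [apply min_idx_le with (k := b)|].
  eapply Rle_trans; [apply min_idx_le with (k := c)|].
  eapply Rle_trans; [apply min_idx_le with (k := d)|].
  unfold f. destruct (excluded_middle_informative _); [lra|contradiction].
Qed.

Definition state : Type := (I * perm)%type.
Definition vert (s : state) (k : idx) : pt := Q (fst s) k.
Definition follows (s s' : state) : Prop :=
  dstp (snd s') /\ vert s' (pa (snd s')) = vert s (pa (snd s)) /\
  vert s' (pb (snd s')) = vert s (pb (snd s)) /\ vert s' (pc (snd s')) = vert s (pd (snd s)) /\
  sv (vert s (pa (snd s))) (vert s (pb (snd s))) (vert s (pd (snd s))) (vert s' (pd (snd s'))) *
  sv (vert s (pa (snd s))) (vert s (pb (snd s))) (vert s (pd (snd s))) (vert s (pc (snd s))) < 0.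

(** The hypothesis stands inside the existential so that [next] becomes a total function. *)
Lemma follows_ex s : exists s', dstp (snd s) -> follows s s'.
Proof.
  destruct (classic (dstp (snd s))) as [Hd|N]; [|exists s; contradiction].
  destruct s as [i [a b c d]]. unfold dstp in Hd; simpl in Hd.
  destruct (facet_neighbour HT i a b d c) as (j & a' & b' & c' & d' & H).
  { unfold dst in *; intuition. }
  exists (j, mkperm a' b' c' d'). intros _. exact H.
Qed.

Definition next (s : state) : state := proj1_sig (constructive_indefinite_description _ (follows_ex s)).
Lemma next_follows s : dstp (snd s) -> follows s (next s).
Proof. unfold next. destruct (constructive_indefinite_description _ (follows_ex s)); auto. Qed.

Fixpoint turn (s : state) (n : nat) : state := match n with O => s | S n => next (turn s n) end.

Lemma turn_dst s n : dstp (snd s) -> dstp (snd (turn s n)).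
Proof. intros H; induction n; simpl; auto. apply next_follows in IHn. apply IHn. Qed.

Lemma follows_compat s s' : follows s s' -> compat L (snd s) (snd s').
Proof.
  intros (_ & E1 & E2 & E3 & _). unfold compat. unfold vert in *.
  rewrite <- (lt_len _ _ _ HT (fst s) (pa (snd s)) (pb (snd s))),
    <- (lt_len _ _ _ HT (fst s) (pa (snd s)) (pd (snd s))),
    <- (lt_len _ _ _ HT (fst s) (pb (snd s)) (pd (snd s))).
  rewrite <- E1, <- E2, <- E3, !(lt_len _ _ _ HT). auto.
Qed.

(** [Phi k] is the total angle turned before tile [k]. Two tiles that occupy the same direction near
    the edge overlap, hence are equal; this forces the rotation to meet [2 PI] exactly and to return
    to the first tile. *)
Theorem edge_cycle_exists r0 : dstp r0 -> exists n rho, edge_cycle L r0 n rho.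
Proof.
  intros Hd0. destruct (lt_cover _ _ _ HT (mkpt 0 0 0)) as [o _].
  set (s0 := (o, r0) : state).
  set (A := vert s0 (pa r0)). set (B := vert s0 (pb r0)).
  set (X := fun k => vert (turn s0 k) (pc (snd (turn s0 k)))).
  set (rho := fun k => snd (turn s0 k)).
  assert (Hd : forall k, dstp (rho k)) by (intros k; apply turn_dst; auto).
  assert (Hf : forall k, follows (turn s0 k) (turn s0 (S k))) by (intros k; apply next_follows, Hd).
  assert (HA : forall k, vert (turn s0 k) (pa (rho k)) = A).
  { induction k; [reflexivity|]. destruct (Hf k) as (_ & E & _). rewrite <- IHk. exact E. }
  assert (HB : forall k, vert (turn s0 k) (pb (rho k)) = B).
  { induction k; [reflexivity|]. destruct (Hf k) as (_ & _ & E & _). rewrite <- IHk. exact E. }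
  assert (HX : forall k, vert (turn s0 k) (pd (rho k)) = X (S k)).
  { intros k. destruct (Hf k) as (_ & _ & _ & E & _). symmetry. exact E. }
  assert (Nsv : forall k, sv A B (X k) (X (S k)) <> 0).
  { intros k. rewrite <- (HA k), <- (HB k), <- HX. apply svQ_perm_ne; [apply Hd|apply (svQ_ne HT)]. }
  set (sg := if Rlt_dec 0 (sv A B (X 0%nat) (X 1%nat)) then 1 else -1).
  assert (Hsg : sg = 1 \/ sg = -1) by (unfold sg; destruct (Rlt_dec _ _); auto).
  (* The next tile lies on the other side of the facet, and exchanging the last two arguments
     changes the sign once more, so the sense of rotation persists. *)
  assert (Psv : forall k, 0 < sg * sv A B (X k) (X (S k))).
  { induction k.
    - specialize (Nsv 0%nat). unfold sg. destruct (Rlt_dec _ _); lra.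
    - destruct (Hf k) as (_ & _ & _ & _ & N). fold (rho k) (rho (S k)) in N.
      rewrite HA, HB, !HX in N. fold (X k) in N.
      change (vert (turn s0 k) (pc (rho k))) with (X k) in N.
      rewrite (sv_swap23 A B (X k)) in N.
      specialize (Nsv (S k)). destruct Hsg as [Es|Es]; rewrite Es in *; nra. }
  assert (Hth : forall k, acos (cosd d2 A B (X k) (X (S k))) = theta L (rho k)).
  { intros k. unfold theta. rewrite <- (HA k), <- (HB k), <- HX. unfold X, vert. rewrite cosd_Q. reflexivity. }
  set (Z := X 0%nat).
  assert (He : 0 < norm (vsub B A)).
  { apply sqrt_lt_R0. change (0 < d2 B A). rewrite d2_sym. apply (d2_pos _ _ _ _ (Nsv 0%nat)). }
  assert (Hn : 0 < sqrt (nn d2 A B Z)) by (apply sqrt_lt_R0, (nn_pos _ _ _ _ (Nsv 0%nat))).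
  set (Phi := angle_sum L rho).
  set (Rd := fun k => radius A B (X k)).
  assert (HR : forall k, 0 < Rd k) by (intros k; apply radius_pos with (X (S k)); auto).
  assert (Pol : forall k, coordU A B Z (X k) = Rd k * cos (Phi k) /\ coordW A B Z sg (X k) = Rd k * sin (Phi k)).
  { induction k.
    - unfold Phi; simpl. rewrite cos_0, sin_0. fold Z.
      assert (W0 : coordW A B Z sg Z = 0).
      { unfold coordW. replace (det3 (vsub Z A) (vsub B A) (vsub Z A)) with 0; [unfold Rdiv; ring|].
        destruct Z, A, B; uv; ring. }
      assert (U0 : coordU A B Z Z = Rd 0%nat).
      { unfold coordU, Rd, radius. fold Z.
        replace (dot (vsub B A) (vsub B A) * dot (vsub Z A) (vsub Z A) - dot (vsub Z A) (vsub B A) * dot (vsub Z A) (vsub B A))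
          with (nn d2 A B Z) by (clear; destruct Z, A, B; uL; uv; field).
        rewrite <- (sqrt_sqrt (nn d2 A B Z)) at 1 by apply nn_ge0. field. lra. }
      rewrite W0, U0. split; ring.
    - destruct IHk as [I1 I2]. change (Phi (S k)) with (Phi k + theta L (rho k)). rewrite <- Hth.
      apply rotation_step with (r := Rd k) (U := coordU A B Z (X k)) (W := coordW A B Z sg (X k)); auto.
      + rewrite coord_dot by auto. rewrite polar_dot by auto. rewrite cos_acos; [reflexivity|].
        pose proof (cosd_inside A B _ _ (Nsv k)); lra.
      + rewrite coord_cross by auto. apply polar_cross; auto. }
  assert (Tb : forall k, 0 < theta L (rho k) < PI) by (intros; apply theta_bounds; auto).
  (* The edge determines two labels of a tile; exchanging the other two would reverse the sense of
     rotation. *)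
  assert (Same : forall k l, fst (turn s0 k) = fst (turn s0 l) -> rho k = rho l /\ X k = X l).
  { intros k l E.
    assert (J : forall a b, vert (turn s0 k) a = vert (turn s0 l) b -> a = b).
    { intros a b Hab. unfold vert in Hab. rewrite <- E in Hab. apply svQ_inj with (1 := svQ_ne HT (fst (turn s0 k))) (2 := Hab). }
    assert (Ea : pa (rho k) = pa (rho l)) by (apply J; unfold rho in *; rewrite HA, HA; auto).
    assert (Eb : pb (rho k) = pb (rho l)) by (apply J; unfold rho in *; rewrite HB, HB; auto).
    assert (Hcd : (pc (rho k) = pc (rho l) /\ pd (rho k) = pd (rho l)) \/ (pc (rho k) = pd (rho l) /\ pd (rho k) = pc (rho l))).
    { pose proof (Hd k) as D1. pose proof (Hd l) as D2. unfold dstp, dst in D1, D2. rewrite Ea, Eb in D1.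
      destruct (rho k) as [a b c d], (rho l) as [a' b' c' d']; simpl in *. subst.
      clear - D1 D2. destruct a', b', c, d, c', d'; intuition congruence. }
    destruct Hcd as [[Ec Ed]|[Ec Ed]].
    - split; [destruct (rho k), (rho l); simpl in *; congruence|].
      unfold X. fold (rho k) (rho l). rewrite Ec. unfold vert. rewrite E. reflexivity.
    - exfalso. assert (X1 : X k = X (S l)) by (rewrite <- HX; unfold X; fold (rho k); rewrite Ec; unfold vert; rewrite E; auto).
      assert (X2 : X (S k) = X l) by (rewrite <- HX; unfold X; fold (rho l); rewrite Ed; unfold vert; rewrite E; auto).
      pose proof (Psv k) as K1. pose proof (Psv l) as K2. rewrite X1, X2, sv_swap23 in K1. lra. }
  assert (Over : forall k l psi psi', Phi k < psi < Phi (S k) -> Phi l < psi' < Phi (S l) ->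
     cos psi = cos psi' -> sin psi = sin psi' -> rho k = rho l /\ X k = X l).
  { intros k l psi psi' K1 K2 Ec Es. apply Same.
    assert (Wd : forall k psi, Phi k < psi < Phi (S k) -> exists e0, 0 < e0 /\ forall eps, 0 < eps < e0 ->
      exists y, near_edge A B Z sg eps psi y /\ interior (inhull A B (X k) (X (S k))) y).
    { intros k1 p1 Hp. apply wedge_interior with (rX := Rd k1) (rY := Rd (S k1)) (phi := Phi k1) (th := theta L (rho k1)); auto; try apply Pol. }
    destruct (Wd k psi K1) as (e1 & P1 & W1). destruct (Wd l psi' K2) as (e2 & P2 & W2).
    assert (Pm : 0 < Rmin e1 e2) by (apply Rmin_glb_lt; auto).
    pose proof (Rmin_l e1 e2). pose proof (Rmin_r e1 e2).
    destruct (W1 (Rmin e1 e2 / 2)) as (y1 & (Y1 & Y2 & Y3) & Int1); [lra|].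
    destruct (W2 (Rmin e1 e2 / 2)) as (y2 & (Z1 & Z2 & Z3) & Int2); [lra|].
    assert (y1 = y2).
    { apply coord_inj with A B Z sg; auto; congruence. }
    subst y2.
    assert (IQ : forall k y, interior (inhull A B (X k) (X (S k))) y -> interior (inhullQ (Q (fst (turn s0 k)))) y).
    { intros k1 y Hy. apply interior_ext with (2 := Hy). intros x.
      rewrite <- (HA k1), <- (HB k1), <- HX. apply (inhull_perm (Q (fst (turn s0 k1)))). apply Hd. }
    apply (lt_disj _ _ _ HT) with y1; apply IQ; auto. }
  destruct theta_min as (m & Hm & Hmin).
  destruct (first_crossing Phi (2 * PI) m) as (n & Hn1 & Hn2); auto.
  { unfold Phi; simpl. pose proof PI_RGT_0; lra. }
  { intros k. unfold Phi; simpl. specialize (Hmin _ (Hd k)). lra. }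
  pose proof PI_RGT_0 as PP.
  assert (Ph1 : Phi 1%nat = theta L (rho 0%nat)) by (unfold Phi; simpl; ring).
  assert (Ph0 : Phi 0%nat = 0) by reflexivity.
  pose proof (Tb 0%nat) as T0.
  assert (Per : forall x, cos (2 * PI + x) = cos x /\ sin (2 * PI + x) = sin x).
  { intros x. rewrite cos_plus, sin_plus, cos_2PI, sin_2PI. split; ring. }
  (* If tile [n] reached beyond [2 PI], it would overlap tile 0 and coincide with it. Then
     [X n = X 0] and [cos (Phi n) = 1], although [0 < Phi n < 2 PI]. *)
  assert (Eq : Phi (S n) = 2 * PI).
  { destruct (Req_dec (Phi (S n)) (2 * PI)) as [|Ne]; auto. exfalso.
    destruct n as [|n]; [rewrite Ph1 in *; lra|].
    set (x := Rmin (Phi (S (S n)) - 2 * PI) (theta L (rho 0%nat)) / 2).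
    assert (0 < Rmin (Phi (S (S n)) - 2 * PI) (theta L (rho 0%nat))) by (apply Rmin_glb_lt; lra).
    pose proof (Rmin_l (Phi (S (S n)) - 2 * PI) (theta L (rho 0%nat))).
    pose proof (Rmin_r (Phi (S (S n)) - 2 * PI) (theta L (rho 0%nat))).
    destruct (Over (S n) 0%nat (2 * PI + x) x) as [_ EX]; try (unfold x; lra); try apply Per.
    destruct (Pol (S n)) as [U1 _]. destruct (Pol 0%nat) as [U2 _].
    unfold Rd in U1, U2. rewrite EX, U2, Ph0, cos_0 in U1.
    apply Rmult_eq_reg_l in U1; [|apply Rgt_not_eq, (HR 0%nat)].
    assert (Pos : 0 < Phi (S n)).
    { clear - Hmin Hd Hm. assert (G : forall k, 0 <= Phi k).
      { induction k; unfold Phi in *; simpl; [lra|]. specialize (Hmin _ (Hd k)). lra. }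
      specialize (G n). unfold Phi in *; simpl. specialize (Hmin _ (Hd n)). lra. }
    symmetry in U1. apply cos_eq_1 in U1; lra. }
  exists (S n), rho. split; [reflexivity|split; [|split; [exact Eq|]]].
  - set (x := Rmin (theta L (rho (S n))) (theta L (rho 0%nat)) / 2).
    pose proof (Tb (S n)).
    assert (0 < Rmin (theta L (rho (S n))) (theta L (rho 0%nat))) by (apply Rmin_glb_lt; lra).
    pose proof (Rmin_l (theta L (rho (S n))) (theta L (rho 0%nat))).
    pose proof (Rmin_r (theta L (rho (S n))) (theta L (rho 0%nat))).
    assert (Phi (S (S n)) = 2 * PI + theta L (rho (S n))) by (rewrite <- Eq; reflexivity).
    destruct (Over (S n) 0%nat (2 * PI + x) x) as [ER _]; try (unfold x; lra); try apply Per.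
    rewrite ER. reflexivity.
  - intros k. split; [apply Hd|split; [|apply (follows_compat _ _ (Hf k))]].
    (* all tiles have the same orientation, and so do all the frames (A,B,X k,X (S k)) *)
    pose proof (Psv k) as K1. pose proof (Psv 0%nat) as K2.
    rewrite <- (HA k), <- (HB k), <- HX in K1. rewrite <- (HA 0%nat), <- (HB 0%nat), <- HX in K2.
    unfold X, vert in K1, K2. fold (rho k) in K1. fold (rho 0%nat) in K2.
    rewrite svQ_perm in K1, K2 by apply Hd.
    unfold evenp. change r0 with (rho 0%nat).
    pose proof (lt_or _ _ _ HT (fst (turn s0 k)) (fst (turn s0 0))) as O.
    set (a := svQ (Q (fst (turn s0 k)))) in *. set (b := svQ (Q (fst (turn s0 0)))) in *.
    clearbody a b sg. clear - K1 K2 O Hsg.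
    destruct (even _ _ _ _), (even _ _ _ _); auto; exfalso; destruct Hsg as [Es|Es]; rewrite Es in *; nra.
Qed.
End Cycles.

(** * Counting tiles around an edge *)

Definition all_idx : list idx := [i0; i1; i2; i3].
Definition idx_eqb (a b : idx) : bool :=
  match a, b with i0, i0 | i1, i1 | i2, i2 | i3, i3 => true | _, _ => false end.
Definition dstb (r : perm) : bool :=
  negb (idx_eqb (pa r) (pb r) || idx_eqb (pa r) (pc r) || idx_eqb (pa r) (pd r)
        || idx_eqb (pb r) (pc r) || idx_eqb (pb r) (pd r) || idx_eqb (pc r) (pd r)).
Definition all_perms : list perm :=
  filter dstb (flat_map (fun a => flat_map (fun b => flat_map (fun c =>
    map (fun d => mkperm a b c d) all_idx) all_idx) all_idx) all_idx).

Lemma all_perms_complete r : dstp r -> In r all_perms.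
Proof.
  destruct r as [a b c d]. unfold dstp; simpl. intros H.
  perms a b c d H; vm_compute; intuition.
Qed.

Lemma all_perms_dst r : In r all_perms -> dstp r.
Proof.
  unfold all_perms. intros H. apply filter_In in H. destruct H as [_ H].
  destruct r as [a b c d]. unfold dstp, dst; simpl.
  destruct a, b, c, d; vm_compute in H; try discriminate H; repeat split; congruence.
Qed.

Definition stepb (code : idx -> idx -> nat) (r r' : perm) : bool :=
  Bool.eqb (evenp r) (evenp r') && Nat.eqb (code (pa r) (pb r)) (code (pa r') (pb r'))
  && Nat.eqb (code (pa r) (pd r)) (code (pa r') (pc r'))
  && Nat.eqb (code (pb r) (pd r)) (code (pb r') (pc r')).

Definition all_steps (code : idx -> idx -> nat) (P : perm -> perm -> bool) : bool :=
  forallb (fun r => forallb (fun r' => implb (stepb code r r') (P r r')) all_perms) all_perms.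

(** A code may merge different lengths but never separates equal ones. Every geometric step is then
    a step of the code, and a coarse code treats several patterns of coincidence at once. *)
Definition refines (L : idx -> idx -> R) (code : idx -> idx -> nat) : Prop :=
  forall a b a' b', a <> b -> a' <> b' -> L a b = L a' b' -> code a b = code a' b'.

Lemma all_steps_spec L code P r r' : refines L code -> all_steps code P = true ->
  dstp r -> dstp r' -> evenp r = evenp r' -> compat L r r' -> P r r' = true.
Proof.
  intros Hc HA Hr Hr' He (E1 & E2 & E3).
  unfold all_steps in HA. rewrite forallb_forall in HA. specialize (HA r (all_perms_complete r Hr)).
  rewrite forallb_forall in HA. specialize (HA r' (all_perms_complete r' Hr')).
  assert (S : stepb code r r' = true).
  { unfold dstp, dst in Hr, Hr'. unfold stepb. rewrite He, Bool.eqb_reflx.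
    rewrite (Hc (pa r) (pb r) (pa r') (pb r')), (Hc (pa r) (pd r) (pa r') (pc r')),
      (Hc (pb r) (pd r) (pb r') (pc r')), !Nat.eqb_refl by tauto. reflexivity. }
  rewrite S in HA. exact HA.
Qed.

Definition ecode (code : idx -> idx -> nat) (r : perm) : nat := code (pa r) (pb r).
Definition on_edge (code : idx -> idx -> nat) (k : nat) (P : perm -> perm -> bool) (r r' : perm) : bool :=
  implb (Nat.eqb (ecode code r) k) (P r r').

(** A colour that changes exactly at the tiles of type [isA] returns to its start, so their number
    is even. In the same way the integer potential of [shifts] forces two other tiles for each tile
    of type [isA]. *)
Definition flips (isA col : perm -> bool) (r r' : perm) : bool :=
  Bool.eqb (col r') (if isA r then negb (col r) else col r).
Definition shifts (isA : perm -> bool) (pot : perm -> Z) (r r' : perm) : bool :=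
  Z.eqb (pot r') (pot r + (if isA r then 2 else -1))%Z.

(* Turning once around an edge, [x] tiles of type [isA] and [y] other tiles are met. *)
Lemma walk_counts L code r0 n rho (isA : perm -> bool) (tA tB : R) : refines L code -> edge_cycle L r0 n rho -> dstp r0 ->
  (forall r, dstp r -> ecode code r = ecode code r0 -> theta L r = if isA r then tA else tB) ->
  exists x y : nat, INR x * tA + INR y * tB = 2 * PI /\ (isA r0 = true -> (1 <= x)%nat) /\
    (forall col, all_steps code (on_edge code (ecode code r0) (flips isA col)) = true -> Nat.even x = true) /\
    (forall col, all_steps code (on_edge code (ecode code r0) (flips (fun r => negb (isA r)) col)) = true -> Nat.even y = true) /\
    (forall pot, all_steps code (on_edge code (ecode code r0) (shifts isA pot)) = true -> y = (2 * x)%nat).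
Proof.
  intros Hc (R0 & Rn & Sum & St) Hd0 Hth.
  assert (K : forall k, ecode code (rho k) = ecode code r0).
  { induction k; [rewrite R0; auto|]. rewrite <- IHk. symmetry.
    destruct (St k) as (D1 & _ & (E & _)). destruct (St (S k)) as (D2 & _).
    unfold ecode. unfold dstp, dst in *. apply Hc; tauto. }
  set (cnt := fix cnt (f : perm -> bool) (n : nat) : nat :=
     match n with O => O | S n => (cnt f n + if f (rho n) then 1 else 0)%nat end).
  assert (Step : forall P, all_steps code (on_edge code (ecode code r0) P) = true ->
     forall k, P (rho k) (rho (S k)) = true).
  { intros P HP k. destruct (St k) as (D1 & E1 & C1). destruct (St (S k)) as (D2 & E2 & _).
    pose proof (all_steps_spec L code _ (rho k) (rho (S k)) Hc HP D1 D2 ltac:(congruence) C1) as H.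
    unfold on_edge in H. rewrite K, Nat.eqb_refl in H. exact H. }
  assert (Par : forall f col, all_steps code (on_edge code (ecode code r0) (flips f col)) = true ->
     Nat.even (cnt f n) = true).
  { intros f col HP.
    assert (G : forall k, col (rho k) = if Nat.even (cnt f k) then col r0 else negb (col r0)).
    { induction k; [simpl; rewrite R0; auto|].
      pose proof (Step _ HP k) as H. unfold flips in H. apply Bool.eqb_prop in H.
      rewrite H, IHk. simpl. destruct (f (rho k)).
      - rewrite Nat.add_1_r, Nat.even_succ, <- Nat.negb_even. destruct (Nat.even (cnt f k)); simpl; auto. rewrite negb_involutive; auto.
      - rewrite Nat.add_0_r. auto. }
    specialize (G n). rewrite Rn in G. destruct (Nat.even (cnt f n)); auto. destruct (col r0); discriminate. }
  assert (Sm : forall k, angle_sum L rho k = INR (cnt isA k) * tA + INR (cnt (fun r => negb (isA r)) k) * tB).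
  { induction k; [simpl; ring|]. simpl angle_sum. rewrite IHk, Hth by (try apply K; apply St).
    simpl cnt. destruct (isA (rho k)); cbn [negb]; rewrite !plus_INR; simpl; ring. }
  exists (cnt isA n), (cnt (fun r => negb (isA r)) n). repeat split.
  - rewrite <- Sm. auto.
  - intros HA. destruct n as [|n].
    { simpl in Sum. pose proof PI_RGT_0. lra. }
    clear - HA R0. induction n; simpl; [rewrite R0, HA; lia|]. simpl in IHn. lia.
  - intros col HP. eapply Par; eauto.
  - intros col HP. eapply Par; eauto.
  - intros pot HP.
    assert (G : forall k, (pot (rho k) = pot r0 + 2 * Z.of_nat (cnt isA k) - Z.of_nat (cnt (fun r => negb (isA r)) k))%Z).
    { induction k; [simpl; rewrite R0; lia|].
      pose proof (Step _ HP k) as H. unfold shifts in H. apply Z.eqb_eq in H.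
      rewrite H, IHk. simpl cnt. destruct (isA (rho k)); cbn [negb]; lia. }
    specialize (G n). rewrite Rn in G. lia.
Qed.

Lemma INR_cases (x : nat) : x = 0%nat \/ x = 1%nat \/ x = 2%nat \/ 3 <= INR x.
Proof.
  destruct x as [|[|[|x]]]; auto. right; right; right.
  rewrite !S_INR. pose proof (pos_INR x). lra.
Qed.

(** With [2 m] tiles the angle is [PI / m]; [m = 1] is impossible for a dihedral angle, and [m = 2]
    gives the right angle. *)
Lemma even_turn c x : -1 < c < 1 -> INR x * acos c = 2 * PI -> Nat.even x = true -> c = 0 \/ 1/2 <= c.
Proof.
  intros Hc H He. pose proof (acos_inside c Hc) as B. pose proof (cos_acos c ltac:(lra)) as C.
  apply Nat.even_spec in He. destruct He as [m ->]. rewrite mult_INR in H. simpl in H.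
  assert (H' : INR m * acos c = PI) by lra.
  pose proof PI_RGT_0.
  destruct (INR_cases m) as [->|[->|[->|Hm]]]; simpl in H'; try lra.
  - left. rewrite <- C. replace (acos c) with (PI/2) by lra. apply cos_PI2.
  - right. assert (acos c <= PI / 3) by nra.
    rewrite <- C. replace (1/2) with (cos (PI/3)) by apply cos_PI3. apply cos_decr_1; lra.
Qed.

Definition c5 : R := cos (2 * PI / 5).

(** For [x = 2 PI / 5] one has [cos (3 x) = cos (2 x)]; the factor [cos x - 1] is divided out. *)
Lemma c5_eq : 4 * (c5 * c5) + 2 * c5 - 1 = 0.
Proof.
  unfold c5. set (x := 2 * PI / 5). pose proof PI_RGT_0.
  assert (E : cos (x + 2 * x) = cos (2 * x)).
  { replace (x + 2 * x) with (2 * PI - 2 * x) by (unfold x; field).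
    rewrite cos_minus, cos_2PI, sin_2PI. ring. }
  rewrite cos_plus, sin_2a, cos_2a_cos in E.
  pose proof (sin2_cos2 x) as T. unfold Rsqr in T.
  assert (N : cos x <> 1).
  { intro Z. apply cos_eq_1 in Z; unfold x in *; lra. }
  set (c := cos x) in *. set (s := sin x) in *.
  apply Rmult_eq_reg_l with (c - 1); [|lra].
  assert (s * s = 1 - c * c) by lra.
  assert (c * (2 * c * c - 1) - 2 * c * (s * s) = 2 * c * c - 1) by lra.
  rewrite H0 in H1. lra.
Qed.

Lemma c5_bounds : 3090/10000 < c5 < 3091/10000.
Proof.
  pose proof c5_eq as E. pose proof PI_RGT_0.
  assert (P : 0 < c5) by (apply cos_gt_0; lra).
  split; nra.
Qed.

(** Up to four tiles leave at least 90 degrees to each, five give 72 degrees, six or more at most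
    60. *)
Lemma any_turn c x : -1 < c < 1 -> INR x * acos c = 2 * PI -> c <= 0 \/ c = c5 \/ 1/2 <= c.
Proof.
  intros Hc H. pose proof (acos_inside c Hc) as B. pose proof (cos_acos c ltac:(lra)) as C.
  pose proof PI_RGT_0.
  destruct (le_lt_dec x 4) as [H4|H4].
  - left. assert (INR x <= 4) by (apply le_INR in H4; simpl in H4; lra).
    assert (PI/2 <= acos c) by nra. rewrite <- C. apply cos_le_0; lra.
  - right. destruct (le_lt_dec x 5) as [H5|H5].
    + left. assert (x = 5)%nat by lia. subst x. simpl in H. rewrite <- C. unfold c5. f_equal. lra.
    + right. assert (6 <= INR x) by (apply le_INR in H5; simpl in H5; lra).
      assert (acos c <= PI / 3) by nra.
      rewrite <- C. replace (1/2) with (cos (PI/3)) by apply cos_PI3. apply cos_decr_1; lra.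
Qed.

Lemma large_perm P a b c d : dst a b c d ->
  large_area d2 (P a) (P b) (P c) (P d) -> large_area d2 (P i0) (P i1) (P i2) (P i3).
Proof.
  intros Hd. unfold large_area. rewrite !svsq_d2.
  assert (E : sv (P a) (P b) (P c) (P d) ^ 2 = sv (P i0) (P i1) (P i2) (P i3) ^ 2).
  { rewrite svQ_perm by auto. unfold svQ. destruct (even a b c d); ring. }
  rewrite E. clear E.
  assert (E : asum d2 (P a) (P b) (P c) (P d) = asum d2 (P i0) (P i1) (P i2) (P i3)).
  { perms a b c d Hd; unfold asum; nn_sort (P i0) (P i1) (P i2) (P i3); ring. }
  rewrite E. auto.
Qed.

Lemma gram_det x y z : det3 x y z ^ 2 =
  dot x x * dot y y * dot z z + 2 * (dot x y * dot x z * dot y z)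
  - dot x x * (dot y z * dot y z) - dot y y * (dot x z * dot x z) - dot z z * (dot x y * dot x y).
Proof. destruct x, y, z; uv; ring. Qed.

(* The spherical excess at [a] is positive: this is the positivity of the Gram determinant of the
   three face normals. *)
Lemma vertex_angles a b c d : sv a b c d <> 0 ->
  PI < acos (cosd d2 a b c d) + acos (cosd d2 a c b d) + acos (cosd d2 a d b c).
Proof.
  intros H. destruct (sv_ne_perm _ _ _ _ H) as (S1 & S2 & S3 & S4 & S5).
  pose proof (gram_det (face1 a b c d) (face2 a b c d) (face3 a b c d)) as G.
  rewrite face_det, dot_face12, dot_face13, dot_face23 in G.
  rewrite <- !norm_sq, face1_norm, face2_norm, face3_norm in G.
  rewrite (dn_cosd a b c d), (dn_cosd a c b d), (dn_cosd a d b c) in G by auto.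
  pose proof (cosd_inside _ _ _ _ H) as C1. pose proof (cosd_inside _ _ _ _ S1) as C2.
  pose proof (cosd_inside _ _ _ _ S2) as C3.
  assert (P : 0 < (sv a b c d ^ 2) ^ 2) by (apply pow2_pos, Rgt_not_eq, pow2_pos; auto).
  rewrite G in P. clear G. nn_sort a b c d.
  set (x := sqrt (nn d2 a b c)) in *. set (y := sqrt (nn d2 a b d)) in *. set (z := sqrt (nn d2 a c d)) in *.
  set (p := cosd d2 a b c d) in *. set (q := cosd d2 a c b d) in *. set (r := cosd d2 a d b c) in *.
  assert (K : 0 < 1 - p*p - q*q - r*r - 2*p*q*r).
  { destruct (Rlt_or_le 0 (1 - p*p - q*q - r*r - 2*p*q*r)); auto.
    pose proof (Rle_0_sqr (x*y*z)) as Q. unfold Rsqr in Q.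
    assert ((x*y*z)*(x*y*z) * (1 - p*p - q*q - r*r - 2*p*q*r) <= 0) by nra. nra. }
  pose proof (cos_acos p ltac:(lra)) as Ep. pose proof (cos_acos q ltac:(lra)) as Eq. pose proof (cos_acos r ltac:(lra)) as Er.
  pose proof (acos_inside p C1) as Bp. pose proof (acos_inside q C2) as Bq. pose proof (acos_inside r C3) as Br.
  set (A := acos p) in *. set (B := acos q) in *. set (C := acos r) in *.
  destruct (Rlt_or_le PI (A + B + C)) as [|N]; auto. exfalso.
  (* A sum of at most [PI] would give [sin B sin C <= p + q r], whose square contradicts [K]. *)
  assert (D : cos (PI - (B + C)) <= cos A) by (apply cos_decr_1; lra).
  rewrite Rtrigo_facts.cos_pi_minus, cos_plus, Ep, Eq, Er in D.
  assert (0 < sin B) by (apply sin_gt_0; lra). assert (0 < sin C) by (apply sin_gt_0; lra).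
  pose proof (sin2_cos2 B) as T1. pose proof (sin2_cos2 C) as T2. unfold Rsqr in T1, T2.
  rewrite Eq in T1. rewrite Er in T2.
  assert ((sin B * sin C) * (sin B * sin C) = (1 - q*q) * (1 - r*r)).
  { replace ((sin B * sin C) * (sin B * sin C)) with ((sin B * sin B) * (sin C * sin C)) by ring.
    replace (sin B * sin B) with (1 - q*q) by lra. replace (sin C * sin C) with (1 - r*r) by lra. ring. }
  assert (0 < sin B * sin C) by nra.
  assert (sin B * sin C <= p + q * r) by lra.
  assert ((sin B * sin C) * (sin B * sin C) <= (p + q * r) * (p + q * r)) by (apply Rmult_le_compat; lra).
  nra.
Qed.

(** * Tetrahedra with a plane of symmetry *)

Definition sqlen (P : idx -> pt) (a b : idx) : R := d2 (P a) (P b).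
Definition has_cycles (L : idx -> idx -> R) : Prop :=
  forall r0, dstp r0 -> exists n rho, edge_cycle L r0 n rho.
Definition largeQ (P : idx -> pt) : Prop := large_area d2 (P i0) (P i1) (P i2) (P i3).

Lemma sqlen_sym P a b : sqlen P a b = sqlen P b a.
Proof. apply d2_sym. Qed.

Lemma cosd_symmetry (L : idx -> idx -> R) (f : idx -> idx) a b c d :
  (forall x y, L (f x) (f y) = L x y) -> cosd L (f a) (f b) (f c) (f d) = cosd L a b c d.
Proof. intros H. unfold cosd, dn, nn, gram. rewrite !H. reflexivity. Qed.

Lemma cosd_sqlen_inside P a b c d : svQ P <> 0 -> dst a b c d -> -1 < cosd (sqlen P) a b c d < 1.
Proof. intros H Hd. apply (cosd_inside (P a) (P b) (P c) (P d)). apply svQ_perm_ne; auto. Qed.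

(* Edge classes of a tetrahedron that is symmetric in the plane exchanging i2 and i3. *)
Definition ty (a b : idx) : nat :=
  match a, b with
  | i0, i1 | i1, i0 => 0
  | i2, i3 | i3, i2 => 1
  | i0, i2 | i2, i0 | i0, i3 | i3, i0 => 2
  | _, _ => 3
  end%nat.

Definition sel (p q r s : R) (t : nat) : R :=
  match t with 0 => p | 1 => q | 2 => r | _ => s end%nat.

Definition swap23 (a : idx) : idx := match a with i2 => i3 | i3 => i2 | x => x end.
Definition swap01 (a : idx) : idx := match a with i0 => i1 | i1 => i0 | x => x end.

Definition face_has (code : idx -> idx -> nat) (k : nat) (r : perm) : bool :=
  Nat.eqb (code (pa r) (pc r)) k || Nat.eqb (code (pb r) (pc r)) k.
Definition face_all (code : idx -> idx -> nat) (k : nat) (r : perm) : bool :=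
  Nat.eqb (code (pa r) (pc r)) k && Nat.eqb (code (pb r) (pc r)) k.

Notation on_ty g := (fun a b : idx => g (ty a b)) (only parsing).

Section Mirror.
(** The edge [i0 i1] of class [p] lies in the mirror plane and [i2 i3] of class [q] is orthogonal to
    it; [r] and [s] are the classes of the mirrored pairs at [i0] and at [i1]. *)
Context (P : idx -> pt) (p q r s : R).
Let L := sqlen P.
Context (Hsv : svQ P <> 0) (Hcyc : has_cycles L)
  (Hp : L i0 i1 = p) (Hq : L i2 i3 = q) (Hr : L i0 i2 = r) (Hr' : L i0 i3 = r)
  (Hs : L i1 i2 = s) (Hs' : L i1 i3 = s).
Let cP := cosd L i0 i1 i2 i3.
Let cQ := cosd L i2 i3 i0 i1.
Let cR := cosd L i0 i2 i1 i3.
Let cS := cosd L i1 i2 i0 i3.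

Lemma L_val a b : a <> b -> L a b = sel p q r s (ty a b).
Proof.
  intros N; destruct a, b; try congruence; simpl; auto;
  unfold L; rewrite sqlen_sym; auto.
Qed.

Lemma mirror_swap23 a b : L (swap23 a) (swap23 b) = L a b.
Proof.
  destruct (classic (a = b)) as [->|N].
  - destruct b; unfold L, sqlen; simpl; destruct (P i0), (P i1), (P i2), (P i3); uv; ring.
  - rewrite !L_val; auto; [|intro; destruct a, b; simpl in *; congruence].
    destruct a, b; simpl; congruence.
Qed.

Lemma cosd_ends a b c d : cosd L b a c d = cosd L a b c d.
Proof. apply (cosd_swap_ends (P a) (P b)). Qed.
Lemma cosd_sides a b c d : cosd L a b d c = cosd L a b c d.
Proof. apply (cosd_swap_sides (P a) (P b)). Qed.
Lemma cosd_mirror a b c d : cosd L (swap23 a) (swap23 b) (swap23 c) (swap23 d) = cosd L a b c d.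
Proof. apply cosd_symmetry, mirror_swap23. Qed.

Lemma theta_val t : dstp t -> theta L t = acos (sel cP cQ cR cS (ty (pa t) (pb t))).
Proof.
  destruct t as [a b c d]. intros H. unfold dstp in H; simpl in *. unfold theta; simpl. f_equal.
  perms a b c d H; simpl; unfold cP, cQ, cR, cS;
  first [ reflexivity | rewrite cosd_ends; reflexivity | rewrite cosd_sides; reflexivity
        | rewrite cosd_ends, cosd_sides; reflexivity
        | rewrite <- cosd_mirror; simpl; reflexivity
        | rewrite <- cosd_mirror; simpl; rewrite cosd_ends; reflexivity
        | rewrite <- cosd_mirror; simpl; rewrite cosd_sides; reflexivity
        | rewrite <- cosd_mirror; simpl; rewrite cosd_ends, cosd_sides; reflexivity ].
Qed.

Lemma inP : -1 < cP < 1. Proof. apply cosd_sqlen_inside; auto; repeat split; congruence. Qed.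
Lemma inQ : -1 < cQ < 1. Proof. apply cosd_sqlen_inside; auto; repeat split; congruence. Qed.
Lemma inR : -1 < cR < 1. Proof. apply cosd_sqlen_inside; auto; repeat split; congruence. Qed.
Lemma inS : -1 < cS < 1. Proof. apply cosd_sqlen_inside; auto; repeat split; congruence. Qed.

Lemma cR' : cosd L i0 i3 i1 i2 = cR.
Proof. unfold cR. rewrite <- cosd_mirror. reflexivity. Qed.
Lemma cS' : cosd L i1 i3 i0 i2 = cS.
Proof. unfold cS. rewrite <- cosd_mirror. reflexivity. Qed.

Lemma large_RS_small : 1/2 <= cR -> 1/2 <= cS -> largeQ P.
Proof.
  intros H1 H2. apply large_four_small_angles; auto.
  - rewrite <- cR' in H1. exact H1.
  - rewrite <- cS' in H2. exact H2.
Qed.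
Lemma large_R_obtuse : cR <= 0 -> largeQ P.
Proof. intros H1. apply large_two_obtuse_angles; auto. rewrite <- cR' in H1. exact H1. Qed.
Lemma large_S_obtuse : cS <= 0 -> largeQ P.
Proof.
  intros H1. apply large_perm with i1 i0 i2 i3; [repeat split; congruence|].
  apply large_two_obtuse_angles; auto.
  - apply (svQ_perm_ne P); auto; repeat split; congruence.
  - rewrite <- cS' in H1. exact H1.
Qed.
Lemma large_QS_small : 1/2 <= cQ -> 1/2 <= cS -> largeQ P.
Proof. intros H1 H2. apply large_face_small_angles; auto. rewrite <- cS' in H2. exact H2. Qed.
Lemma large_Q_right : p = r -> cQ = 0 -> largeQ P.
Proof.
  intros E H. apply large_right_dihedral; auto.
  - change (L i0 i2 = L i0 i1). congruence.
  - change (L i0 i3 = L i0 i1). congruence.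
  - change (L i1 i3 = L i1 i2). congruence.
Qed.
Lemma large_QR_supplementary : q = r -> cQ = - cR -> largeQ P.
Proof.
  intros E H. apply large_supplementary_dihedrals; auto.
  - change (L i0 i3 = L i0 i2). congruence.
  - change (L i2 i3 = L i0 i2). congruence.
  - change (L i1 i3 = L i1 i2). congruence.
Qed.

Lemma refines_ty g :
  (forall t t', (t < 4)%nat -> (t' < 4)%nat -> sel p q r s t = sel p q r s t' -> g t = g t') ->
  refines L (on_ty g).
Proof.
  intros H a b a' b' N N' E. rewrite !L_val in E by auto.
  apply H; auto; [destruct a, b|destruct a', b']; simpl; lia.
Qed.

(* [col] is the type of the facet through which a tile is entered. *)
Lemma even_class g r0 col c : dstp r0 -> refines L (on_ty g) -> -1 < c < 1 ->
  (forall t, (t < 4)%nat -> g t = g (ty (pa r0) (pb r0)) -> sel cP cQ cR cS t = c) ->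
  all_steps (on_ty g) (on_edge (on_ty g) (g (ty (pa r0) (pb r0))) (flips (fun _ => true) col)) = true ->
  c = 0 \/ 1/2 <= c.
Proof.
  intros Hd Href Hc Ht Hcol. destruct (Hcyc r0 Hd) as (n & rho & HC).
  destruct (walk_counts L _ r0 n rho (fun _ => true) (acos c) 0 Href HC Hd) as (x & y & E & _ & Ev & _).
  - intros t Dt Et. rewrite theta_val by auto. f_equal. apply Ht; auto.
    destruct t as [a b c' d']; simpl. destruct a, b; simpl; lia.
  - apply even_turn with x; auto; [lra|]. apply Ev with col; auto.
Qed.

Lemma const_class g r0 c : dstp r0 -> refines L (on_ty g) -> -1 < c < 1 ->
  (forall t, (t < 4)%nat -> g t = g (ty (pa r0) (pb r0)) -> sel cP cQ cR cS t = c) ->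
  c <= 0 \/ c = c5 \/ 1/2 <= c.
Proof.
  intros Hd Href Hc Ht. destruct (Hcyc r0 Hd) as (n & rho & HC).
  destruct (walk_counts L _ r0 n rho (fun _ => true) (acos c) 0 Href HC Hd) as (x & y & E & _).
  - intros t Dt Et. rewrite theta_val by auto. f_equal. apply Ht; auto.
    destruct t as [a b c' d']; simpl. destruct a, b; simpl; lia.
  - apply any_turn with x; auto; lra.
Qed.

Lemma dst0123 : dstp (mkperm i0 i1 i2 i3). Proof. unfold dstp, dst; simpl; repeat split; congruence. Qed.
Lemma dst2301 : dstp (mkperm i2 i3 i0 i1). Proof. unfold dstp, dst; simpl; repeat split; congruence. Qed.
Lemma dst0213 : dstp (mkperm i0 i2 i1 i3). Proof. unfold dstp, dst; simpl; repeat split; congruence. Qed.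
Lemma dst1203 : dstp (mkperm i1 i2 i0 i3). Proof. unfold dstp, dst; simpl; repeat split; congruence. Qed.

Ltac refine_tac := apply refines_ty; intros t t' Lt Lt' E;
  destruct t as [|[|[|[|t]]]]; [..|lia]; destruct t' as [|[|[|[|t']]]]; [..|lia]; simpl in *;
  first [reflexivity | exfalso; congruence].
Ltac class_tac := intros t Lt Et; destruct t as [|[|[|[|t]]]]; [..|lia]; simpl in *; congruence.

(** The code merges [p] and [q], so they may be equal. Of the two facets at an edge of class [r]
    just one contains an edge of class [s], and conversely, so both counts are even. *)
Lemma large_generic : r <> p -> r <> q -> r <> s -> s <> p -> s <> q -> largeQ P.
Proof.
  intros.
  set (g := fun t : nat => match t with 0 => 0 | 1 => 0 | 2 => 2 | _ => 3 end%nat).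
  assert (Hg : refines L (on_ty g)) by refine_tac.
  assert (A1 : cR = 0 \/ 1/2 <= cR).
  { apply (even_class g (mkperm i0 i2 i1 i3) (face_has (on_ty g) 3));
      [apply dst0213|exact Hg|apply inR|class_tac|vm_compute; reflexivity]. }
  assert (A2 : cS = 0 \/ 1/2 <= cS).
  { apply (even_class g (mkperm i1 i2 i0 i3) (face_has (on_ty g) 2));
      [apply dst1203|exact Hg|apply inS|class_tac|vm_compute; reflexivity]. }
  destruct A1; [apply large_R_obtuse; lra|]. destruct A2; [apply large_S_obtuse; lra|].
  apply large_RS_small; auto.
Qed.

Lemma cR_eq_cS : r = s -> cR = cS.
Proof.
  intros E. unfold cR, cS.
  rewrite <- (cosd_symmetry L swap01 i1 i2 i0 i3); [reflexivity|].
  intros a b. destruct (classic (a = b)) as [->|N].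
  - destruct b; unfold L, sqlen; simpl; destruct (P i0), (P i1), (P i2), (P i3); uv; ring.
  - rewrite !L_val; auto; [|intro; destruct a, b; simpl in *; congruence].
    destruct a, b; simpl; congruence.
Qed.

(** The facets at an edge of class [r] are isosceles with base [p] or [q], and alternate because
    these differ. *)
Lemma large_C2v : r = s -> r <> p -> r <> q -> p <> q -> largeQ P.
Proof.
  intros Ers N1 N2 N3. pose proof (cR_eq_cS Ers) as Ec.
  set (g := fun t : nat => match t with 0 => 0 | 1 => 1 | _ => 2 end%nat).
  assert (Hg : refines L (on_ty g)) by refine_tac.
  assert (A1 : cR = 0 \/ 1/2 <= cR).
  { apply (even_class g (mkperm i0 i2 i1 i3) (face_has (on_ty g) 0));
      [apply dst0213|exact Hg|apply inR|class_tac|vm_compute; reflexivity]. }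
  destruct A1; [apply large_R_obtuse; lra|]. apply large_RS_small; lra.
Qed.

(** Edges of the classes [p] and [r] may surround the same edge, so their angles are not controlled;
    parity at the classes [q] and [s] is enough. *)
Lemma large_isosceles_apex : p = r -> r <> s -> r <> q -> s <> q -> largeQ P.
Proof.
  intros Epr N1 N2 N3.
  set (g := fun t : nat => match t with 0 => 0 | 1 => 1 | 2 => 0 | _ => 3 end%nat).
  assert (Hg : refines L (on_ty g)) by refine_tac.
  assert (A1 : cQ = 0 \/ 1/2 <= cQ).
  { apply (even_class g (mkperm i2 i3 i0 i1) (face_has (on_ty g) 3));
      [apply dst2301|exact Hg|apply inQ|class_tac|vm_compute; reflexivity]. }
  assert (A2 : cS = 0 \/ 1/2 <= cS).
  { apply (even_class g (mkperm i1 i2 i0 i3) (face_has (on_ty g) 1));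
      [apply dst1203|exact Hg|apply inS|class_tac|vm_compute; reflexivity]. }
  destruct A1; [apply large_Q_right; auto|]. destruct A2; [apply large_S_obtuse; lra|].
  apply large_QS_small; auto.
Qed.

Definition rot123 (a : idx) : idx := match a with i0 => i0 | i1 => i2 | i2 => i3 | i3 => i1 end.

Lemma large_pyramid : p = r -> q = s -> r <> s -> largeQ P.
Proof.
  intros Epr Eqs N.
  assert (Ec : cQ = cS).
  { unfold cQ, cS.
    rewrite <- (cosd_symmetry L rot123 i1 i2 i0 i3); [reflexivity|].
    intros a b. destruct (classic (a = b)) as [->|Nab].
    - destruct b; unfold L, sqlen; simpl; destruct (P i0), (P i1), (P i2), (P i3); uv; ring.
    - rewrite !L_val; auto; [|intro; destruct a, b; simpl in *; congruence].
      destruct a, b; simpl; congruence. }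
  set (g := fun t : nat => match t with 0 => 0 | 1 => 1 | 2 => 0 | _ => 1 end%nat).
  assert (Hg : refines L (on_ty g)) by refine_tac.
  assert (A2 : cS = 0 \/ 1/2 <= cS).
  { apply (even_class g (mkperm i1 i2 i0 i3) (face_has (on_ty g) 0));
      [apply dst1203|exact Hg|apply inS|class_tac|vm_compute; reflexivity]. }
  destruct A2; [apply large_S_obtuse; lra|]. apply large_QS_small; lra.
Qed.

Ltac lens := unfold nn, dn, gram; rewrite !L_val by congruence; simpl.

Lemma nnL_pos a b c d : dst a b c d -> 0 < nn L a b c.
Proof. intros H. apply (nn_pos (P a) (P b) (P c) (P d)). apply svQ_perm_ne; auto. Qed.

Lemma cosd_same a b c d N D : dst a b c d -> nn L a b c = N -> nn L a b d = N -> dn L a b c d = D ->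
  0 < N /\ cosd L a b c d * N = D.
Proof.
  intros H H1 H2 H3. pose proof (nnL_pos a b c d H) as HN. rewrite H1 in HN. split; auto.
  unfold cosd. rewrite H1, H2, H3, sqrt_sqrt by lra. field. lra.
Qed.

Lemma cosd_mixed a b c d : dst a b c d ->
  0 < nn L a b c * nn L a b d /\
  (cosd L a b c d) ^ 2 * (nn L a b c * nn L a b d) = dn L a b c d ^ 2 /\
  (0 < dn L a b c d <-> 0 < cosd L a b c d).
Proof.
  intros H. pose proof (nnL_pos a b c d H) as H1.
  assert (H2 : 0 < nn L a b d) by (apply nnL_pos with c; unfold dst in *; intuition).
  pose proof (sqrt_lt_R0 _ H1) as Q1. pose proof (sqrt_lt_R0 _ H2) as Q2.
  pose proof (sqrt_sqrt _ (Rlt_le _ _ H1)) as E1. pose proof (sqrt_sqrt _ (Rlt_le _ _ H2)) as E2.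
  split; [apply Rmult_lt_0_compat; auto|].
  assert (E : cosd L a b c d * (sqrt (nn L a b c) * sqrt (nn L a b d)) = dn L a b c d).
  { unfold cosd. field. lra. }
  split.
  - rewrite <- E, <- E1, <- E2 at 1. ring.
  - assert (0 < sqrt (nn L a b c) * sqrt (nn L a b d)) by (apply Rmult_lt_0_compat; auto).
    rewrite <- E. split; intros; nra.
Qed.

Lemma r_pos : 0 < r.
Proof. rewrite <- Hr. apply (d2_pos (P i0) (P i2) (P i1) (P i3)). apply (svQ_perm_ne P); auto. apply dst0213. Qed.
Lemma s_pos : 0 < s.
Proof. rewrite <- Hs. apply (d2_pos (P i1) (P i2) (P i0) (P i3)). apply (svQ_perm_ne P); auto. apply dst1203. Qed.
Lemma q_pos : 0 < q.
Proof. rewrite <- Hq. apply (d2_pos (P i2) (P i3) (P i0) (P i1)). apply (svQ_perm_ne P); auto. apply dst2301. Qed.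

(** The dihedral cosine [1/3] lies strictly between 0 and [1/2] and differs from [cos 72], which is
    about 0.309. *)
Lemma not_regular : p = r -> q = r -> s = r -> False.
Proof.
  intros E1 E2 E3.
  assert (Hg : refines L (fun a b => 0%nat)) by (intros a b a' b' _ _ _; auto).
  pose proof r_pos as Pr.
  assert (K : forall a b c d, dst a b c d -> cosd L a b c d = 1/3).
  { intros a b c d H. destruct (cosd_same a b c d (3/4*(r*r)) (1/4*(r*r)) H) as [PN E].
    - destruct H as (?&?&?&?&?&?). lens. destruct a, b, c, d; try congruence; simpl; rewrite ?E1, ?E2, ?E3; field.
    - destruct H as (?&?&?&?&?&?). lens. destruct a, b, c, d; try congruence; simpl; rewrite ?E1, ?E2, ?E3; field.
    - destruct H as (?&?&?&?&?&?). lens. destruct a, b, c, d; try congruence; simpl; rewrite ?E1, ?E2, ?E3; field.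
    - nra. }
  pose proof c5_bounds.
  destruct (const_class (fun _ => 0%nat) (mkperm i0 i1 i2 i3) cP); auto using inP, dst0123.
  - intros t Lt _. destruct t as [|[|[|[|t]]]]; [..|lia]; simpl; unfold cP, cQ, cR, cS; rewrite !K; auto; repeat split; congruence.
  - unfold cP in H0. rewrite K in H0; [lra|repeat split; congruence].
  - unfold cP in H0. rewrite K in H0; [lra|repeat split; congruence].
Qed.

Definition half_turn (a : idx) : idx := match a with i0 => i2 | i1 => i3 | i2 => i0 | i3 => i1 end.

(** The case of the special tetrahedron. All facets are congruent, so there is no parity, and five
    tiles at an edge of class [r] must be excluded directly: from [cQ = 1 - 2 * cR] the other cosine
    would be about 0.38, which [any_turn] forbids. *)
Lemma large_disphenoid : p = q -> r = s -> r <> p -> largeQ P.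
Proof.
  intros Epq Ers N. pose proof (cR_eq_cS Ers) as Ec.
  assert (EPQ : cP = cQ).
  { unfold cP, cQ. rewrite <- (cosd_symmetry L half_turn i0 i1 i2 i3); [reflexivity|].
    intros a b. destruct (classic (a = b)) as [->|Nab].
    - destruct b; unfold L, sqlen; simpl; destruct (P i0), (P i1), (P i2), (P i3); uv; ring.
    - rewrite !L_val; auto; [|intro; destruct a, b; simpl in *; congruence].
      destruct a, b; simpl; congruence. }
  set (g := fun t : nat => match t with 0 => 0 | 1 => 0 | _ => 2 end%nat).
  assert (Hg : refines L (on_ty g)) by refine_tac.
  assert (A1 : cR <= 0 \/ cR = c5 \/ 1/2 <= cR).
  { apply (const_class g (mkperm i0 i2 i1 i3)); [apply dst0213|exact Hg|apply inR|class_tac]. }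
  assert (A2 : cQ <= 0 \/ cQ = c5 \/ 1/2 <= cQ).
  { apply (const_class g (mkperm i2 i3 i0 i1)); [apply dst2301|exact Hg|apply inQ|class_tac]. }
  destruct A1 as [A1|[A1|A1]]; [apply large_R_obtuse; lra| |apply large_RS_small; lra].
  exfalso.
  destruct (cosd_same i0 i2 i1 i3 (p * r - p * p / 4) (p * p / 4) dst0213) as [PN E1];
    try (lens; rewrite <- ?Ers, <- ?Epq; field).
  destruct (cosd_same i2 i3 i0 i1 (p * r - p * p / 4) (p * r - p * p * 3 / 4) dst2301) as [_ E2];
    try (lens; rewrite <- ?Ers, <- ?Epq; field).
  fold cR in E1. fold cQ in E2. pose proof c5_bounds. rewrite A1 in E1.
  assert (cQ = 1 - 2 * c5) by (apply Rmult_eq_reg_r with (p * r - p * p / 4); lra).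
  lra.
Qed.

(** Parity controls class [s] only. The remaining range [0 < cR < 1/2] is incompatible with
    [1/2 <= cS], as the explicit cosines in terms of [x = s / r] show. *)
Lemma large_kite : p = r -> q = r -> r <> s -> largeQ P.
Proof.
  intros Epr Eqr N.
  set (g := fun t : nat => match t with 0 => 0 | 1 => 0 | 2 => 0 | _ => 3 end%nat).
  assert (Hg : refines L (on_ty g)) by refine_tac.
  assert (A2 : cS = 0 \/ 1/2 <= cS).
  { apply (even_class g (mkperm i1 i2 i0 i3) (face_has (on_ty g) 3));
      [apply dst1203|exact Hg|apply inS|class_tac|vm_compute; reflexivity]. }
  destruct A2 as [A2|A2]; [apply large_S_obtuse; lra|].
  destruct (Rle_or_lt cR 0) as [|B1]; [apply large_R_obtuse; auto|].
  destruct (Rle_or_lt (1/2) cR) as [|B2]; [apply large_RS_small; auto|].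
  exfalso. pose proof r_pos as Pr. pose proof s_pos as Ps.
  destruct (cosd_mixed i0 i2 i1 i3 dst0213) as (P1 & E1 & [_ S1]).
  destruct (cosd_mixed i1 i2 i0 i3 dst1203) as (P2 & E2 & _).
  fold cR in E1, S1. fold cS in E2. specialize (S1 B1).
  assert (N1 : nn L i0 i2 i1 = s * r - s * s / 4) by (lens; rewrite Epr; field).
  assert (N2 : nn L i0 i2 i3 = 3/4 * (r * r)) by (lens; rewrite Eqr; field).
  assert (N3 : nn L i1 i2 i0 = s * r - s * s / 4) by (lens; rewrite Epr; field).
  assert (N4 : nn L i1 i2 i3 = s * r - r * r / 4) by (lens; rewrite Eqr; field).
  assert (D1 : dn L i0 i2 i1 i3 = r * (2 * r - s) / 4) by (lens; rewrite Epr, Eqr; field).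
  assert (D2 : dn L i1 i2 i0 i3 = s * r / 4) by (lens; rewrite Epr, Eqr; field).
  rewrite N1, N2 in P1, E1. rewrite D1 in E1, S1. rewrite N3, N4 in P2, E2. rewrite D2 in E2.
  (* normalise to r = 1: then (2 - x)^2 < 3 x (4 - x) / 4 contradicts x >= (4 - x) (x - 1/4) *)
  set (x := s / r). assert (Ex : s = x * r) by (unfold x; field; lra).
  assert (Px : 0 < x) by (apply Rdiv_lt_0_compat; auto).
  rewrite Ex in P1, E1, S1, P2, E2. clearbody x.
  assert (Pr4 : 0 < (r * r) * (r * r)) by (apply Rmult_lt_0_compat; nra).
  assert (F1 : (2 - x)^2 / 16 <= 1/4 * ((x - x * x / 4) * (3/4))).
  { apply Rmult_le_reg_r with ((r*r)*(r*r)); auto.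
    replace ((2 - x) ^ 2 / 16 * (r * r * (r * r))) with ((r * (2 * r - x * r) / 4) ^ 2) by field.
    rewrite <- E1.
    assert (cR ^ 2 <= 1/4) by nra.
    replace (1 / 4 * ((x - x * x / 4) * (3 / 4)) * (r * r * (r * r))) with (1/4 * ((x * r * r - x * r * (x * r) / 4) * (3 / 4 * (r * r)))) by field.
    apply Rmult_le_compat_r; lra. }
  assert (F2 : 1/4 * ((x - x * x / 4) * (x - 1/4)) <= x^2 / 16).
  { apply Rmult_le_reg_r with ((r*r)*(r*r)); auto.
    replace (x ^ 2 / 16 * (r * r * (r * r))) with ((x * r * r / 4) ^ 2) by field.
    rewrite <- E2.
    assert (1/4 <= cS ^ 2) by nra.
    replace (1 / 4 * ((x - x * x / 4) * (x - 1 / 4)) * (r * r * (r * r))) with (1/4 * ((x * r * r - x * r * (x * r) / 4) * (x * r * r - r * r / 4))) by field.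
    apply Rmult_le_compat_r; lra. }
  assert (F3 : 0 < 2 - x).
  { destruct (Rlt_or_le 0 (2 - x)); auto. assert (r * (2 * r - x * r) <= 0); [|lra].
    replace (r * (2 * r - x * r)) with ((r * r) * (2 - x)) by ring. nra. }
  assert (F4 : (1 - x/4) * (x - 1/4) <= x / 4).
  { apply Rmult_le_reg_l with (x/4); [lra|]. simpl in F2. lra. }
  simpl in F1. nra.
Qed.

Lemma acos_small c : -1 < c < 1 -> (1/2 <= c <-> acos c <= PI / 3).
Proof.
  intros H. pose proof (acos_inside c H). pose proof (cos_acos c ltac:(lra)) as C. pose proof PI_RGT_0.
  split; intros K.
  - destruct (Rle_or_lt (acos c) (PI/3)); auto.
    assert (cos (acos c) < cos (PI/3)) by (apply cos_decreasing_1; lra). rewrite cos_PI3 in H3. lra.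
  - rewrite <- C, <- cos_PI3. apply cos_decr_1; lra.
Qed.

(** An edge of length [r] may be surrounded by tiles of both classes [q] and [r]. An edge of class
    [p] marks the facets that alternate at the latter, two edges of class [s] those at the former,
    so both counts are even and [b * acos cR + a * acos cQ = PI]. With [acos cS <= PI / 3], the
    spherical excess at [i2] gives [acos cR + acos cQ > 2 PI / 3], which leaves few values of [a]
    and [b]. *)
Lemma large_equilateral_face : q = r -> p <> r -> p <> s -> r <> s -> largeQ P.
Proof.
  intros Eqr N1 N2 N3.
  set (g := fun t : nat => match t with 0 => 1 | 1 => 0 | 2 => 0 | _ => 3 end%nat).
  assert (Hg : refines L (on_ty g)) by refine_tac.
  assert (A2 : cS = 0 \/ 1/2 <= cS).
  { apply (even_class g (mkperm i1 i2 i0 i3) (face_has (on_ty g) 1));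
      [apply dst1203|exact Hg|apply inS|class_tac|vm_compute; reflexivity]. }
  destruct A2 as [A2|A2]; [apply large_S_obtuse; lra|].
  destruct (Hcyc (mkperm i0 i2 i1 i3) dst0213) as (n & rho & HC).
  set (isA := fun t : perm => Nat.eqb (ty (pa t) (pb t)) 2).
  destruct (walk_counts L _ _ n rho isA (acos cR) (acos cQ) Hg HC dst0213) as (x & y & E & Hx & Ev1 & Ev2 & _).
  { intros t Dt Et. rewrite theta_val by auto. f_equal. unfold isA, ecode in *.
    revert Et. destruct t as [a b c d]; simpl. destruct a, b; simpl; auto; discriminate. }
  specialize (Hx eq_refl).
  specialize (Ev1 (face_has (on_ty g) 1) ltac:(vm_compute; reflexivity)).
  specialize (Ev2 (face_all (on_ty g) 3) ltac:(vm_compute; reflexivity)).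
  apply Nat.even_spec in Ev1, Ev2. destruct Ev1 as [b ->], Ev2 as [a ->].
  rewrite !mult_INR in E. simpl (INR 2) in E.
  pose proof (acos_inside _ inR) as BR. pose proof (acos_inside _ inQ) as BQ. pose proof (acos_inside _ inS) as BS.
  pose proof PI_RGT_0 as PP.
  assert (V : PI < acos cR + acos cS + acos cQ).
  { assert (sv (P i2) (P i0) (P i1) (P i3) <> 0) by (apply (svQ_perm_ne P); auto; repeat split; congruence).
    pose proof (vertex_angles _ _ _ _ H) as V.
    change (PI < acos (cosd L i2 i0 i1 i3) + acos (cosd L i2 i1 i0 i3) + acos (cosd L i2 i3 i0 i1)) in V.
    rewrite (cosd_ends i0 i2), (cosd_ends i1 i2) in V. exact V. }
  pose proof (proj1 (acos_small _ inS) A2) as TS.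
  assert (Eb : INR b * acos cR + INR a * acos cQ = PI) by lra.
  assert (Hb : 1 <= INR b) by (replace 1 with (INR 1) by reflexivity; apply le_INR; lia).
  assert (GA : acos cR <= PI/3 -> largeQ P) by (intros K; apply large_RS_small; auto; apply acos_small; auto; apply inR).
  destruct a as [|a].
  - simpl in Eb. destruct (INR_cases b) as [->|[->|[->|H3]]]; simpl in *; try lra.
    + apply large_R_obtuse. rewrite <- (cos_acos cR) by (pose proof inR; lra).
      replace (acos cR) with (PI/2) by lra. rewrite cos_PI2. lra.
    + apply GA. nra.
  - assert (Ha : 1 <= INR (S a)) by (rewrite S_INR; pose proof (pos_INR a); lra).
    destruct (le_lt_dec 2 b) as [B2|B2].
    + apply GA. assert (2 <= INR b) by (replace 2 with (INR 2) by reflexivity; apply le_INR; auto).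
      assert (2 * acos cR <= INR b * acos cR) by nra. assert (acos cQ <= INR (S a) * acos cQ) by nra. lra.
    + assert (b = 1%nat) by lia. subst b.
      destruct a as [|a].
      * simpl in Eb. apply large_QR_supplementary; auto.
        rewrite <- (cos_acos cQ), <- (cos_acos cR) by (pose proof inR; pose proof inQ; lra).
        replace (acos cQ) with (PI - acos cR) by lra. apply Rtrigo_facts.cos_pi_minus.
      * apply large_QS_small; auto. apply acos_small; [apply inQ|].
        assert (2 <= INR (S (S a))) by (rewrite !S_INR; pose proof (pos_INR a); lra).
        assert (2 * acos cQ <= INR (S (S a)) * acos cQ) by nra. simpl (INR 1) in *. lra.
Qed.

(** Two equilateral faces meet in [i0 i1], and the shape depends on [x = q / r] alone:
    [cP = 1 - 2 x / 3], [cQ = (2 - x) / (4 - x)], [cR^2 = x / (12 - 3 x)]. The edges of class [q]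
    have a length of their own, so the possible values of [cQ] are those of [any_turn]. *)
Lemma large_equilateral_pair : p = r -> s = r -> q <> r -> largeQ P.
Proof.
  intros Epr Esr N. pose proof (cR_eq_cS (eq_sym Esr)) as Ec.
  set (g := fun t : nat => match t with 1 => 1 | _ => 0 end%nat).
  assert (Hg : refines L (on_ty g)) by refine_tac.
  pose proof r_pos as Pr. pose proof q_pos as Pq.
  destruct (cosd_same i0 i1 i2 i3 (3/4*(r*r)) (3/4 * (r * r) - r * q / 2) dst0123) as [_ EP];
    try (lens; rewrite ?Epr, ?Esr; field).
  destruct (cosd_same i2 i3 i0 i1 (r * q - q * q / 4) (r * q / 2 - q * q / 4) dst2301) as [PN EQ];
    try (lens; rewrite ?Epr, ?Esr; field).
  destruct (cosd_mixed i0 i2 i1 i3 dst0213) as (_ & ER & [SR _]).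
  assert (N1 : nn L i0 i2 i1 = 3/4 * (r * r)) by (lens; rewrite Epr, Esr; field).
  assert (N2 : nn L i0 i2 i3 = r * q - q * q / 4) by (lens; field).
  assert (D1 : dn L i0 i2 i1 i3 = r * q / 4) by (lens; rewrite Epr, Esr; field).
  rewrite N1, N2, D1 in ER. rewrite D1 in SR. fold cP in EP. fold cQ in EQ. fold cR in ER, SR.
  assert (SR' : 0 < cR) by (apply SR; nra). clear SR N1 N2 D1.
  set (x := q / r). assert (Ex : q = x * r) by (unfold x; field; lra).
  assert (Px : 0 < x) by (apply Rdiv_lt_0_compat; auto).
  assert (Pr2 : 0 < r * r) by nra.
  assert (Pr4 : 0 < (r * r) * (r * r)) by (apply Rmult_lt_0_compat; auto).
  assert (FP : cP = 1 - 2 * x / 3).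
  { apply Rmult_eq_reg_r with (3/4 * (r*r)); [|nra]. rewrite EP, Ex. field. }
  assert (FQ : cQ * (4 - x) = 2 - x).
  { apply Rmult_eq_reg_r with (x * (r*r) / 4); [|nra]. rewrite Ex in EQ.
    replace (cQ * (4 - x) * (x * (r * r) / 4)) with (cQ * (r * (x * r) - x * r * (x * r) / 4)) by field.
    rewrite EQ. field. }
  assert (FR : cR * cR * (3 * (4 - x)) = x).
  { apply Rmult_eq_reg_r with (x * ((r*r) * (r*r)) / 16); [|nra]. rewrite Ex in ER.
    replace (cR * cR * (3 * (4 - x)) * (x * (r * r * (r * r)) / 16)) with (cR ^ 2 * (3 / 4 * (r * r) * (r * (x * r) - x * r * (x * r) / 4))) by field.
    rewrite ER. field. }
  assert (X4 : x < 4).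
  { rewrite Ex in PN. replace (r * (x * r) - x * r * (x * r) / 4) with ((r * r) * (x * (4 - x) / 4)) in PN by field.
    destruct (Rlt_or_le x 4); auto. assert (x * (4 - x) <= 0) by nra. nra. }
  clearbody x.
  assert (A : cQ <= 0 \/ cQ = c5 \/ 1/2 <= cQ).
  { apply (const_class g (mkperm i2 i3 i0 i1)); [apply dst2301|exact Hg|apply inQ|class_tac]. }
  pose proof inP as IP. pose proof inR as IR.
  destruct A as [A|[A|A]].
  - assert (2 <= x) by (destruct (Rle_or_lt 2 x); auto; nra).
    apply large_RS_small; rewrite <- ?Ec; destruct (Rle_or_lt (1/2) cR); auto; nra.
  - (* x = 1.1056..: all angles lie between 60 and 90 degrees, so five tiles meet at each edge of
       class [r], an even number of them with angle [acos cR]; both possibilities miss 2 PI. *)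
    exfalso. pose proof c5_bounds as C5. rewrite A in FQ.
    assert (X1 : 1105/1000 < x < 1106/1000) by (split; nra).
    assert (R2 : cR * cR * (12 - 3 * x) = x) by lra.
    assert (R3 : 127/1000 < cR * cR < 128/1000) by (split; nra).
    assert (R4 : 35/100 < cR < 36/100) by (split; nra).
    assert (P4 : 262/1000 < cP < 264/1000) by lra.
    destruct (Hcyc (mkperm i0 i2 i1 i3) dst0213) as (n & rho & HC).
    set (isA := fun t : perm => negb (Nat.eqb (ty (pa t) (pb t)) 0)).
    destruct (walk_counts L _ _ n rho isA (acos cR) (acos cP) Hg HC dst0213) as (u & v & E & Hu & Ev1 & _).
    { intros t Dt Et. rewrite theta_val by auto. f_equal. unfold isA, ecode in *.
      revert Et. destruct t as [a b c d]; simpl. destruct a, b; simpl; intros; congruence. }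
    specialize (Hu eq_refl).
    specialize (Ev1 (face_has (on_ty g) 1) ltac:(vm_compute; reflexivity)).
    apply Nat.even_spec in Ev1. destruct Ev1 as [b ->].
    pose proof (acos_inside _ IR) as BR. pose proof (acos_inside _ IP) as BP. pose proof PI_RGT_0 as PP.
    pose proof (cos_acos cR ltac:(lra)) as CR. pose proof (cos_acos cP ltac:(lra)) as CP.
    set (tr := acos cR) in *. set (tp := acos cP) in *.
    assert (K1 : PI/3 < tr < PI/2).
    { split.
      - destruct (Rlt_or_le (PI/3) tr); auto. assert (cos (PI/3) <= cos tr) by (apply cos_decr_1; lra).
        rewrite cos_PI3 in H0. lra.
      - destruct (Rlt_or_le tr (PI/2)); auto. assert (cos tr <= 0) by (apply cos_le_0; lra). lra. }
    assert (K2 : PI/3 < tp < PI/2).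
    { split.
      - destruct (Rlt_or_le (PI/3) tp); auto. assert (cos (PI/3) <= cos tp) by (apply cos_decr_1; lra).
        rewrite cos_PI3 in H0. lra.
      - destruct (Rlt_or_le tp (PI/2)); auto. assert (cos tp <= 0) by (apply cos_le_0; lra). lra. }
    assert (Cnt : (2 * b + v = 5)%nat).
    { pose proof (pos_INR (2 * b)) as Q1. pose proof (pos_INR v) as Q2.
      assert (Hb1 : 1 <= INR (2*b)) by (replace 1 with (INR 1) by reflexivity; apply le_INR; lia).
      set (B := INR (2 * b)) in *. set (V := INR v) in *.
      assert (0 < B * (tr - PI/3)) by (apply Rmult_lt_0_compat; lra).
      assert (0 <= V * (tp - PI/3)) by (apply Rmult_le_pos; lra).
      assert (0 < B * (PI/2 - tr)) by (apply Rmult_lt_0_compat; lra).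
      assert (0 <= V * (PI/2 - tp)) by (apply Rmult_le_pos; lra).
      assert (M3 : INR (2 * b + v) < INR 6).
      { rewrite plus_INR. fold B V. simpl. apply Rmult_lt_reg_r with (PI/3); lra. }
      assert (M4 : INR 4 < INR (2 * b + v)).
      { rewrite plus_INR. fold B V. simpl. apply Rmult_lt_reg_r with (PI/2); lra. }
      apply INR_lt in M3, M4. lia. }
    assert (Cases : (b = 1 /\ v = 3)%nat \/ (b = 2 /\ v = 1)%nat) by lia.
    destruct Cases as [[-> ->]|[-> ->]]; simpl in E.
    + assert (T : cos (2 * tr) = cos (tp + 2 * tp)).
      { replace (tp + 2 * tp) with (2 * PI - 2 * tr) by lra. rewrite cos_minus, cos_2PI, sin_2PI. ring. }
      rewrite cos_plus, sin_2a, !cos_2a_cos, CR, CP in T.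
      pose proof (sin2_cos2 tp) as S2. unfold Rsqr in S2. rewrite CP in S2.
      assert (S3 : sin tp * sin tp = 1 - cP * cP) by lra.
      assert (T2 : 2 * (cR * cR) - 1 = cP * (2 * cP * cP - 1) - 2 * cP * (sin tp * sin tp)) by lra.
      rewrite S3 in T2.
      assert (T3 : cP * cP < 7/100) by nra.
      assert (T4 : cP * (cP * cP) < 264/1000 * (7/100)) by nra. nra.
    + assert (T : cos tp = cos (2 * (2 * tr))).
      { replace (2 * (2 * tr)) with (2 * PI - tp) by lra. rewrite cos_minus, cos_2PI, sin_2PI. ring. }
      rewrite !cos_2a_cos, CR, CP in T.
      set (w := cR * cR) in *. assert (T2 : cP = 2 * ((2 * w - 1) * (2 * w - 1)) - 1) by (unfold w; lra).
      nra.
  - exfalso. nra.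
Qed.
End Mirror.

(** * Tetrahedra without a plane of symmetry *)

(** The two classes are the complementary paths [i2 i0 i1 i3] and [i0 i3 i2 i1]. The half turn
    [swap_both] preserves both, so each path has one angle at its middle edge and one at its two end
    edges. *)
Definition path_code (a b : idx) : nat :=
  match a, b with
  | i0, i1 | i1, i0 | i0, i2 | i2, i0 | i1, i3 | i3, i1 => 0
  | _, _ => 1
  end%nat.

Definition swap_both (a : idx) : idx := match a with i0 => i1 | i1 => i0 | i2 => i3 | i3 => i2 end.

Section Path.
Context (P : idx -> pt) (al be : R).
Let L := sqlen P.
Context (Hsv : svQ P <> 0) (Hcyc : has_cycles L) (Hne : al <> be)
  (H01 : L i0 i1 = al) (H02 : L i0 i2 = al) (H13 : L i1 i3 = al)
  (H03 : L i0 i3 = be) (H12 : L i1 i2 = be) (H23 : L i2 i3 = be).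

Lemma path_val a b : a <> b -> L a b = match path_code a b with 0%nat => al | _ => be end.
Proof.
  intros N; destruct a, b; try congruence; simpl; auto;
  unfold L; rewrite sqlen_sym; auto.
Qed.

Lemma path_refines : refines L path_code.
Proof.
  intros a b a' b' N N' E. rewrite !path_val in E by auto.
  destruct a, b, a', b'; simpl in *; congruence.
Qed.

Lemma path_half_turn a b c d :
  cosd L (swap_both a) (swap_both b) (swap_both c) (swap_both d) = cosd L a b c d.
Proof.
  apply cosd_symmetry. intros x y. destruct (classic (x = y)) as [->|N].
  - destruct y; unfold L, sqlen; simpl; destruct (P i0), (P i1), (P i2), (P i3); uv; ring.
  - rewrite !path_val; auto; [|intro; destruct x, y; simpl in *; congruence].
    destruct x, y; simpl; congruence.
Qed.

Let cA := cosd L i0 i1 i2 i3.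
Let cB := cosd L i0 i2 i1 i3.
Let cC := cosd L i0 i3 i1 i2.
Let cD := cosd L i2 i3 i0 i1.

Definition path_cos (a b : idx) : R :=
  match a, b with
  | i0, i1 | i1, i0 => cA
  | i2, i3 | i3, i2 => cD
  | i0, i2 | i2, i0 | i1, i3 | i3, i1 => cB
  | _, _ => cC
  end.

Lemma path_theta t : dstp t -> theta L t = acos (path_cos (pa t) (pb t)).
Proof.
  destruct t as [a b c d]. intros H. unfold dstp in H; simpl in *. unfold theta; simpl. f_equal.
  assert (Ends : forall a b c d, cosd L b a c d = cosd L a b c d) by (intros; apply (cosd_swap_ends (P _) (P _))).
  assert (Sides : forall a b c d, cosd L a b d c = cosd L a b c d) by (intros; apply (cosd_swap_sides (P _) (P _))).
  perms a b c d H; simpl; unfold cA, cB, cC, cD;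
  first [ reflexivity | rewrite Ends; reflexivity | rewrite Sides; reflexivity
        | rewrite Ends, Sides; reflexivity
        | rewrite <- path_half_turn; simpl; reflexivity
        | rewrite <- path_half_turn; simpl; rewrite Ends; reflexivity
        | rewrite <- path_half_turn; simpl; rewrite Sides; reflexivity
        | rewrite <- path_half_turn; simpl; rewrite Ends, Sides; reflexivity ].
Qed.

Lemma path_cos_inside a b : -1 < path_cos a b < 1.
Proof.
  assert (K : forall a b c d, dst a b c d -> -1 < cosd L a b c d < 1) by (intros; apply cosd_sqlen_inside; auto).
  destruct a, b; simpl; apply K; repeat split; congruence.
Qed.

(* Along the cycle the tiles appear in the order (A B B)^x; [pot] records the position in a block. *)
Lemma path_cycle_A : exists x : nat, (1 <= x)%nat /\ INR x * (acos cA + 2 * acos cB) = 2 * PI.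
Proof.
  assert (Hd : dstp (mkperm i0 i1 i2 i3)) by (unfold dstp, dst; simpl; repeat split; congruence).
  destruct (Hcyc _ Hd) as (n & rho & HC).
  set (isA := fun t : perm => Nat.eqb (ty (pa t) (pb t)) 0).
  destruct (walk_counts L path_code _ n rho isA (acos cA) (acos cB) path_refines HC Hd) as (x & y & E & Hx & _ & _ & Hy).
  { intros t Dt Et. rewrite path_theta by auto. f_equal. unfold isA, ecode in *.
    revert Et. destruct t as [a b c d]; simpl. destruct a, b; simpl; intros; congruence. }
  exists x. split; [apply Hx; reflexivity|].
  specialize (Hy (fun t => if isA t then 0%Z else if face_has path_code 0 t then 2%Z else 1%Z) ltac:(vm_compute; reflexivity)).
  subst y. rewrite mult_INR in E. simpl (INR 2) in E. lra.
Qed.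

Lemma path_cycle_D : exists x : nat, (1 <= x)%nat /\ INR x * (acos cD + 2 * acos cC) = 2 * PI.
Proof.
  assert (Hd : dstp (mkperm i2 i3 i0 i1)) by (unfold dstp, dst; simpl; repeat split; congruence).
  destruct (Hcyc _ Hd) as (n & rho & HC).
  set (isA := fun t : perm => Nat.eqb (ty (pa t) (pb t)) 1).
  destruct (walk_counts L path_code _ n rho isA (acos cD) (acos cC) path_refines HC Hd) as (x & y & E & Hx & _ & _ & Hy).
  { intros t Dt Et. rewrite path_theta by auto. f_equal. unfold isA, ecode in *.
    assert (N : pa t <> pb t) by apply Dt.
    revert N Et. destruct t as [a b c d]; simpl. destruct a, b; simpl; intros; congruence. }
  exists x. split; [apply Hx; reflexivity|].
  specialize (Hy (fun t => if isA t then 0%Z else if face_has path_code 1 t then 2%Z else 1%Z) ltac:(vm_compute; reflexivity)).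
  subst y. rewrite mult_INR in E. simpl (INR 2) in E. lra.
Qed.

Lemma obtuse_cos c : -1 < c < 1 -> 2 * PI / 3 <= acos c -> c <= - (1/2).
Proof.
  intros H K. pose proof (acos_inside c H). pose proof PI_RGT_0.
  rewrite <- (cos_acos c) by lra.
  replace (- (1/2)) with (cos (2 * PI / 3)).
  - apply cos_decr_1; lra.
  - replace (2 * PI / 3) with (PI - PI/3) by field. rewrite Rtrigo_facts.cos_pi_minus, cos_PI3. reflexivity.
Qed.

Lemma large_obtuse a b c d : dst a b c d -> cosd L a d b c <= - (1/2) -> largeQ P.
Proof.
  intros Hd H. apply large_perm with a b c d; auto. apply large_very_obtuse_angle; auto. apply svQ_perm_ne; auto.
Qed.

(** If both block numbers were at least 2, then [A + 2B <= PI] and [D + 2C <= PI], against the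
    excess at [i0] and [i2], which adds up to [A + 2B + 2C + D > 2 PI]. If one of them is 1, three
    angles sum to [2 PI] and one is at least 120 degrees. *)
Lemma large_path : largeQ P.
Proof.
  destruct path_cycle_A as (x & Hx & Ex). destruct path_cycle_D as (y & Hy & Ey).
  pose proof PI_RGT_0 as PP.
  pose proof (path_cos_inside i0 i1) as IA. pose proof (path_cos_inside i0 i2) as IB.
  pose proof (path_cos_inside i0 i3) as IC. pose proof (path_cos_inside i2 i3) as ID. simpl in IA, IB, IC, ID.
  pose proof (acos_inside _ IA). pose proof (acos_inside _ IB). pose proof (acos_inside _ IC). pose proof (acos_inside _ ID).
  destruct (le_lt_dec 2 x) as [X2|X2].
  - destruct (le_lt_dec 2 y) as [Y2|Y2].
    + exfalso.
      assert (2 <= INR x) by (replace 2 with (INR 2) by reflexivity; apply le_INR; auto).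
      assert (2 <= INR y) by (replace 2 with (INR 2) by reflexivity; apply le_INR; auto).
      assert (acos cA + 2 * acos cB <= PI) by nra.
      assert (acos cD + 2 * acos cC <= PI) by nra.
      pose proof (vertex_angles (P i0) (P i1) (P i2) (P i3) Hsv) as V0.
      change (PI < acos cA + acos cB + acos cC) in V0.
      assert (S2 : sv (P i2) (P i0) (P i1) (P i3) <> 0) by (apply (svQ_perm_ne P); auto; repeat split; congruence).
      pose proof (vertex_angles _ _ _ _ S2) as V2.
      assert (K : forall a b c d, dst a b c d -> acos (cosd d2 (P a) (P b) (P c) (P d)) = acos (path_cos a b)).
      { intros a b c d Hd. apply (path_theta (mkperm a b c d) Hd). }
      rewrite !K in V2 by (repeat split; congruence). simpl in V2. lra.
    + assert (y = 1)%nat by lia. subst y. simpl in Ey.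
      destruct (Rle_or_lt (2 * PI / 3) (acos cD)) as [K|K].
      * apply obtuse_cos in K; auto. apply large_obtuse with i2 i0 i1 i3; auto. repeat split; congruence.
      * assert (K2 : 2 * PI / 3 <= acos cC) by lra.
        apply obtuse_cos in K2; auto. apply large_obtuse with i0 i1 i2 i3; auto. repeat split; congruence.
  - assert (x = 1)%nat by lia. subst x. simpl in Ex.
    destruct (Rle_or_lt (2 * PI / 3) (acos cA)) as [K|K].
    + apply obtuse_cos in K; auto. apply large_obtuse with i0 i2 i3 i1; auto. repeat split; congruence.
    + assert (K2 : 2 * PI / 3 <= acos cB) by lra.
      apply obtuse_cos in K2; auto. apply large_obtuse with i0 i1 i3 i2; auto. repeat split; congruence.
Qed.
End Path.

(** * Relabelling and the classification of the possible shapes *)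

Definition relabel (T : tet) (a b c d : idx) : tet := mktet (vt T a) (vt T b) (vt T c) (vt T d).

Lemma relabel_hull T a b c d : dst a b c d -> seteq (hull (relabel T a b c d)) (hull T).
Proof.
  intros H x. rewrite !hull_inhull. apply (inhull_perm (vt T) a b c d x H).
Qed.

Lemma relabel_admits T a b c d : dst a b c d -> admits_op_ftf_tiling T -> admits_op_ftf_tiling (relabel T a b c d).
Proof.
  intros H (I & tile & (H1 & H2) & H3). exists I, tile. split; [split; auto|auto].
  intros i. destruct (H1 i) as (f & Hf & E). exists f. split; auto.
  intros x. rewrite (E x). split; intros (y & Hy & Ey); exists y; split; auto;
  apply (relabel_hull T a b c d H); auto.
Qed.

Lemma relabel_svQ T a b c d : dst a b c d -> svQ (vt T) <> 0 -> svQ (vt (relabel T a b c d)) <> 0.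
Proof. intros H HT. apply (svQ_perm_ne (vt T) a b c d); auto. Qed.

Lemma relabel_large T a b c d : dst a b c d -> largeQ (vt (relabel T a b c d)) -> largeQ (vt T).
Proof. intros H HL. apply (large_perm (vt T) a b c d); auto. Qed.

Lemma admits_cycles T : svQ (vt T) <> 0 -> admits_op_ftf_tiling T -> has_cycles (sqlen (vt T)).
Proof.
  intros H HA r0 Hr. destruct (tiling_labelled T H HA) as (I & Q & HT).
  apply (edge_cycle_exists HT r0 Hr).
Qed.

(** The cases above cover the patterns of coincidence only up to symmetry. The patterns excluded in
    [G] are reached by exchanging [i0] and [i1], which swaps [r] and [s], or, when [r = s], by
    exchanging the two opposite edges [p] and [q]. *)
Lemma mirror_large T : svQ (vt T) <> 0 -> admits_op_ftf_tiling T ->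
  sqlen (vt T) i0 i2 = sqlen (vt T) i0 i3 -> sqlen (vt T) i1 i2 = sqlen (vt T) i1 i3 -> largeQ (vt T).
Proof.
  intros Hsv HA.
  assert (G : forall T, svQ (vt T) <> 0 -> admits_op_ftf_tiling T -> forall p q r s,
     sqlen (vt T) i0 i1 = p -> sqlen (vt T) i2 i3 = q -> sqlen (vt T) i0 i2 = r -> sqlen (vt T) i0 i3 = r ->
     sqlen (vt T) i1 i2 = s -> sqlen (vt T) i1 i3 = s ->
     (p = s -> r <> s -> False) -> (q = s -> r <> s -> p <> r -> False) -> (r = s -> q = r -> p <> r -> False) -> largeQ (vt T)).
  { clear. intros T Hsv HA p q r s Hp Hq Hr Hr' Hs Hs' F1 F2 F3.
    pose proof (admits_cycles T Hsv HA) as Hc.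
    destruct (Req_dec r s) as [Ers|Nrs].
    - destruct (Req_dec p r) as [Epr|Npr].
      + destruct (Req_dec q r) as [Eqr|Nqr].
        * exfalso. apply (not_regular (vt T) p q r s); auto.
        * apply (large_equilateral_pair (vt T) p q r s); auto.
      + destruct (Req_dec q r) as [Eqr|Nqr]; [exfalso; auto|].
        destruct (Req_dec p q) as [Epq|Npq].
        * apply (large_disphenoid (vt T) p q r s); auto.
        * apply (large_C2v (vt T) p q r s); auto.
    - destruct (Req_dec p r) as [Epr|Npr].
      + destruct (Req_dec q r) as [Eqr|Nqr]; [apply (large_kite (vt T) p q r s); auto|].
        destruct (Req_dec q s) as [Eqs|Nqs]; [apply (large_pyramid (vt T) p q r s); auto|].
        apply (large_isosceles_apex (vt T) p q r s); auto.
      + destruct (Req_dec q r) as [Eqr|Nqr].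
        * apply (large_equilateral_face (vt T) p q r s); auto.
        * apply (large_generic (vt T) p q r s); auto. }
  intros E1 E2.
  set (p := sqlen (vt T) i0 i1). set (q := sqlen (vt T) i2 i3). set (r := sqlen (vt T) i0 i2). set (s := sqlen (vt T) i1 i2).
  assert (D1 : dst i1 i0 i2 i3) by (repeat split; congruence).
  assert (D2 : dst i2 i3 i0 i1) by (repeat split; congruence).
  assert (Sw : ((p = s \/ (q = s /\ p <> r)) /\ r <> s) -> largeQ (vt T)).
  { intros [C N]. apply relabel_large with i1 i0 i2 i3; auto.
    apply (G _ (relabel_svQ T _ _ _ _ D1 Hsv) (relabel_admits T _ _ _ _ D1 HA) p q s r); auto;
      try (unfold sqlen, relabel; simpl; unfold p, q, r, s; rewrite ?E1, ?E2; auto; fail);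
      try (unfold p; apply (sqlen_sym (vt T))).
    - intros K1 K2. destruct C as [C|[C1 C2]]; congruence.
    - intros K1 K2 K3. destruct C as [C|[C1 C2]]; congruence. }
  destruct (classic ((p = s \/ (q = s /\ p <> r)) /\ r <> s)) as [|NS]; [auto|].
  destruct (classic (r = s /\ q = r /\ p <> r)) as [(C1 & C2 & C3)|NC].
  { apply relabel_large with i2 i3 i0 i1; auto.
    apply (G _ (relabel_svQ T _ _ _ _ D2 Hsv) (relabel_admits T _ _ _ _ D2 HA) q p r s); auto.
    - change (sqlen (vt T) i2 i0 = r). rewrite sqlen_sym; auto.
    - change (sqlen (vt T) i2 i1 = r). rewrite sqlen_sym. unfold r, s in *; congruence.
    - change (sqlen (vt T) i3 i0 = s). rewrite sqlen_sym. unfold r, s in *; congruence.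
    - change (sqlen (vt T) i3 i1 = s). rewrite sqlen_sym. unfold r, s in *; congruence. }
  apply (G T Hsv HA p q r s); auto; tauto.
Qed.

Definition edge_code (c1 c2 c3 c4 c5 : nat) (a b : idx) : nat :=
  match a, b with
  | i0, i2 | i2, i0 => c1
  | i0, i3 | i3, i0 => c2
  | i1, i2 | i2, i1 => c3
  | i1, i3 | i3, i1 => c4
  | i2, i3 | i3, i2 => c5
  | _, _ => 0%nat
  end.

Definition mirrorb (code : idx -> idx -> nat) (t : perm) : bool :=
  Nat.eqb (code (pa t) (pc t)) (code (pa t) (pd t)) && Nat.eqb (code (pb t) (pc t)) (code (pb t) (pd t)).
Definition pathb (code : idx -> idx -> nat) (t : perm) : bool :=
  Nat.eqb (code (pa t) (pb t)) (code (pa t) (pc t)) && Nat.eqb (code (pa t) (pb t)) (code (pb t) (pd t))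
  && Nat.eqb (code (pa t) (pd t)) (code (pb t) (pc t)) && Nat.eqb (code (pa t) (pd t)) (code (pc t) (pd t)).

(** The facet left by a label is spanned by [pa], [pb], [pd]; each of the four occurs once. *)
Definition facets : list perm := [mkperm i0 i1 i3 i2; mkperm i0 i1 i2 i3; mkperm i0 i2 i1 i3; mkperm i1 i2 i0 i3].

(* Every facet can be glued to a facet by a length-preserving map compatible with the orientations. *)
Definition gluable (code : idx -> idx -> nat) : bool :=
  forallb (fun t => existsb (stepb code t) all_perms) facets.

Definition check_code (code : idx -> idx -> nat) : bool :=
  implb (gluable code) (existsb (fun t => mirrorb code t || pathb code t) all_perms).

(** Each edge is coded by the position of the first edge of its length, so the k-th code is at most
    k and these 720 codes include every partition of the six edges. *)
Lemma all_codes_checked :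
  forallb (fun c1 => forallb (fun c2 => forallb (fun c3 => forallb (fun c4 => forallb (fun c5 =>
    check_code (edge_code c1 c2 c3 c4 c5)) (seq 0 6)) (seq 0 5)) (seq 0 4)) (seq 0 3)) (seq 0 2) = true.
Proof. vm_compute. reflexivity. Qed.

Lemma classification (L : idx -> idx -> R) : (forall a b, L a b = L b a) -> has_cycles L ->
  exists a b c d, dst a b c d /\
   ((L a c = L a d /\ L b c = L b d) \/
    (L a b = L a c /\ L a b = L b d /\ L a d = L b c /\ L a d = L c d)).
Proof.
  intros Sym Hc.
  (* Position of the first edge whose squared length is [v]; for an edge length the default 5 means
     that of [i2 i3]. *)
  set (F := fun v : R => (if Req_EM_T (L i0 i1) v then 0 else if Req_EM_T (L i0 i2) v then 1
     else if Req_EM_T (L i0 i3) v then 2 else if Req_EM_T (L i1 i2) v then 3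
     else if Req_EM_T (L i1 i3) v then 4 else 5)%nat).
  set (code := edge_code (F (L i0 i2)) (F (L i0 i3)) (F (L i1 i2)) (F (L i1 i3)) (F (L i2 i3))).
  assert (F0 : F (L i0 i1) = 0%nat) by (unfold F; destruct (Req_EM_T (L i0 i1) (L i0 i1)); congruence).
  assert (EF : forall a b, a <> b -> code a b = F (L a b)).
  { intros a b N. unfold code. destruct a, b; simpl; try congruence; try reflexivity;
    rewrite ?(Sym i1 i0), ?(Sym i2 i0), ?(Sym i3 i0), ?(Sym i2 i1), ?(Sym i3 i1), ?(Sym i3 i2); auto. }
  assert (Inj : forall a b a' b', a <> b -> a' <> b' -> F (L a b) = F (L a' b') -> L a b = L a' b').
  { set (G := fun n : nat => match n with 0 => L i0 i1 | 1 => L i0 i2 | 2 => L i0 i3 | 3 => L i1 i2 | 4 => L i1 i3 | _ => L i2 i3 end%nat).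
    assert (K : forall a b, a <> b -> G (F (L a b)) = L a b).
    { intros a b N. unfold F.
      destruct (Req_EM_T (L i0 i1) (L a b)); auto. destruct (Req_EM_T (L i0 i2) (L a b)); auto.
      destruct (Req_EM_T (L i0 i3) (L a b)); auto. destruct (Req_EM_T (L i1 i2) (L a b)); auto.
      destruct (Req_EM_T (L i1 i3) (L a b)); auto. simpl.
      destruct a, b; try congruence; rewrite ?(Sym i1 i0), ?(Sym i2 i0), ?(Sym i3 i0), ?(Sym i2 i1), ?(Sym i3 i1), ?(Sym i3 i2) in *; congruence. }
    intros a b a' b' N N' E. rewrite <- (K a b), <- (K a' b'), E; auto. }
  assert (Href : refines L code).
  { intros a b a' b' N N' E. rewrite !EF by auto. congruence. }
  assert (Gl : gluable code = true).
  { apply forallb_forall. intros t Ht.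
    assert (Dt : dstp t) by (unfold facets in Ht; simpl in Ht;
      destruct Ht as [<-|[<-|[<-|[<-|[]]]]]; unfold dstp, dst; simpl; repeat split; congruence).
    destruct (Hc t Dt) as (n & rho & R0 & _ & _ & St).
    destruct (St 0%nat) as (_ & _ & C0). destruct (St 1%nat) as (D1 & E1 & _). rewrite R0 in C0.
    apply existsb_exists. exists (rho 1%nat). split; [apply all_perms_complete; auto|].
    destruct C0 as (A1 & A2 & A3). unfold dstp, dst in Dt, D1. unfold stepb.
    rewrite E1, Bool.eqb_reflx.
    rewrite (Href _ _ _ _ (proj1 Dt) (proj1 D1) A1), Nat.eqb_refl.
    rewrite (Href (pa t) (pd t) (pa (rho 1%nat)) (pc (rho 1%nat))), Nat.eqb_refl by tauto.
    rewrite (Href (pb t) (pd t) (pb (rho 1%nat)) (pc (rho 1%nat))), Nat.eqb_refl by tauto. reflexivity. }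
  assert (Ck : check_code code = true).
  { pose proof all_codes_checked as H.
    assert (B1 : In (F (L i0 i2)) (seq 0 2)).
    { apply in_seq. unfold F. destruct (Req_EM_T _ _); [lia|]. destruct (Req_EM_T _ _); [lia|congruence]. }
    assert (B2 : In (F (L i0 i3)) (seq 0 3)).
    { apply in_seq. unfold F. repeat (destruct (Req_EM_T _ _); [lia|]). congruence. }
    assert (B3 : In (F (L i1 i2)) (seq 0 4)).
    { apply in_seq. unfold F. repeat (destruct (Req_EM_T _ _); [lia|]). congruence. }
    assert (B4 : In (F (L i1 i3)) (seq 0 5)).
    { apply in_seq. unfold F. repeat (destruct (Req_EM_T _ _); [lia|]). congruence. }
    assert (B5 : In (F (L i2 i3)) (seq 0 6)).
    { apply in_seq. unfold F. repeat (destruct (Req_EM_T _ _); [lia|]). lia. }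
    rewrite forallb_forall in H. specialize (H _ B1). cbv beta in H.
    rewrite forallb_forall in H. specialize (H _ B2). cbv beta in H.
    rewrite forallb_forall in H. specialize (H _ B3). cbv beta in H.
    rewrite forallb_forall in H. specialize (H _ B4). cbv beta in H.
    rewrite forallb_forall in H. specialize (H _ B5). exact H. }
  unfold check_code in Ck. rewrite Gl in Ck. cbn [implb] in Ck.
  apply existsb_exists in Ck. destruct Ck as (t & Ht & Hb).
  apply all_perms_dst in Ht. exists (pa t), (pb t), (pc t), (pd t). split; [exact Ht|].
  assert (Bk : forall a b a' b', a <> b -> a' <> b' -> Nat.eqb (code a b) (code a' b') = true -> L a b = L a' b').
  { intros a b a' b' N N' E. apply Nat.eqb_eq in E. rewrite !EF in E by auto. auto. }
  unfold dstp, dst in Ht. apply orb_true_iff in Hb. destruct Hb as [Hb|Hb].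
  - left. unfold mirrorb in Hb. apply andb_true_iff in Hb. destruct Hb.
    split; apply Bk; auto; tauto.
  - right. unfold pathb in Hb. rewrite !andb_true_iff in Hb. destruct Hb as [[[X1 X2] X3] X4].
    repeat split; apply Bk; auto; tauto.
Qed.

Lemma tiling_large T : svQ (vt T) <> 0 -> admits_op_ftf_tiling T -> largeQ (vt T).
Proof.
  intros Hsv HA.
  destruct (classification (sqlen (vt T)) (sqlen_sym (vt T)) (admits_cycles T Hsv HA)) as (a & b & c & d & Hd & K).
  apply relabel_large with a b c d; auto.
  pose proof (relabel_svQ T a b c d Hd Hsv) as Hsv'. pose proof (relabel_admits T a b c d Hd HA) as HA'.
  destruct K as [[K1 K2]|(K1 & K2 & K3 & K4)].
  - apply mirror_large; auto.
  - destruct (Req_dec (sqlen (vt T) a b) (sqlen (vt T) a d)) as [E|N].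
    + apply mirror_large; auto.
      * change (sqlen (vt T) a c = sqlen (vt T) a d). congruence.
      * change (sqlen (vt T) b c = sqlen (vt T) b d). congruence.
    + apply (large_path (vt (relabel T a b c d)) (sqlen (vt T) a b) (sqlen (vt T) a d)); auto.
      apply admits_cycles; auto.
Qed.

Lemma tarea_asum T : 2 * tarea T = asum d2 (v0 T) (v1 T) (v2 T) (v3 T).
Proof. unfold tarea, asum. rewrite !tri_area_nn. field. Qed.

Lemma tvol_sv T : tvol T = 1 -> sv (v0 T) (v1 T) (v2 T) (v3 T) ^ 2 = 36.
Proof.
  intros H. unfold tvol in H. set (x := sv _ _ _ _) in *.
  assert (E : Rabs x = 6) by lra.
  pose proof (Rsqr_abs x) as S. unfold Rsqr in S. rewrite E in S. simpl. lra.
Qed.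

(* 165888 = (288 sqrt 2)^2 *)
Lemma tarea_lower_bound T : tvol T = 1 -> admits_op_ftf_tiling T -> 165888 <= tarea T ^ 6.
Proof.
  intros Hv HA. pose proof (tvol_sv T Hv) as E.
  assert (Hsv : svQ (vt T) <> 0).
  { unfold svQ; simpl. intro Z. rewrite Z in E. lra. }
  pose proof (tiling_large T Hsv HA) as HL. unfold largeQ, large_area in HL.
  rewrite svsq_d2 in HL. simpl vt in HL. rewrite E, <- tarea_asum in HL.
  replace ((2 * tarea T) ^ 6) with (64 * tarea T ^ 6) in HL by ring. lra.
Qed.

(** * Congruence of tetrahedra with equal edge lengths *)

(** The differences of the weights sum to zero, so squared distances depend on the edge lengths
    only. Hence the affine map matching the vertices of two such tetrahedra is an isometry. *)
Lemma d2_lin4_lin4 s t u v s' t' u' v' A B C D : s + t + u + v = 1 -> s' + t' + u' + v' = 1 ->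
  d2 (lin4 s t u v A B C D) (lin4 s' t' u' v' A B C D) =
  - ((s-s')*(t-t') * d2 A B + (s-s')*(u-u') * d2 A C + (s-s')*(v-v') * d2 A D
     + (t-t')*(u-u') * d2 B C + (t-t')*(v-v') * d2 B D + (u-u')*(v-v') * d2 C D).
Proof.
  intros H H'. assert (E : s = 1 - t - u - v) by lra. assert (E' : s' = 1 - t' - u' - v') by lra. subst.
  destruct A, B, C, D; unfold lin4; uv; ring.
Qed.

Lemma det3_mul (m11 m12 m13 m21 m22 m23 m31 m32 m33 : R) (e f g : pt) :
  let comb x y z := mkpt (x * px e + y * px f + z * px g) (x * py e + y * py f + z * py g) (x * pz e + y * pz f + z * pz g) in
  det3 (comb m11 m12 m13) (comb m21 m22 m23) (comb m31 m32 m33) =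
  det3 (mkpt m11 m12 m13) (mkpt m21 m22 m23) (mkpt m31 m32 m33) * det3 e f g.
Proof. destruct e, f, g; uv; ring. Qed.

Lemma sv_lin4 A B C D s1 t1 u1 w1 s2 t2 u2 w2 s3 t3 u3 w3 s4 t4 u4 w4 :
  s1 + t1 + u1 + w1 = 1 -> s2 + t2 + u2 + w2 = 1 -> s3 + t3 + u3 + w3 = 1 -> s4 + t4 + u4 + w4 = 1 ->
  sv (lin4 s1 t1 u1 w1 A B C D) (lin4 s2 t2 u2 w2 A B C D) (lin4 s3 t3 u3 w3 A B C D) (lin4 s4 t4 u4 w4 A B C D)
  = det3 (mkpt (t2-t1) (u2-u1) (w2-w1)) (mkpt (t3-t1) (u3-u1) (w3-w1)) (mkpt (t4-t1) (u4-u1) (w4-w1)) * sv A B C D.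
Proof.
  intros H1 H2 H3 H4. unfold sv at 2. rewrite <- det3_mul. unfold sv.
  assert (K : forall s t u v s' t' u' v', s + t + u + v = 1 -> s' + t' + u' + v' = 1 ->
     vsub (lin4 s t u v A B C D) (lin4 s' t' u' v' A B C D) =
     mkpt ((t-t') * px (vsub B A) + (u-u') * px (vsub C A) + (v-v') * px (vsub D A))
          ((t-t') * py (vsub B A) + (u-u') * py (vsub C A) + (v-v') * py (vsub D A))
          ((t-t') * pz (vsub B A) + (u-u') * pz (vsub C A) + (v-v') * pz (vsub D A))).
  { intros. assert (E : s = 1 - t - u - v) by lra. assert (E' : s' = 1 - t' - u' - v') by lra. subst.
    apply pt_eq; unfold lin4, vsub; simpl; ring. }
  rewrite !K by auto. reflexivity.
Qed.

Lemma congruent P Q : svQ P <> 0 -> (forall a b, sqlen P a b = sqlen Q a b) ->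
  exists f, isometry f /\ seteq (image f (inhullQ P)) (inhullQ Q) /\ (0 < svQ P * svQ Q -> orient_pres f).
Proof.
  intros HP HL. unfold svQ in HP.
  set (w0 := fun x => sv x (P i1) (P i2) (P i3) / svQ P).
  set (w1 := fun x => sv (P i0) x (P i2) (P i3) / svQ P).
  set (w2 := fun x => sv (P i0) (P i1) x (P i3) / svQ P).
  set (w3 := fun x => sv (P i0) (P i1) (P i2) x / svQ P).
  assert (W : forall x, w0 x + w1 x + w2 x + w3 x = 1 /\
     x = linQ (w0 x) (w1 x) (w2 x) (w3 x) P)
    by (intros x; apply (lin4_all (P i0) (P i1) (P i2) (P i3) x HP)).
  set (f := fun x => linQ (w0 x) (w1 x) (w2 x) (w3 x) Q).
  assert (Hf : isometry f).
  { intros x y. rewrite !dist_d2. f_equal.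
    destruct (W x) as [Sx Ex]. destruct (W y) as [Sy Ey].
    transitivity (d2 (linQ (w0 x) (w1 x) (w2 x) (w3 x) P) (linQ (w0 y) (w1 y) (w2 y) (w3 y) P));
      [|rewrite <- Ex, <- Ey; reflexivity].
    unfold f. rewrite !d2_lin4_lin4 by auto. unfold sqlen in HL. rewrite !HL. reflexivity. }
  assert (FP : forall s t u v, s + t + u + v = 1 ->
     f (linQ s t u v P) = linQ s t u v Q).
  { intros s t u v S. set (x := linQ s t u v P).
    destruct (W x) as [Sx Ex]. unfold x in Ex at 1. apply lin4_inj in Ex; auto.
    destruct Ex as (X0 & X1 & X2 & X3). unfold f. rewrite <- X0, <- X1, <- X2, <- X3. reflexivity. }
  exists f. split; auto. split.
  - intros y; split.
    + intros (x & (s & t & u & v & H1 & H2 & H3 & H4 & H5 & E) & <-).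
      exists s, t, u, v. repeat split; auto. rewrite E, FP; auto.
    + intros (s & t & u & v & H1 & H2 & H3 & H4 & H5 & E).
      exists (linQ s t u v P). split; [exists s, t, u, v; repeat split; auto|].
      rewrite FP; auto.
  - intros Hor a b c d H. unfold f.
    destruct (W a) as [Sa Ea]. destruct (W b) as [Sb Eb]. destruct (W c) as [Sc Ec]. destruct (W d) as [Sd Ed].
    rewrite sv_lin4 by auto. fold (svQ Q).
    rewrite Ea, Eb, Ec, Ed in H. rewrite sv_lin4 in H by auto. fold (svQ P) in H.
    set (M := det3 _ _ _) in *.
    assert (0 < (M * svQ P) * (svQ P * svQ Q)) by (apply Rmult_lt_0_compat; auto).
    assert (0 < svQ P * svQ P) by (unfold svQ; nra).
    replace (M * svQ P * (svQ P * svQ Q)) with (M * svQ Q * (svQ P * svQ P)) in H0 by ring.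
    destruct (Rlt_or_le 0 (M * svQ Q)); auto. nra.
Qed.

Lemma inhull_convex A B C D P0 P1 P2 P3 s t u v : 0 <= s -> 0 <= t -> 0 <= u -> 0 <= v -> s + t + u + v = 1 ->
  (s <> 0 -> inhull A B C D P0) -> (t <> 0 -> inhull A B C D P1) ->
  (u <> 0 -> inhull A B C D P2) -> (v <> 0 -> inhull A B C D P3) ->
  inhull A B C D (lin4 s t u v P0 P1 P2 P3).
Proof.
  intros Hs Ht Hu Hv S H0 H1 H2 H3.
  assert (K : forall k X, 0 <= k -> (k <> 0 -> inhull A B C D X) -> exists a b c d,
    0 <= a /\ 0 <= b /\ 0 <= c /\ 0 <= d /\ a + b + c + d = k /\
    k * px X = a * px A + b * px B + c * px C + d * px D /\
    k * py X = a * py A + b * py B + c * py C + d * py D /\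
    k * pz X = a * pz A + b * pz B + c * pz C + d * pz D).
  { intros k X Hk HX. destruct (Req_dec k 0) as [->|N].
    - exists 0, 0, 0, 0. repeat split; lra.
    - destruct (HX N) as (a & b & c & d & Ha & Hb & Hc & Hd & Sm & E).
      exists (k*a), (k*b), (k*c), (k*d). subst X. simpl. repeat split; try nra; ring. }
  destruct (K s P0 Hs H0) as (a0 & b0 & c0 & d0 & A1 & A2 & A3 & A4 & A5 & A6 & A7 & A8).
  destruct (K t P1 Ht H1) as (a1 & b1 & c1 & e1 & B1 & B2 & B3 & B4 & B5 & B6 & B7 & B8).
  destruct (K u P2 Hu H2) as (a2 & b2 & c2 & e2 & C1 & C2 & C3 & C4 & C5 & C6 & C7 & C8).
  destruct (K v P3 Hv H3) as (a3 & b3 & c3 & d3 & D1 & D2 & D3 & D4 & D5 & D6 & D7 & D8).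
  exists (a0+a1+a2+a3), (b0+b1+b2+b3), (c0+c1+c2+c3), (d0+e1+e2+d3).
  repeat split; try lra. apply pt_eq; simpl; lra.
Qed.

(** * The tiling by Kuhn simplices *)

Inductive order3 : Set := s012 | s021 | s102 | s120 | s201 | s210.
Definition cell : Set := (Z * Z * Z * order3)%type.

(* Offsets of the vertices on the monotone lattice path from (0,0,0) to (1,1,1) that
   increases the coordinates in the given order. *)
Definition offset (g : order3) (k : idx) : Z * Z * Z :=
  match k, g with
  | i0, _ => (0, 0, 0)
  | i1, s012 => (1, 0, 0) | i1, s021 => (1, 0, 0) | i1, s102 => (0, 1, 0)
  | i1, s120 => (0, 1, 0) | i1, s201 => (0, 0, 1) | i1, s210 => (0, 0, 1)
  | i2, s012 => (1, 1, 0) | i2, s021 => (1, 0, 1) | i2, s102 => (1, 1, 0)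
  | i2, s120 => (0, 1, 1) | i2, s201 => (1, 0, 1) | i2, s210 => (0, 1, 1)
  | i3, _ => (1, 1, 1)
  end%Z.

Definition vz (c : cell) (k : idx) : Z * Z * Z :=
  let '(x, y, z, g) := c in let '(a, b, d) := offset g k in (x + a, y + b, z + d)%Z.

(* The basis (-1,1,1), (1,-1,1), (1,1,-1) of the body-centred cubic lattice, in which unit steps
   and their total sum have squared length 3, and sums of two steps have squared length 4. *)
Definition embed (h : R) (x y z : R) : pt := mkpt (h * (- x + y + z)) (h * (x - y + z)) (h * (x + y - z)).
Definition embz (h : R) (v : Z * Z * Z) : pt :=
  let '(x, y, z) := v in embed h (IZR x) (IZR y) (IZR z).
Definition kvert (h : R) (c : cell) (k : idx) : pt := embz h (vz c k).
Definition ktile (h : R) (c : cell) : tet :=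
  mktet (kvert h c i0) (kvert h c i1) (kvert h c i2) (kvert h c i3).

Definition lx (h : R) (X : pt) : R := (py X + pz X) / (2 * h).
Definition ly (h : R) (X : pt) : R := (px X + pz X) / (2 * h).
Definition lz (h : R) (X : pt) : R := (px X + py X) / (2 * h).

(** Take the floors of the lattice coordinates of [X + t (1,1,1)]. While [t] runs through [[0, 1)],
    they visit exactly the vertices of nonzero weight of a Kuhn simplex containing [X], each for a
    time equal to its weight. These vertices are therefore determined by [X] alone. *)
Definition floor_at (h : R) (v : Z * Z * Z) (X : pt) (t : R) : Prop :=
  let '(x, y, z) := v in
  IZR x <= lx h X + t < IZR x + 1 /\ IZR y <= ly h X + t < IZR y + 1 /\ IZR z <= lz h X + t < IZR z + 1.

Lemma floor_unique a b r : IZR a <= r < IZR a + 1 -> IZR b <= r < IZR b + 1 -> a = b.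
Proof.
  intros H1 H2. assert (IZR a < IZR (b + 1)) by (rewrite plus_IZR; lra).
  assert (IZR b < IZR (a + 1)) by (rewrite plus_IZR; lra).
  apply lt_IZR in H, H0. lia.
Qed.

Lemma floor_at_unique h v w X t : floor_at h v X t -> floor_at h w X t -> v = w.
Proof.
  destruct v as [[x y] z], w as [[x' y'] z']. intros (A1 & A2 & A3) (B1 & B2 & B3).
  f_equal; [f_equal|]; eapply floor_unique; eauto.
Qed.

Section Kuhn.
Context (h : R) (Hh : 0 < h).

Lemma lattice_coords c s t u v : s + t + u + v = 1 ->
  let X := linQ s t u v (kvert h c) in
  let '(x, y, z, g) := c in
  let o k := offset g k in
  lx h X = IZR x + t * IZR (fst (fst (o i1))) + u * IZR (fst (fst (o i2))) + v /\
  ly h X = IZR y + t * IZR (snd (fst (o i1))) + u * IZR (snd (fst (o i2))) + v /\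
  lz h X = IZR z + t * IZR (snd (o i1)) + u * IZR (snd (o i2)) + v.
Proof.
  intros S. destruct c as [[[x y] z] g]. assert (E : s = 1 - t - u - v) by lra. subst s.
  destruct g; simpl; unfold lx, ly, lz, kvert, embz, embed, lin4; simpl; rewrite !plus_IZR;
  repeat split; field; lra.
Qed.

Lemma floor_somewhere c s t u v r : 0 <= s -> 0 <= t -> 0 <= u -> 0 <= v -> s + t + u + v = 1 -> 0 <= r < 1 ->
  exists m, floor_at h (vz c m) (linQ s t u v (kvert h c)) r.
Proof.
  intros H1 H2 H3 H4 S Hr. pose proof (lattice_coords c s t u v S) as K.
  destruct c as [[[x y] z] g]. cbv zeta in K. destruct K as (K1 & K2 & K3).
  set (X := lin4 _ _ _ _ _ _ _ _) in *.
  destruct (Rlt_or_le r s); [exists i0|destruct (Rlt_or_le r (s + t)); [exists i1|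
    destruct (Rlt_or_le r (s + t + u)); [exists i2|exists i3]]];
  destruct g; simpl in *; rewrite K1, K2, K3, ?plus_IZR; simpl; repeat split; lra.
Qed.

Lemma floor_vertex c s t u v k : 0 <= s -> 0 <= t -> 0 <= u -> 0 <= v -> s + t + u + v = 1 ->
  (match k with i0 => s | i1 => t | i2 => u | i3 => v end) <> 0 ->
  exists r, 0 <= r < 1 /\
    floor_at h (vz c k) (linQ s t u v (kvert h c)) r.
Proof.
  intros H1 H2 H3 H4 S Hk. pose proof (lattice_coords c s t u v S) as K.
  destruct c as [[[x y] z] g]. cbv zeta in K. destruct K as (K1 & K2 & K3).
  set (X := lin4 _ _ _ _ _ _ _ _) in *.
  (* The moment at which the vertex is reached; its nonzero weight keeps this moment below 1. *)
  destruct k; [exists 0|exists s|exists (s+t)|exists (s+t+u)]; (split; [lra|]);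
  destruct g; simpl in *; rewrite K1, K2, K3, ?plus_IZR; simpl; repeat split; lra.
Qed.

Lemma vt_ktile c k : vt (ktile h c) k = kvert h c k.
Proof. destruct k; reflexivity. Qed.

Definition shared (c c' : cell) (k : idx) : Prop := exists m, vz c k = vz c' m.

(** The core of the face-to-face property: at the moment when [X] visits vertex [k] of [c], the
    floors are also a vertex of [c']. *)
Lemma common_point_shared c c' s t u v k : 0 <= s -> 0 <= t -> 0 <= u -> 0 <= v -> s + t + u + v = 1 ->
  hull (ktile h c') (linQ s t u v (kvert h c)) ->
  (match k with i0 => s | i1 => t | i2 => u | i3 => v end) <> 0 -> shared c c' k.
Proof.
  intros H1 H2 H3 H4 S HX Hk. destruct (floor_vertex c s t u v k H1 H2 H3 H4 S Hk) as (r & Hr & F).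
  apply hull_inhull in HX. destruct HX as (s' & t' & u' & v' & G1 & G2 & G3 & G4 & G5 & E). simpl in E.
  destruct (floor_somewhere c' s' t' u' v' r G1 G2 G3 G4 G5 Hr) as [m Fm].
  rewrite <- E in Fm. exists m. eapply floor_at_unique; eauto.
Qed.

(** The coordinate sum grows by one along each lattice path, so shared vertices occupy equal
    positions, and they determine base point and order. *)
Lemma shared_all c c' : (forall k, shared c c' k) -> c = c'.
Proof.
  intros H. set (sm := fun w : Z * Z * Z => (fst (fst w) + snd (fst w) + snd w)%Z).
  assert (K : forall c, sm (vz c i1) = (sm (vz c i0) + 1)%Z /\ sm (vz c i2) = (sm (vz c i0) + 2)%Z /\ sm (vz c i3) = (sm (vz c i0) + 3)%Z).
  { intros [[[x y] z] g]. unfold sm. destruct g; simpl; lia. }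
  destruct (K c) as (A1 & A2 & A3). destruct (K c') as (B1 & B2 & B3).
  destruct (H i0) as [m0 E0]. destruct (H i1) as [m1 E1]. destruct (H i2) as [m2 E2]. destruct (H i3) as [m3 E3].
  pose proof (f_equal sm E0) as F0. pose proof (f_equal sm E1) as F1.
  pose proof (f_equal sm E2) as F2. pose proof (f_equal sm E3) as F3.
  assert (m0 = i0) by (destruct m0, m3; auto; lia). subst m0.
  assert (m1 = i1) by (destruct m1; auto; lia). subst m1.
  assert (m2 = i2) by (destruct m2; auto; lia). subst m2.
  destruct c as [[[x y] z] g], c' as [[[x' y'] z'] g'].
  clear - E0 E1 E2. simpl in E0. injection E0; intros.
  assert (x = x') by lia. assert (y = y') by lia. assert (z = z') by lia. subst.
  assert (g = g'); [|subst; auto].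
  destruct g, g'; auto; exfalso; simpl in E1, E2;
  first [injection E1; intros; lia | injection E2; intros; lia].
Qed.

Lemma shared_hull_sub c c' (b : idx -> bool) : (forall k, b k = true <-> shared c c' k) ->
  forall x, (hull (ktile h c) x /\ hull (ktile h c') x) <-> hull_sub (ktile h c) (b i0) (b i1) (b i2) (b i3) x.
Proof.
  intros Hb x. split.
  - intros [H1 H2]. apply hull_inhull in H1. destruct H1 as (s & t & u & v & G1 & G2 & G3 & G4 & G5 & E). simpl in E.
    rewrite E in H2.
    assert (N : forall k, b k = false -> match k with i0 => s | i1 => t | i2 => u | i3 => v end = 0).
    { intros k Hk. apply NNPP. intro N. pose proof (common_point_shared c c' s t u v k G1 G2 G3 G4 G5 H2 N) as Sh.
      apply Hb in Sh. congruence. }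
    exists s, t, u, v. subst x. repeat split; auto; [apply (N i0)|apply (N i1)|apply (N i2)|apply (N i3)].
  - intros H. pose proof H as H'. apply hull_sub_lin4 in H'.
    destruct H' as (s & t & u & v & G1 & G2 & G3 & G4 & G5 & K0 & K1 & K2 & K3 & E).
    split.
    + apply hull_inhull. exists s, t, u, v. repeat split; auto.
    + apply hull_inhull. rewrite E.
      assert (V : forall k, b k = true -> inhull (v0 (ktile h c')) (v1 (ktile h c')) (v2 (ktile h c')) (v3 (ktile h c')) (vt (ktile h c) k)).
      { intros k Hk. apply Hb in Hk. destruct Hk as [m Em]. rewrite vt_ktile. unfold kvert. rewrite Em.
        change (inhullQ (vt (ktile h c')) (kvert h c' m)). rewrite <- vt_ktile. apply vertex_in. }
      apply inhull_convex; auto.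
Qed.

Lemma kvert_len c : let L := sqlen (kvert h c) in
  L i0 i1 = 3 * (h*h) /\ L i0 i2 = 4 * (h*h) /\ L i0 i3 = 3 * (h*h) /\ L i1 i2 = 3 * (h*h) /\
  L i1 i3 = 4 * (h*h) /\ L i2 i3 = 3 * (h*h).
Proof.
  destruct c as [[[x y] z] g]. unfold sqlen, kvert.
  destruct g; simpl; unfold embed, d2, dot, vsub; simpl; rewrite !plus_IZR; repeat split; ring.
Qed.

Lemma kvert_sv c : svQ (kvert h c) <> 0.
Proof.
  intro E. destruct (kvert_len c) as (L1 & L2 & L3 & L4 & L5 & L6). unfold sqlen in *.
  assert (V : svsq d2 (kvert h c i0) (kvert h c i1) (kvert h c i2) (kvert h c i3) = 16 * (h*h)^3)
    by (unfold svsq, gram; rewrite L1, L2, L3, L4, L5, L6; field).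
  rewrite svsq_d2 in V. unfold svQ in E. rewrite E in V.
  assert (0 < (h*h)^3) by (apply pow_lt; nra). lra.
Qed.

(** The cell is given by the integer parts and the order of the fractional parts; the weights are
    successive differences of 1, the sorted fractional parts and 0. *)
Lemma kuhn_cover x : exists c, hull (ktile h c) x.
Proof.
  set (a := lx h x). set (b := ly h x). set (d := lz h x).
  assert (F : forall r, exists n, IZR n <= r < IZR n + 1).
  { intros r. destruct (archimed r) as [A1 A2]. exists (up r - 1)%Z. rewrite minus_IZR. lra. }
  destruct (F a) as [n1 N1]. destruct (F b) as [n2 N2]. destruct (F d) as [n3 N3].
  assert (Ex : x = embed h a b d).
  { apply pt_eq; unfold embed, a, b, d, lx, ly, lz; simpl; field; lra. }
  assert (G : forall g s t u v, 0 <= s -> 0 <= t -> 0 <= u -> 0 <= v -> s + t + u + v = 1 ->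
     let o k := offset g k in
     a = IZR n1 + t * IZR (fst (fst (o i1))) + u * IZR (fst (fst (o i2))) + v ->
     b = IZR n2 + t * IZR (snd (fst (o i1))) + u * IZR (snd (fst (o i2))) + v ->
     d = IZR n3 + t * IZR (snd (o i1)) + u * IZR (snd (o i2)) + v -> exists c, hull (ktile h c) x).
  { intros g s t u v G1 G2 G3 G4 G5 o Ea Eb Ed. exists (n1, n2, n3, g). apply hull_inhull.
    exists s, t, u, v. repeat split; auto. rewrite Ex, Ea, Eb, Ed. unfold o.
    assert (E : s = 1 - t - u - v) by lra. subst s.
    destruct g; simpl; unfold kvert, embz, embed, lin4; simpl; rewrite !plus_IZR; f_equal; ring. }
  set (fa := a - IZR n1). set (fb := b - IZR n2). set (fd := d - IZR n3).
  destruct (Rle_or_lt fb fa); destruct (Rle_or_lt fd fb); destruct (Rle_or_lt fd fa).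
  - apply (G s012 (1 - fa) (fa - fb) (fb - fd) fd); unfold fa, fb, fd in *; simpl; lra.
  - apply (G s012 (1 - fa) (fa - fb) (fb - fd) fd); unfold fa, fb, fd in *; simpl; lra.
  - apply (G s021 (1 - fa) (fa - fd) (fd - fb) fb); unfold fa, fb, fd in *; simpl; lra.
  - apply (G s201 (1 - fd) (fd - fa) (fa - fb) fb); unfold fa, fb, fd in *; simpl; lra.
  - apply (G s102 (1 - fb) (fb - fa) (fa - fd) fd); unfold fa, fb, fd in *; simpl; lra.
  - apply (G s120 (1 - fb) (fb - fd) (fd - fa) fa); unfold fa, fb, fd in *; simpl; lra.
  - apply (G s210 (1 - fd) (fd - fb) (fb - fa) fa); unfold fa, fb, fd in *; simpl; lra.
  - apply (G s210 (1 - fd) (fd - fb) (fb - fa) fa); unfold fa, fb, fd in *; simpl; lra.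
Qed.

(** Moving from [x] slightly towards the missing vertex gives that vertex a positive weight, so the
    new point leaves the face. *)
Lemma hull_sub_no_interior c (b : idx -> bool) k x : b k = false ->
  ~ interior (hull_sub (ktile h c) (b i0) (b i1) (b i2) (b i3)) x.
Proof.
  intros Hk (e & He & HI).
  set (V := kvert h c k).
  (* The summand 1 keeps the denominator positive when [x = V], and the displacement [ep * dist x V]
     stays below [e]. *)
  set (ep := Rmin (1/2) (e / (2 * (dist x V + 1)))).
  pose proof (dist_ge0 x V) as PD.
  assert (P1 : 0 < e / (2 * (dist x V + 1))) by (apply Rdiv_lt_0_compat; lra).
  assert (Pe : 0 < ep) by (apply Rmin_glb_lt; lra).
  assert (Pe2 : ep <= e / (2 * (dist x V + 1))) by apply Rmin_r.
  assert (Pe3 : ep <= 1/2) by apply Rmin_l.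
  set (y := mkpt (px x + ep * (px V - px x)) (py x + ep * (py V - py x)) (pz x + ep * (pz V - pz x))).
  assert (Hy : dist x y < e).
  { assert (E : dist x y = ep * dist x V).
    { rewrite !dist_d2. replace (d2 x y) with ((ep * ep) * d2 x V) by (unfold y; destruct x, V; uv; ring).
      rewrite sqrt_mult by (try apply d2_ge0; nra). rewrite sqrt_square by lra. reflexivity. }
    rewrite E. apply Rle_lt_trans with (e / (2 * (dist x V + 1)) * dist x V); [apply Rmult_le_compat_r; auto|].
    apply Rmult_lt_reg_r with (2 * (dist x V + 1)); [lra|].
    replace (e / (2 * (dist x V + 1)) * dist x V * (2 * (dist x V + 1))) with (e * dist x V) by (field; lra). nra. }
  assert (Hx0 : dist x x < e).
  { rewrite dist_d2. replace (d2 x x) with 0 by (destruct x; uv; ring). rewrite sqrt_0. auto. }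
  apply HI in Hy. apply HI in Hx0. clear HI.
  destruct Hx0 as (s & t & u & v & _ & _ & _ & _ & S & Z0 & Z1 & Z2 & Z3 & E1 & E2 & E3).
  destruct Hy as (s' & t' & u' & v' & _ & _ & _ & _ & S' & Y0 & Y1 & Y2 & Y3 & F1 & F2 & F3).
  set (dl := fun j => if idx_eqb k j then ep else 0).
  assert (Eq : linQ s' t' u' v' (kvert h c) =
    lin4 ((1-ep)*s + dl i0) ((1-ep)*t + dl i1) ((1-ep)*u + dl i2) ((1-ep)*v + dl i3) (kvert h c i0) (kvert h c i1) (kvert h c i2) (kvert h c i3)).
  { apply pt_eq; cbn [lin4 px py pz]; simpl v0 in *; simpl v1 in *; simpl v2 in *; simpl v3 in *.
    - rewrite <- F1. unfold y; cbn [px]. rewrite E1. unfold V, dl. destruct k; simpl; ring.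
    - rewrite <- F2. unfold y; cbn [py]. rewrite E2. unfold V, dl. destruct k; simpl; ring.
    - rewrite <- F3. unfold y; cbn [pz]. rewrite E3. unfold V, dl. destruct k; simpl; ring. }
  apply lin4_inj in Eq; auto.
  - destruct Eq as (Q0 & Q1 & Q2 & Q3). unfold dl in *.
    destruct k; simpl in *.
    + rewrite (Y0 Hk), (Z0 Hk) in Q0. lra.
    + rewrite (Y1 Hk), (Z1 Hk) in Q1. lra.
    + rewrite (Y2 Hk), (Z2 Hk) in Q2. lra.
    + rewrite (Y3 Hk), (Z3 Hk) in Q3. lra.
  - apply kvert_sv.
  - unfold dl. destruct k; simpl; nra.
Qed.
End Kuhn.

Definition swap02 (a : idx) : idx := match a with i0 => i2 | i2 => i0 | x => x end.

Lemma sqlen_diag P a : sqlen P a a = 0.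
Proof. unfold sqlen. destruct (P a); uv; ring. Qed.

Lemma sqlen_ext P Q :
  sqlen P i0 i1 = sqlen Q i0 i1 -> sqlen P i0 i2 = sqlen Q i0 i2 -> sqlen P i0 i3 = sqlen Q i0 i3 ->
  sqlen P i1 i2 = sqlen Q i1 i2 -> sqlen P i1 i3 = sqlen Q i1 i3 -> sqlen P i2 i3 = sqlen Q i2 i3 ->
  forall a b, sqlen P a b = sqlen Q a b.
Proof.
  intros H1 H2 H3 H4 H5 H6 a b.
  destruct a, b; rewrite ?sqlen_diag; auto; rewrite (sqlen_sym P), (sqlen_sym Q); auto.
Qed.

Lemma hull_ktile h c : seteq (hull (ktile h c)) (inhullQ (kvert h c)).
Proof. intros x. apply hull_inhull. Qed.

Lemma image_ext f A B : seteq A B -> seteq (image f A) (image f B).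
Proof. intros E x. split; intros (y & Hy & Ey); exists y; split; auto; apply E; auto. Qed.

Lemma seteq_trans A B C : seteq A B -> seteq B C -> seteq A C.
Proof. intros H1 H2 x. rewrite (H1 x). apply H2. Qed.

(* The tetrahedron has a mirror symmetry, so one may choose the orientation of the labelling. *)
Lemma kuhn_oriented h c c' : 0 < h -> exists f, isometry f /\ orient_pres f /\
  seteq (hull (ktile h c')) (image f (hull (ktile h c))).
Proof.
  intros Hh.
  assert (G : forall Q, (forall a b, sqlen (kvert h c) a b = sqlen Q a b) -> 0 < svQ (kvert h c) * svQ Q ->
     seteq (inhullQ Q) (inhullQ (kvert h c')) -> exists f, isometry f /\ orient_pres f /\
     seteq (hull (ktile h c')) (image f (hull (ktile h c)))).
  { intros Q HL Ho HQ. destruct (congruent (kvert h c) Q (kvert_sv h Hh c) HL) as (f & F1 & F2 & F3).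
    exists f. repeat split; auto.
    - intros Hx. apply (image_ext f _ _ (hull_ktile h c)). apply F2, HQ, hull_ktile. auto.
    - intros Hx. apply hull_ktile, HQ, F2. apply (image_ext f _ _ (hull_ktile h c)). auto. }
  destruct (kvert_len h c) as (A1 & A2 & A3 & A4 & A5 & A6).
  destruct (kvert_len h c') as (B1 & B2 & B3 & B4 & B5 & B6).
  pose proof (kvert_sv h Hh c) as N. pose proof (kvert_sv h Hh c') as N'.
  destruct (Rlt_or_le 0 (svQ (kvert h c) * svQ (kvert h c'))) as [Hs|Hs].
  - apply (G (kvert h c')); auto; [|intros x; tauto].
    apply sqlen_ext; congruence.
  - set (Q := fun k => kvert h c' (swap02 k)).
    assert (D : dst i2 i1 i0 i3) by (repeat split; congruence).
    apply (G Q).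
    + apply sqlen_ext; unfold Q, sqlen; simpl; fold (sqlen (kvert h c) i0 i1); unfold sqlen in *.
      * rewrite d2_sym in B4. congruence.
      * rewrite d2_sym in B2. congruence.
      * congruence.
      * rewrite d2_sym in B1. congruence.
      * congruence.
      * congruence.
    + assert (E : svQ Q = - svQ (kvert h c')).
      { unfold Q, svQ at 1. simpl. rewrite (svQ_perm (kvert h c') i2 i1 i0 i3 D). reflexivity. }
      rewrite E.
      assert (svQ (kvert h c) * svQ (kvert h c') <> 0) by (apply Rmult_integral_contrapositive; auto).
      lra.
    + intros x. unfold Q, inhullQ at 1. simpl. apply (inhull_perm (kvert h c') i2 i1 i0 i3 x D).
Qed.

Lemma kuhn_tiling h T : 0 < h -> svQ (vt T) <> 0 ->
  (forall a b, sqlen (vt T) a b = sqlen (kvert h (0, 0, 0, s012)%Z) a b) ->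
  op_ftf_tiling T cell (ktile h).
Proof.
  intros Hh HT HL.
  assert (Hb : forall c c', exists b : idx -> bool, forall k, b k = true <-> shared c c' k).
  { intros c c'. exists (fun k => if excluded_middle_informative (shared c c' k) then true else false).
    intros k. destruct (excluded_middle_informative _); split; auto; discriminate. }
  assert (Hne : forall c c' (b : idx -> bool), c <> c' -> (forall k, b k = true <-> shared c c' k) -> exists k, b k = false).
  { intros c c' b N Hbk. apply NNPP. intro K. apply N. apply shared_all. intros k. apply Hbk.
    destruct (b k) eqn:E; auto. exfalso. apply K. exists k; auto. }
  split; [split; [|split; [|split]]|].
  - intros c. destruct (kvert_len h c) as (A1 & A2 & A3 & A4 & A5 & A6).
    destruct (kvert_len h (0, 0, 0, s012)%Z) as (B1 & B2 & B3 & B4 & B5 & B6).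
    destruct (congruent (vt T) (kvert h c) HT) as (f & F1 & F2 & _).
    { intros a b. rewrite HL. apply sqlen_ext; congruence. }
    exists f. split; auto. intros x. rewrite (hull_ktile h c x), <- (F2 x).
    apply image_ext. intros y. symmetry. apply hull_inhull.
  - apply kuhn_cover; auto.
  (* A point interior to both tiles would be interior to their intersection, which is spanned by a
     proper subset of the vertices. *)
  - intros c c' N x [I1 I2]. destruct (Hb c c') as [b Hbk]. destruct (Hne c c' b N Hbk) as [k Hk].
    apply (hull_sub_no_interior h Hh c b k x Hk).
    destruct I1 as (e1 & P1 & K1). destruct I2 as (e2 & P2 & K2).
    exists (Rmin e1 e2). split; [apply Rmin_glb_lt; auto|]. intros y Hy.
    pose proof (Rmin_l e1 e2). pose proof (Rmin_r e1 e2).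
    apply (shared_hull_sub h Hh c c' b Hbk). split; [apply K1|apply K2]; lra.
  - intros c c' N. destruct (Hb c c') as [b Hbk]. destruct (Hb c' c) as [b' Hbk'].
    destruct (Hne c c' b N Hbk) as [k Hk]. destruct (Hne c' c b' (not_eq_sym N) Hbk') as [k' Hk'].
    pose proof (shared_hull_sub h Hh c c' b Hbk) as S1. pose proof (shared_hull_sub h Hh c' c b' Hbk') as S2.
    destruct (classic (exists x, hull (ktile h c) x /\ hull (ktile h c') x)) as [[x Hx]|E];
      [right|left; intros x Hx; apply E; exists x; auto].
    assert (NE : forall c (b : idx -> bool), hull_sub (ktile h c) (b i0) (b i1) (b i2) (b i3) x -> (b i0 || b i1 || b i2 || b i3)%bool = true).
    { clear. intros c b H. apply hull_sub_lin4 in H.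
      destruct H as (s & t & u & v & _ & _ & _ & _ & S & K0 & K1 & K2 & K3 & _).
      destruct (Req_dec s 0) as [Z0|Z0]; [|rewrite K0 by auto; auto].
      destruct (Req_dec t 0) as [Z1|Z1]; [|rewrite K1 by auto; rewrite !orb_true_r; auto].
      destruct (Req_dec u 0) as [Z2|Z2]; [|rewrite K2 by auto; rewrite !orb_true_r; auto].
      rewrite K3 by lra. rewrite !orb_true_r; auto. }
    assert (Pr : forall (b : idx -> bool) k, b k = false -> (b i0 && b i1 && b i2 && b i3)%bool = false).
    { clear. intros b k H. destruct k; rewrite H, ?andb_false_r; auto. }
    exists (fun x => hull (ktile h c) x /\ hull (ktile h c') x). split; [|split].
    + exists (b i0), (b i1), (b i2), (b i3). split; [|split].
      * apply (NE c). apply S1; auto.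
      * apply (Pr b k); auto.
      * exact S1.
    + exists (b' i0), (b' i1), (b' i2), (b' i3). split; [|split].
      * apply (NE c'). apply S2; tauto.
      * apply (Pr b' k'); auto.
      * intros y. rewrite <- (S2 y). tauto.
    + intros y; tauto.
  - intros c c'. apply kuhn_oriented; auto.
Qed.

(** * The special tetrahedron and the comparison of areas *)

Lemma dist_d2_eq a b k : 0 <= k -> dist a b = k -> d2 a b = k * k.
Proof. intros H E. rewrite <- dist_sq, E. reflexivity. Qed.

Lemma isos_face_d2 s a b c : 0 < s -> isos_face s a b c ->
  (d2 a b = 4 * (s*s) /\ d2 b c = 3 * (s*s) /\ d2 a c = 3 * (s*s)) \/
  (d2 b c = 4 * (s*s) /\ d2 a b = 3 * (s*s) /\ d2 a c = 3 * (s*s)) \/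
  (d2 a c = 4 * (s*s) /\ d2 a b = 3 * (s*s) /\ d2 b c = 3 * (s*s)).
Proof.
  intros Hs H.
  assert (K4 : forall x y, dist x y = 2 * s -> d2 x y = 4 * (s*s))
    by (intros x y E; rewrite (dist_d2_eq _ _ (2*s)) by lra; ring).
  assert (K3 : forall x y, dist x y = sqrt 3 * s -> d2 x y = 3 * (s*s)).
  { intros x y E. rewrite (dist_d2_eq _ _ (sqrt 3 * s)); auto.
    - replace (sqrt 3 * s * (sqrt 3 * s)) with (sqrt 3 * sqrt 3 * (s*s)) by ring. rewrite sqrt_sqrt by lra. ring.
    - apply Rmult_le_pos; [apply sqrt_pos|lra]. }
  destruct H as [(H1 & H2 & H3)|[(H1 & H2 & H3)|(H1 & H2 & H3)]];
  [left|right; left|right; right]; auto.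
Qed.

(** Each face has exactly one long edge, so the two long edges are opposite. The three choices of
    such a pair give the three labellings, in which [ac] and [bd] are long as in the Kuhn
    simplices. *)
Lemma special_shape T : is_scaled_special T -> exists s a b c d, 0 < s /\ dst a b c d /\
  let L := sqlen (vt T) in
  L a b = 3 * (s*s) /\ L a c = 4 * (s*s) /\ L a d = 3 * (s*s) /\
  L b c = 3 * (s*s) /\ L b d = 4 * (s*s) /\ L c d = 3 * (s*s).
Proof.
  intros (s & Hs & F1 & F2 & F3 & F4). exists s.
  apply isos_face_d2 in F1, F2, F3, F4; auto.
  assert (Pw : 0 < s * s) by nra. set (w := s * s) in *. clearbody w.
  unfold sqlen.
  destruct F1 as [(A1&A2&A3)|[(A1&A2&A3)|(A1&A2&A3)]];
  destruct F2 as [(B1&B2&B3)|[(B1&B2&B3)|(B1&B2&B3)]]; try (exfalso; lra);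
  destruct F3 as [(C1&C2&C3)|[(C1&C2&C3)|(C1&C2&C3)]]; try (exfalso; lra);
  destruct F4 as [(D1&D2&D3)|[(D1&D2&D3)|(D1&D2&D3)]]; try (exfalso; lra);
  first
  [ exists i0, i2, i1, i3; (split; [assumption|split; [repeat split; congruence|]]); simpl; rewrite ?(d2_sym (v2 T) (v1 T)); repeat split; lra
  | exists i0, i1, i2, i3; (split; [assumption|split; [repeat split; congruence|]]); simpl; repeat split; lra
  | exists i0, i1, i3, i2; (split; [assumption|split; [repeat split; congruence|]]); simpl; rewrite ?(d2_sym (v3 T) (v2 T)); repeat split; lra ].
Qed.

Lemma special_area T : tvol T = 1 -> forall s a b c d, 0 < s -> dst a b c d ->
  let L := sqlen (vt T) in
  L a b = 3 * (s*s) -> L a c = 4 * (s*s) -> L a d = 3 * (s*s) ->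
  L b c = 3 * (s*s) -> L b d = 4 * (s*s) -> L c d = 3 * (s*s) -> tarea T ^ 6 = 165888.
Proof.
  intros HV s a b c d Hs Hd L H1 H2 H3 H4 H5 H6. unfold L, sqlen in *. clear L.
  pose proof (tvol_sv T HV) as E.
  assert (Ev : svsq d2 (vt T a) (vt T b) (vt T c) (vt T d) = 36).
  { rewrite svsq_d2, svQ_perm by auto. unfold svQ. simpl vt. destruct (even a b c d); rewrite <- E; ring. }
  assert (Ew : 16 * (s*s)^3 = 36) by (rewrite <- Ev; unfold svsq, gram; rewrite H1, H2, H3, H4, H5, H6; field).
  assert (Ea : asum d2 (vt T a) (vt T b) (vt T c) (vt T d) = 2 * tarea T).
  { rewrite tarea_asum. perms a b c d Hd; unfold asum; simpl vt; nn_sort (v0 T) (v1 T) (v2 T) (v3 T); ring. }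
  assert (N : forall x, x = 8 * ((s*s)*(s*s)) -> sqrt x = sqrt 8 * (s*s)).
  { intros x ->. rewrite sqrt_mult by nra. rewrite sqrt_square by nra. reflexivity. }
  unfold asum in Ea.
  rewrite (N (nn d2 (vt T a) (vt T b) (vt T c))), (N (nn d2 (vt T a) (vt T b) (vt T d))),
    (N (nn d2 (vt T a) (vt T c) (vt T d))), (N (nn d2 (vt T b) (vt T c) (vt T d))) in Ea
    by (unfold nn, gram; rewrite ?H1, ?H2, ?H3, ?H4, ?H5, ?H6; field).
  assert (Et : tarea T = 2 * sqrt 8 * (s*s)) by lra.
  rewrite Et. replace ((2 * sqrt 8 * (s*s))^6) with (64 * (sqrt 8 * sqrt 8)^3 * ((s*s)^3)^2) by ring.
  rewrite sqrt_sqrt by lra. replace ((s*s)^3) with (9/4) by lra. field.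
Qed.

Lemma pow6_lt x y : 0 <= x -> x < y -> x ^ 6 < y ^ 6.
Proof.
  intros Hx H. assert (x * x < y * y) by nra. assert (x*x*x < y*y*y) by nra.
  replace (x^6) with ((x*x*x)*(x*x*x)) by ring. replace (y^6) with ((y*y*y)*(y*y*y)) by ring.
  assert (0 <= x*x*x) by (apply Rmult_le_pos; nra). nra.
Qed.

Lemma tarea_ge0 T : 0 <= tarea T.
Proof.
  assert (K : forall a b c, 0 <= tri_area a b c) by (intros; unfold tri_area; apply Rmult_le_pos; [apply sqrt_pos|lra]).
  unfold tarea. pose proof (K (v0 T) (v1 T) (v2 T)). pose proof (K (v0 T) (v1 T) (v3 T)).
  pose proof (K (v0 T) (v2 T) (v3 T)). pose proof (K (v1 T) (v2 T) (v3 T)). lra.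
Qed.

Theorem theorem5p2 :
  forall T : tet, is_scaled_special T -> tvol T = 1 ->
    admits_op_ftf_tiling T /\
    (forall T' : tet, tvol T' = 1 -> admits_op_ftf_tiling T' -> tarea T <= tarea T').
Proof.
  intros T HS HV.
  destruct (special_shape T HS) as (s & a & b & c & d & Hs & Hd & L1 & L2 & L3 & L4 & L5 & L6).
  assert (Hsv : svQ (vt T) <> 0).
  { pose proof (tvol_sv T HV) as E. unfold svQ; simpl. intro Z. rewrite Z in E. lra. }
  split.
  - exists cell, (ktile s).
    assert (HK : op_ftf_tiling (relabel T a b c d) cell (ktile s)).
    { apply kuhn_tiling; auto; [apply relabel_svQ; auto|].
      destruct (kvert_len s (0, 0, 0, s012)%Z) as (B1 & B2 & B3 & B4 & B5 & B6).
      apply sqlen_ext; [rewrite B1; exact L1|rewrite B2; exact L2|rewrite B3; exact L3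
        |rewrite B4; exact L4|rewrite B5; exact L5|rewrite B6; exact L6]. }
    destruct HK as ((K1 & K2) & K3). split; [split; auto|auto].
    intros i. destruct (K1 i) as (f & Hf & E). exists f. split; auto.
    apply (seteq_trans _ _ _ E). apply image_ext, relabel_hull; auto.
  - intros T' HV' HA'.
    pose proof (special_area T HV s a b c d Hs Hd L1 L2 L3 L4 L5 L6) as E.
    pose proof (tarea_lower_bound T' HV' HA') as B.
    destruct (Rle_or_lt (tarea T) (tarea T')) as [|Lt]; auto.
    apply pow6_lt in Lt; [lra|apply tarea_ge0].
Qed.
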